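(* Let $m,n\ge 0$ be integers with $m+n\geq 1$, let $\mathfrak{b}$ be an $\epsilon$-$\delta$ sequence for $\mathfrak{gl}(m|n)$ (equivalently, a choice of Borel subalgebra of $\mathfrak{gl}(m|n)$), and let $\lambda$ be an $(m|n)$-hook partition. Let $\hat{\mathfrak{b}}$ be the $\epsilon$-$\delta$ sequence obtained from $\mathfrak{b}$ by deleting its last entry, and let $\hat m$ (respectively $\hat n$) be the number of $\delta$'s (respectively $\epsilon$'s) in $\hat{\mathfrak{b}}$, so that either $(\hat m,\hat n)=(m,n-1)$ or $(\hat m,\hat n)=(m-1,n)$. With respect to the embedding $\mathfrak{gl}(\hat m|\hat n)\subset\mathfrak{gl}(m|n)$ described in the context, \[ L_{m|n}(\mathfrak{b},\lambda^{\mathfrak{b}})\downarrow_{\mathfrak{gl}(\hat m|\hat n)}\;\cong\;\bigoplus_{\sigma} L_{\hat m|\hat n}(\hat{\mathfrak{b}},\sigma^{\hat{\mathfrak{b}}}), \] where the sum is over all $(\hat m|\hat n)$-hook partitions $\sigma$ (each occurring exactly once) such that (1) $\sigma'$ interlaces $\lambda'$, if $\hat m=m$; (2) $\sigma$ interlaces $\lambda$, if $\hat n=n$.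
   Context: The ground field is $\mathbb{C}$. A partition is a weakly decreasing sequence $\lambda=(\lambda_1,\lambda_2,\ldots)$ of non-negative integers with finitely many nonzero entries; $\lambda'$ is the conjugate partition. $\lambda$ is an $(m|n)$-hook partition if $\lambda_{m+1}\le n$. A partition $\mu$ interlaces a partition $\lambda$ if $\lambda_i\ge\mu_i\ge\lambda_{i+1}$ for all $i\geq 1$. $\mathfrak{gl}(m|n)$ is the Lie superalgebra of $(m+n)\times(m+n)$ complex matrices with even part the block-diagonal matrices $\mathfrak{gl}(m)\oplus\mathfrak{gl}(n)$. $\mathfrak{h}$ is the Cartan subalgebra of diagonal matrices, with basis $h_i=E_{ii}$, $1\le i\le m+n$, and dual basis $\delta_1,\dots,\delta_m,\epsilon_1,\dots,\epsilon_n$ of $\mathfrak{h}^*$, where $\delta_i(h_k)=1$ if $k=i$ and $0$ otherwise, and $\epsilon_j(h_k)=1$ if $k=m+j$ and $0$ otherwise. The set $\Phi$ of roots consists of the differences of two distinct elements of $\{\delta_1,\dots,\delta_m,\epsilon_1,\dots,\epsilon_n\}$. An $\epsilon$-$\delta$ sequence for $\mathfrak{gl}(m|n)$ is a sequence $\mathfrak{b}$ consisting of $m$ symbols $\delta$ and $n$ symbols $\epsilon$. Label the $\delta$'s as $\delta_1,\dots,\delta_m$ and the $\epsilon$'s as $\epsilon_1,\dots,\epsilon_n$ in the order in which they appear. The differences of consecutive labelled letters (earlier minus later) form a set of simple roots of $\Phi$; the positive roots $\Phi^+(\mathfrak{b})$ are all differences $x-y$ with $x$ appearing before $y$. The corresponding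 Borel subalgebra is $\mathfrak{h}\oplus\bigoplus_{\alpha\in\Phi^+(\mathfrak{b})}\mathfrak{gl}(m|n)_\alpha$, also denoted $\mathfrak{b}$. Every Borel subalgebra is conjugate to exactly one of these, and ''Borel subalgebra'' always means one of these. For $\omega\in\mathfrak{h}^*$, $L_{m|n}(\mathfrak{b},\omega)$ denotes the simple $\mathfrak{gl}(m|n)$-module of highest weight $\omega$ with respect to $\mathfrak{b}$. For an $(m|n)$-hook partition $\lambda$, let $d_i$ be the number of $\epsilon$'s appearing before the $i$-th $\delta$ in $\mathfrak{b}$ and $e_j$ the number of $\delta$'s appearing before the $j$-th $\epsilon$ in $\mathfrak{b}$, and put \[ \lambda^{\mathfrak{b}}=\sum_{i=1}^m\max\{\lambda_i-d_i,0\}\,\delta_i+\sum_{j=1}^n\max\{\lambda'_j-e_j,0\}\,\epsilon_j . \] Embedding: set $\hat h=h_m$ if $\hat n=n$ (last entry of $\mathfrak{b}$ is $\delta$), and $\hat h=h_{m+n}$ if $\hat m=m$ (last entry is $\epsilon$). Let $\hat{\mathfrak{h}}$ be the span of the remaining $h_i$, so $\hat{\mathfrak{h}}\oplus\mathbb{C}\hat h=\mathfrak{h}$, and regard $\hat{\mathfrak{h}}^*\subset\mathfrak{h}^*$ as the functionals vanishing on $\hat h$. Then $\mathfrak{gl}(\hat m|\hat n)$ is identified with $\hat{\mathfrak{h}}\oplus\bigoplus_{\alpha\in\Phi\cap\hat{\mathfrak{h}}^*}\mathfrak{gl}(m|n)_\alpha$, i.e. the matrices whose $m$-th row and column (if $\hat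 n=n$), respectively $(m+n)$-th row and column (if $\hat m=m$), are zero. If $\hat m=\hat n=0$, then $\mathfrak{gl}(0|0)=0$, the only $(0|0)$-hook partition is the empty one, and the corresponding module is $\mathbb{C}$. Isomorphisms of modules are understood up to parity shift of the simple summands. *)

(* Defs.v *)
From HB Require Import structures.
From mathcomp Require Import all_boot all_order all_algebra.
From mathcomp Require Import boolp classical_sets cardinality.
From mathcomp Require Import zify.

Set Implicit Arguments.
Unset Strict Implicit.
Unset Printing Implicit Defensive.

Import Order.TTheory GRing.Theory.
Local Open Scope ring_scope.
Local Open Scope classical_set_scope.

(* Partitions are stored without their trailing zeros; [part lam i] is the    *)
(* (i+1)-st entry of the infinite sequence, indices starting at 0.            *)
Definition is_part (s : seq nat) : bool := sorted geq s && (0%N \notin s).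

Record int_partition := IntPartition { pseq :> seq nat; _ : is_part pseq }.
HB.instance Definition _ := [isSub for pseq].
HB.instance Definition _ := [Choice of int_partition by <:].

Definition part (lam : int_partition) (i : nat) : nat := nth 0%N lam i.

Definition conj_part (lam : int_partition) (j : nat) : nat :=
  count (fun x => (j < x)%N) lam.

Definition hook (m n : nat) (lam : int_partition) : Prop := (part lam m <= n)%N.

Definition interlaces (mu lam : nat -> nat) : Prop :=
  forall i, (mu i <= lam i)%N /\ (lam i.+1 <= mu i)%N.

Inductive letter := Delta | Epsilon.

Definition is_delta (x : letter) : bool := if x is Delta then true else false.
Definition is_epsilon (x : letter) : bool := ~~ is_delta x.

Record edseq (m n : nat) := EDSeq {
  letters :> seq letter;
  count_delta : count is_delta letters = m;
  count_epsilon : count is_epsilon letters = n }.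

(* The index set {1, ..., m+n} of rows and columns is 'I_(m + n); its first m *)
(* elements are the indices of delta_1, ..., delta_m, the other ones those of *)
(* epsilon_1, ..., epsilon_n. [labels b] lists the indices of the labelled    *)
(* letters of b in the order in which they occur in b.                        *)
Definition labels m n (b : edseq m n) : seq nat :=
  [seq (if nth Delta b p is Delta then count is_delta (take p b)
        else m + count is_epsilon (take p b))%N | p <- iota 0 (size b)].

Definition position m n (b : edseq m n) (i : nat) : nat := index i (labels b).

Definition del_last m n (b : edseq m n) : seq letter := take (size b).-1 b.

Definition mhat m n (b : edseq m n) : nat := count is_delta (del_last b).
Definition nhat m n (b : edseq m n) : nat := count is_epsilon (del_last b).

Definition hat m n (b : edseq m n) : edseq (mhat b) (nhat b) :=
  @EDSeq (mhat b) (nhat b) (del_last b) erefl erefl.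

Lemma mhat_le m n (b : edseq m n) : (mhat b <= m)%N.
Proof.
rewrite -[leqRHS](count_delta b) -[in leqRHS](cat_take_drop (size b).-1 b).
by rewrite count_cat leq_addr.
Qed.

Lemma nhat_le m n (b : edseq m n) : (nhat b <= n)%N.
Proof.
rewrite -[leqRHS](count_epsilon b) -[in leqRHS](cat_take_drop (size b).-1 b).
by rewrite count_cat leq_addr.
Qed.

(* delta_i is sent to delta_i and epsilon_j to epsilon_j; the missed index is *)
(* m (resp. m+n) if b ends with a delta (resp. an epsilon).                   *)
Definition hat_idx m n (b : edseq m n) (a : 'I_(mhat b + nhat b)) :
    'I_(m + n) :=
  match fintype.split a with
  | inl i => lshift n (widen_ord (mhat_le b) i)
  | inr j => rshift m (widen_ord (nhat_le b) j)
  end.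

Definition parity m n (i : 'I_(m + n)) : bool := (m <= i)%N.

Lemma hat_idx_inj m n (b : edseq m n) : injective (@hat_idx m n b).
Proof.
move=> a c; rewrite /hat_idx.
case: (fintype.splitP a) => i ai; case: (fintype.splitP c) => j cj;
  move=> /(congr1 val) /= e; apply: val_inj; rewrite /= ai cj //.
- by have := ltn_ord i; have := mhat_le b; lia.
- by have := ltn_ord j; have := mhat_le b; lia.
- lia.
Qed.

Lemma parity_hat_idx m n (b : edseq m n) a :
  parity (@hat_idx m n b a) = parity a.
Proof.
rewrite /parity /hat_idx; case: (fintype.splitP a) => i ai /=; rewrite ai.
  by rewrite leqNgt (leq_trans (ltn_ord i) (mhat_le b)) leqNgt ltn_ord.
by rewrite !leq_addr.
Qed.

Section GeneralLinear.
Variable F : fieldType.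

(* The truncated subtraction of nat computes max{x - y, 0}.                   *)
Definition lambda_wt m n (b : edseq m n) (lam : int_partition) :
    'rV[F]_(m + n) :=
  \row_k (match fintype.split k with
          | inl i => part lam i - count is_epsilon (take (position b k) b)
          | inr j => conj_part lam j - count is_delta (take (position b k) b)
          end)%N%:R.

(* A weight (element of h^* ) is the row of its coordinates in the basis      *)
(* delta_1, ..., epsilon_n; an element diag_mx h of the Cartan subalgebra is  *)
(* given by its diagonal h.                                                   *)
Definition wt_eval N (w h : 'rV[F]_N) : F := \sum_i w 0 i * h 0 i.

Definition gl_part m n (p : bool) (A : 'M[F]_(m + n)) : 'M[F]_(m + n) :=
  \matrix_(i, j) (if parity i (+) parity j == p then A i j else 0).

Definition gl_homog m n (p : bool) (A : 'M[F]_(m + n)) : Prop :=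
  gl_part p A = A.

Definition sbracket m n (A B : 'M[F]_(m + n)) : 'M[F]_(m + n) :=
  \sum_(p : bool) \sum_(q : bool)
    (gl_part p A *m gl_part q B
     - (-1) ^+ (p && q) *: (gl_part q B *m gl_part p A)).

Definition coord_wt N (i : 'I_N) : 'rV[F]_N := delta_mx 0 i.

Definition positive_root m n (b : edseq m n) (alpha : 'rV[F]_(m + n)) : Prop :=
  exists i j : 'I_(m + n),
    (position b i < position b j)%N /\ alpha = coord_wt i - coord_wt j.

Definition root_space m n (alpha : 'rV[F]_(m + n)) (A : 'M[F]_(m + n)) : Prop :=
  forall h : 'rV[F]_(m + n), sbracket (diag_mx h) A = wt_eval alpha h *: A.

(* The inclusion gl(mhat|nhat) -> gl(m|n), sending E_ac to the matrix unit    *)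
(* at (hat_idx a, hat_idx c).                                                 *)
Definition gl_embed m n (b : edseq m n) (A : 'M[F]_(mhat b + nhat b)) :
    'M[F]_(m + n) :=
  \sum_a \sum_c A a c *: delta_mx (hat_idx a) (hat_idx c).

(* gl(m|n)-supermodules; [homog p] is the homogeneous component of parity p.  *)
Record supermodule m n := Supermodule {
  carrier :> lmodType F;
  homog : bool -> set carrier;
  sm_act : 'M[F]_(m + n) -> carrier -> carrier;
  homog0 : forall p, homog p 0;
  homogD : forall p a u v, homog p u -> homog p v -> homog p (a *: u + v);
  homog_split : forall v, exists v0 v1,
    [/\ homog false v0, homog true v1 & v = v0 + v1];
  homog_disj : forall v, homog false v -> homog true v -> v = 0;
  act_linl : forall v a A B,
    sm_act (a *: A + B) v = a *: sm_act A v + sm_act B v;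
  act_linr : forall A a u v,
    sm_act A (a *: u + v) = a *: sm_act A u + sm_act A v;
  act_homog : forall p q A v,
    gl_homog p A -> homog q v -> homog (p (+) q) (sm_act A v);
  act_bracket : forall p q A B v, gl_homog p A -> gl_homog q B ->
    sm_act (sbracket A B) v
    = sm_act A (sm_act B v) - (-1) ^+ (p && q) *: sm_act B (sm_act A v) }.

Definition sub_supermodule m n (V : supermodule m n) (S : set V) : Prop :=
  [/\ S 0,
      forall a u v, S u -> S v -> S (a *: u + v),
      forall A v, S v -> S (sm_act A v)
    & forall v0 v1, homog false v0 -> homog true v1 -> S (v0 + v1) ->
        S v0 /\ S v1].

Definition simple_sm m n (V : supermodule m n) : Prop :=
  (exists v : V, v <> 0) /\
  forall S : set V, sub_supermodule S -> S = [set 0] \/ S = setT.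

Definition highest_weight_vector m n (b : edseq m n) (w : 'rV[F]_(m + n))
    (V : supermodule m n) (v : V) : Prop :=
  [/\ v <> 0,
      exists p, homog p v,
      forall h, sm_act (diag_mx h) v = wt_eval w h *: v
    & forall alpha A, positive_root b alpha -> root_space alpha A ->
        sm_act A v = 0].

(* V is a model of L_{m|n}(b, w): this determines V up to isomorphism and     *)
(* parity shift.                                                              *)
Definition is_simple_hw m n (b : edseq m n) (w : 'rV[F]_(m + n))
    (V : supermodule m n) : Prop :=
  simple_sm V /\ exists v : V, highest_weight_vector b w v.

Definition sm_iso m n (V W : supermodule m n) : Prop :=
  exists f : {linear V -> W},
    [/\ bijective f,
        forall p v, homog p v -> homog p (f v)
      & forall A v, f (sm_act A v) = sm_act A (f v)].

Section ParityShift.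
Variables (m n : nat) (s : bool) (V : supermodule m n).

Lemma pshift_split (v : V) : exists v0 v1,
  [/\ homog (s (+) false) v0, homog (s (+) true) v1 & v = v0 + v1].
Proof.
have [v0 [v1 [h0 h1 ->]]] := homog_split v.
by case: s; [exists v1, v0; rewrite addrC | exists v0, v1].
Qed.

Lemma pshift_disj (v : V) :
  homog (s (+) false) v -> homog (s (+) true) v -> v = 0.
Proof. by case: s => /= h0 h1; apply: homog_disj. Qed.

Lemma pshift_act p q (A : 'M[F]_(m + n)) (v : V) :
  gl_homog p A -> homog (s (+) q) v -> homog (s (+) (p (+) q)) (sm_act A v).
Proof. by move=> hA /(act_homog hA); rewrite addbCA. Qed.

(* V if s = false, and its parity shift if s = true. The action is kept as it *)
(* is: the convention with a sign, (-1)^|A| A v, gives an isomorphic module.  *)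
Definition pshift : supermodule m n :=
  @Supermodule m n V (fun p => homog (s (+) p)) (@sm_act _ _ V)
    (fun p => homog0 V _) (fun p => @homogD _ _ V _)
    pshift_split pshift_disj (@act_linl _ _ V) (@act_linr _ _ V) pshift_act
    (@act_bracket _ _ V).
End ParityShift.

Section Restriction.
Variables (m n : nat) (b : edseq m n).

Lemma gl_embedD a (A B : 'M[F]_(mhat b + nhat b)) :
  gl_embed (a *: A + B) = a *: gl_embed A + gl_embed B.
Proof.
rewrite /gl_embed scaler_sumr -big_split /=; apply: eq_bigr => i _.
rewrite scaler_sumr -big_split /=; apply: eq_bigr => j _.
by rewrite !mxE scalerA scalerDl.
Qed.

Let P : 'M[F]_(mhat b + nhat b, m + n) := \matrix_(a, i) (hat_idx a == i)%:R.

Let PP : P *m P^T = 1%:M.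
Proof.
apply/matrixP => a c; rewrite !mxE (bigD1 (hat_idx a)) //= big1 => [|i ne].
  by rewrite !mxE eqxx mul1r addr0 (inj_eq (@hat_idx_inj _ _ b)) eq_sym.
by rewrite !mxE eq_sym (negPf ne) mul0r.
Qed.

Let gl_embedE A : gl_embed A = P^T *m A *m P.
Proof.
apply/matrixP => i j; rewrite /gl_embed summxE !mxE.
under eq_bigr do rewrite summxE.
rewrite exchange_big /=; apply: eq_bigr => c _.
rewrite !mxE big_distrl /=; apply: eq_bigr => a _.
rewrite !mxE !(eq_sym _ (hat_idx _)).
by case: eqP; case: eqP; rewrite ?(mulr0, mul0r, mulr1, mul1r).
Qed.

Lemma gl_embedM A B : gl_embed A *m gl_embed B = @gl_embed m n b (A *m B).
Proof.
by rewrite !gl_embedE -!mulmxA (mulmxA P) PP mul1mx.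
Qed.

Lemma gl_part_embed p A :
  gl_part p (gl_embed A) = @gl_embed m n b (gl_part p A).
Proof.
apply/matrixP => i j; rewrite /gl_embed !mxE !summxE.
transitivity (\sum_a if parity i (+) parity j == p then
   (\sum_c A a c *: delta_mx (@hat_idx m n b a) (hat_idx c)) i j else 0).
  by case: ifP => // _; rewrite big1.
apply: eq_bigr => a _; rewrite !summxE.
transitivity (\sum_c if parity i (+) parity j == p then
   (A a c *: delta_mx (@hat_idx m n b a) (hat_idx c)) i j else 0).
  by case: ifP => // _; rewrite big1.
apply: eq_bigr => c _; rewrite !mxE.
have [->|_] := eqVneq i (hat_idx a); last by rewrite !mulr0; case: ifP.
have [->|_] := eqVneq j (hat_idx c); last by rewrite !mulr0; case: ifP.
by rewrite !parity_hat_idx; case: ifP; rewrite ?mul0r.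
Qed.

Lemma gl_embed_homog p A : gl_homog p A -> gl_homog p (@gl_embed m n b A).
Proof. by rewrite /gl_homog gl_part_embed => ->. Qed.

Lemma gl_embed_sbracket A B :
  gl_embed (sbracket A B) = sbracket (@gl_embed m n b A) (gl_embed B).
Proof.
have e0 : @gl_embed m n b 0 = 0.
  rewrite /gl_embed big1 // => a _; rewrite big1 // => c _.
  by rewrite mxE scale0r.
have eZ x C : @gl_embed m n b (x *: C) = x *: gl_embed C.
  by rewrite -[x *: C]addr0 gl_embedD e0 addr0.
have eD C D : @gl_embed m n b (C + D) = gl_embed C + gl_embed D.
  by rewrite -[C]scale1r gl_embedD !scale1r.
rewrite /sbracket (big_morph _ eD e0); apply: eq_bigr => p _.
rewrite (big_morph _ eD e0); apply: eq_bigr => q _.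
by rewrite !gl_part_embed !gl_embedM -!scaleN1r !scalerA eD eZ.
Qed.

Variable V : supermodule m n.

Lemma restr_linl (v : V) a (A B : 'M[F]_(mhat b + nhat b)) :
  sm_act (gl_embed (a *: A + B)) v
  = a *: sm_act (gl_embed A) v + sm_act (gl_embed B) v.
Proof. by rewrite gl_embedD act_linl. Qed.

Lemma restr_homog p q (A : 'M[F]_(mhat b + nhat b)) (v : V) :
  gl_homog p A -> homog q v -> homog (p (+) q) (sm_act (gl_embed A) v).
Proof. by move=> /gl_embed_homog; apply: act_homog. Qed.

Lemma restr_bracket p q (A B : 'M[F]_(mhat b + nhat b)) (v : V) :
  gl_homog p A -> gl_homog q B ->
  sm_act (gl_embed (sbracket A B)) v
  = sm_act (gl_embed A) (sm_act (gl_embed B) v)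
    - (-1) ^+ (p && q) *: sm_act (gl_embed B) (sm_act (gl_embed A) v).
Proof.
move=> /gl_embed_homog hA /gl_embed_homog hB.
by rewrite gl_embed_sbracket (act_bracket _ hA hB).
Qed.

Definition sm_restrict : supermodule (mhat b) (nhat b) :=
  @Supermodule (mhat b) (nhat b) V (@homog _ _ V)
    (fun A => @sm_act _ _ V (gl_embed A))
    (@homog0 _ _ V) (@homogD _ _ V) (@homog_split _ _ V) (@homog_disj _ _ V)
    restr_linl (fun A => @act_linr _ _ V (gl_embed A))
    restr_homog restr_bracket.
End Restriction.

(* External direct sum of a possibly infinite family: finitely supported      *)
(* dependent functions.                                                       *)
Section DirectSum.
Variable I : Type.

Record dsum (V : I -> lmodType F) := DSum {
  dval :> forall i, V i;
  dval_fin : finite_set [set i | dval i != 0] }.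

HB.instance Definition _ V := gen_eqMixin (dsum V).
HB.instance Definition _ V := gen_choiceMixin (dsum V).

Section Module.
Variable V : I -> lmodType F.
Implicit Types f g h : dsum V.

Lemma dsumP f g : (forall i, f i = g i) -> f = g.
Proof.
case: f g => [f hf] [g hg] /= fg.
have e : f = g by apply: functional_extensionality_dep.
by case: _ / e hg => hg; congr DSum; apply: Prop_irrelevance.
Qed.

Lemma dsum0_fin : finite_set [set i | (0 : V i) != 0].
Proof.
apply: (sub_finite_set _ (finite_set0 I)) => i /=.
by rewrite eqxx.
Qed.

Lemma dsumN_fin f : finite_set [set i | - f i != 0].
Proof. by apply: (sub_finite_set _ (dval_fin f)) => i /=; rewrite oppr_eq0. Qed.

Lemma dsumD_fin f g : finite_set [set i | f i + g i != 0].
Proof.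
have h : finite_set ([set i | f i != 0] `|` [set i | g i != 0]).
  by rewrite finite_setU; split; apply: dval_fin.
apply: (sub_finite_set _ h) => i /=.
by have [->|] := eqVneq (f i) 0; [rewrite add0r; right | left].
Qed.

Lemma dsumZ_fin a f : finite_set [set i | a *: f i != 0].
Proof.
apply: (sub_finite_set _ (dval_fin f)) => i /=.
by apply: contra_neq => ->; rewrite scaler0.
Qed.

Let dsum_zero : dsum V := DSum dsum0_fin.
Let dsum_opp f : dsum V := DSum (dsumN_fin f).
Let dsum_add f g : dsum V := DSum (dsumD_fin f g).
Let dsum_scale a f : dsum V := DSum (dsumZ_fin a f).

Fact dsum_addA : associative dsum_add.
Proof. by move=> f g h; apply: dsumP => i /=; rewrite addrA. Qed.
Fact dsum_addC : commutative dsum_add.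
Proof. by move=> f g; apply: dsumP => i /=; rewrite addrC. Qed.
Fact dsum_add0 : left_id dsum_zero dsum_add.
Proof. by move=> f; apply: dsumP => i /=; rewrite add0r. Qed.
Fact dsum_addN : left_inverse dsum_zero dsum_opp dsum_add.
Proof. by move=> f; apply: dsumP => i /=; rewrite addNr. Qed.

HB.instance Definition _ := GRing.isZmodule.Build (dsum V)
  dsum_addA dsum_addC dsum_add0 dsum_addN.

Fact dsum_scaleA a c f : dsum_scale a (dsum_scale c f) = dsum_scale (a * c) f.
Proof. by apply: dsumP => i /=; rewrite scalerA. Qed.
Fact dsum_scale1 : left_id 1 dsum_scale.
Proof. by move=> f; apply: dsumP => i /=; rewrite scale1r. Qed.
Fact dsum_scaleDr : right_distributive dsum_scale +%R.
Proof. by move=> a f g; apply: dsumP => i /=; rewrite scalerDr. Qed.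
Fact dsum_scaleDl f : {morph dsum_scale^~ f : a c / a + c}.
Proof. by move=> a c; apply: dsumP => i /=; rewrite scalerDl. Qed.

HB.instance Definition _ := GRing.Zmodule_isLmodule.Build F (dsum V)
  dsum_scaleA dsum_scale1 dsum_scaleDr dsum_scaleDl.
End Module.

Variables (m n : nat) (W : I -> supermodule m n).
Implicit Types (A B : 'M[F]_(m + n)) (f g : dsum W).

Lemma act0 (V : supermodule m n) A : sm_act A (0 : V) = 0.
Proof.
by have := act_linr A 1 (0 : V) 0; rewrite !scale1r addr0 => /eqP;
  rewrite -subr_eq0 opprD addNKr oppr_eq0 => /eqP.
Qed.

Definition dsum_homog p : set (dsum W) := [set f | forall i, homog p (f i)].

Lemma dsum_act_fin A f : finite_set [set i | sm_act A (f i) != 0].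
Proof.
apply: (sub_finite_set _ (dval_fin f)) => i /=.
by apply: contra_neq => ->; rewrite act0.
Qed.

Definition dsum_act A f : dsum W := DSum (dsum_act_fin A f).

Lemma dsum_homog0 p : dsum_homog p 0.
Proof. by move=> i; apply: homog0. Qed.

Lemma dsum_homogD p a f g :
  dsum_homog p f -> dsum_homog p g -> dsum_homog p (a *: f + g).
Proof. by move=> hf hg i; apply: homogD. Qed.

Lemma dsum_disj f : dsum_homog false f -> dsum_homog true f -> f = 0.
Proof. by move=> h0 h1; apply: dsumP => i; apply: homog_disj. Qed.

Lemma dsum_split f : exists f0 f1,
  [/\ dsum_homog false f0, dsum_homog true f1 & f = f0 + f1].
Proof.
have [g hg] : exists g : forall i, W i * W i, forall i,
    [/\ homog false (g i).1, homog true (g i).2 & f i = (g i).1 + (g i).2].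
  have ex i : exists u : W i * W i,
      [/\ homog false u.1, homog true u.2 & f i = u.1 + u.2].
    by have [v0 [v1 ?]] := homog_split (f i); exists (v0, v1).
  by exists (fun i => projT1 (cid (ex i))) => i; case: cid.
have g0 i : f i = 0 -> (g i).1 = 0 /\ (g i).2 = 0.
  have [h0 h1 ->] := hg i => /eqP; rewrite addr_eq0 => /eqP e.
  suff z : (g i).2 = 0 by rewrite e z oppr0.
  apply: homog_disj h1; rewrite -[(g i).2]opprK -e -scaleN1r -[_ *: _]addr0.
  exact: homogD h0 (homog0 _ _).
have fin1 : finite_set [set i | (g i).1 != 0].
  apply: (sub_finite_set _ (dval_fin f)) => i /=.
  by apply: contra_neq => /g0 [].
have fin2 : finite_set [set i | (g i).2 != 0].
  apply: (sub_finite_set _ (dval_fin f)) => i /=.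
  by apply: contra_neq => /g0 [].
exists (DSum fin1), (DSum fin2); split=> [i|i|] /=; try by case: (hg i).
by apply: dsumP => i /=; case: (hg i).
Qed.

Lemma dsum_linl f a A B :
  dsum_act (a *: A + B) f = a *: dsum_act A f + dsum_act B f.
Proof. by apply: dsumP => i; apply: act_linl. Qed.

Lemma dsum_linr A a f g :
  dsum_act A (a *: f + g) = a *: dsum_act A f + dsum_act A g.
Proof. by apply: dsumP => i; apply: act_linr. Qed.

Lemma dsum_act_homog p q A f :
  gl_homog p A -> dsum_homog q f -> dsum_homog (p (+) q) (dsum_act A f).
Proof. by move=> hA hf i; apply: act_homog. Qed.

Lemma dsum_bracket p q A B f : gl_homog p A -> gl_homog q B ->
  dsum_act (sbracket A B) f
  = dsum_act A (dsum_act B f) - (-1) ^+ (p && q) *: dsum_act B (dsum_act A f).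
Proof. by move=> hA hB; apply: dsumP => i; apply: act_bracket. Qed.

Definition sm_dsum : supermodule m n :=
  @Supermodule m n (dsum W) dsum_homog dsum_act dsum_homog0 dsum_homogD
    dsum_split dsum_disj dsum_linl dsum_linr dsum_act_homog dsum_bracket.
End DirectSum.
End GeneralLinear.

Definition branching_set m n (b : edseq m n) (lam : int_partition) :
    set int_partition :=
  [set sigma | [/\ hook (mhat b) (nhat b) sigma,
    mhat b = m -> interlaces (conj_part sigma) (conj_part lam)
  & nhat b = n -> interlaces (part sigma) (part lam)]].

(* Main.v *)
Require Import Defs.
From HB Require Import structures.
From mathcomp Require Import all_boot all_order all_algebra.
From mathcomp Require Import boolp classical_sets cardinality reals complex.
From mathcomp Require Import zify ring.

(* For every total order of the letters, a highest weight vector of a module  *)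
(* with nonnegative integral weights (a polynomial module) has a weight of    *)
(* the form lambda^b: exchanging two adjacent letters changes the highest     *)
(* weight by an explicit rule, and nonnegativity of all the weights obtained  *)
(* in this way forces the successive values to be the lengths of the rows and *)
(* columns peeled off a hook partition.                                       *)
(*                                                                            *)
(* In a unitary module U generated by a highest weight vector, the vectors    *)
(* that are singular for the smaller algebra inject into the quotient of U by *)
(* the image of its lowering operators, which is spanned by the monomials in  *)
(* the root vectors of the deleted letter N.  With N last this bounds the     *)
(* weights sigma of these vectors above by lambda and shows multiplicity one; *)
(* with N first it bounds them below by lambda minus its first row (column).  *)
(* Together these are the interlacing conditions, so dim L(lambda) is at most *)
(* the number s(lambda) of chains of interlacing partitions.                  *)
(*                                                                            *)
(* The same argument shows that all constituents of C^{m|n} (x) L(lambda) are *)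
(* L(mu) with mu = lambda + box, each at most once.  By the Pieri identity,   *)
(* sum_mu s(mu) = (m + n) s(lambda), so that by induction on |lambda| all the *)
(* inequalities are equalities: each such mu occurs, dim L(mu) = s(mu), and   *)
(* each interlacing sigma occurs in the restriction of L(mu).                 *)

Set Implicit Arguments.
Unset Strict Implicit.
Unset Printing Implicit Defensive.

Import Order.TTheory GRing.Theory Num.Theory.

(** * Partitions *)

(** The algebra acts through operators [E i j] on a plain vector space ([glrep]), and an order on
    the indices replaces the Borel subalgebra. The branching is semisimple because of unitarity: the
    modules in question occur in tensor powers of the natural module, which carry a positive
    definite form for which [E i j] and [E j i] are adjoint. Singular vectors are then orthogonal to
    the image of the lowering operators, so a spanning set of the quotient by that image controls
    their weights and multiplicities ([cover_exists], [cover_unique]). Orthogonal complements of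
    submodules are submodules, which gives complete reducibility ([sing_decomp]), and a highest
    weight vector generates an irreducible module ([hwv_irred]).

    Upper bound: even and odd reflections ([swap_even], [swap_odd]), together with nonnegativity of
    weights, force every highest weight to come from a hook partition ([hw_partition]) and show how
    it changes with the order ([swap_wt]). Placing the deleted letter last, then first, confines the
    constituents of a restriction to interlacing partitions, each at most once ([branch_strip],
    [branch_unique]). Iterating this bounds dimensions by a number of chains of partitions
    ([dim_gen_le]).

    Lower bound: no singular vector is written down. Tensoring with the natural module adds one box,
    and the combinatorial identity [pieri] says that the upper bounds for the possible constituents
    add up to exactly the dimension available, so every bound is attained ([tens_step],
    [exists_model]). Equality of dimensions then makes every interlacing partition occur and the sum
    direct ([full_branching]).

    Transfer to supermodules: in a module generated by a homogeneous highest weight vector the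
    weight of a vector determines its parity, so a simple supermodule is irreducible even without
    its grading ([simple_irred]) and is isomorphic to the unitary model by [hw_iso]. On each summand
    the discrepancy of parities is constant, because the sum of all weight coordinates is constant
    ([total_weight]); this gives the parity shifts in [branching_rule]. *)

Definition empty_part := @IntPartition [::] isT.

Lemma part_sorted (lam : int_partition) : sorted geq lam.
Proof. by case: lam => s /= /andP[]. Qed.

Lemma part_noz (lam : int_partition) : 0 \notin (lam : seq nat).
Proof. by case: lam => s /= /andP[]. Qed.

Lemma geq_trans : transitive geq.
Proof. by move=> a b c /= h1 h2; apply: leq_trans h2 h1. Qed.

Lemma part_pos (lam : int_partition) i : (0 < part lam i) = (i < size lam).
Proof.
rewrite /part; case: (ltnP i (size lam)) => hi; last by rewrite nth_default.
rewrite lt0n; apply: contra (part_noz lam) => /eqP <-; exact: mem_nth.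
Qed.

Lemma part_decr (lam : int_partition) i j : i <= j -> part lam j <= part lam i.
Proof.
move=> hij; rewrite /part; case: (ltnP j (size lam)) => hj; last by rewrite nth_default.
have := @sorted_leq_nth _ geq geq_trans (fun x => leqnn x) 0 _ (part_sorted lam) i j.
by apply => //; rewrite inE; apply: leq_ltn_trans hj.
Qed.

Lemma part_inj (lam mu : int_partition) : part lam =1 part mu -> lam = mu.
Proof.
move=> h; apply: val_inj; rewrite /=.
have hs : size lam = size mu.
  apply/eqP; rewrite eqn_leq; apply/andP; split; rewrite leqNgt -part_pos.
    by rewrite h part_pos ltnn.
  by rewrite -h part_pos ltnn.
by apply: (@eq_from_nth _ 0) => // i _; apply: h.
Qed.

(** Meant for a weakly decreasing [f] that vanishes at [K], as in [part_ofE]. [insubd] makes it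
    total, with the empty partition as default when the list of values is not a partition. *)
Definition part_of (f : nat -> nat) (K : nat) : int_partition :=
  insubd empty_part (mkseq f (find (fun i => f i == 0) (iota 0 K))).

Lemma part_ofE f K : (forall i, f i.+1 <= f i) -> f K = 0 -> part (part_of f K) =1 f.
Proof.
move=> fd fK; set k := find (fun i => f i == 0) (iota 0 K).
have fle i j : i <= j -> f j <= f i.
  move=> /subnK <-; elim: (j - i) => // d IH; rewrite addSn.
  exact: leq_trans (fd _) IH.
have fk : f k = 0.
  have hk : k <= K by rewrite /k -[leqRHS](size_iota 0 K) find_size.
  case: (ltnP k K) => hkK; last by have -> : k = K by apply/eqP; rewrite eqn_leq hk.
  have := @nth_find _ 0 (fun i => f i == 0) (iota 0 K).
  by rewrite has_find size_iota => /(_ hkK); rewrite nth_iota // add0n => /eqP.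
have fpos i : i < k -> f i != 0.
  move=> hi; have := before_find 0 hi.
  have hiK : i < K by apply: leq_trans hi _; rewrite /k -[leqRHS](size_iota 0 K) find_size.
  by rewrite nth_iota // add0n => ->.
have hp : is_part (mkseq f k).
  apply/andP; split.
    apply/(sortedP 0) => i; rewrite size_mkseq => hi.
    by rewrite (nth_mkseq _ _ hi) (nth_mkseq _ _ (ltnW hi)); apply: fd.
  apply/negP => h0; case: (elimT (nthP 0) h0) => i; rewrite size_mkseq => hi.
  by rewrite nth_mkseq // => /eqP; apply/negP/fpos.
move=> i; rewrite /part /part_of -/k insubdK //.
case: (ltnP i k) => hi; first by rewrite nth_mkseq.
rewrite nth_default ?size_mkseq //; apply/esym/eqP.
by rewrite -leqn0 -fk; apply: fle.
Qed.

Definition box (lam : int_partition) i j := j < part lam i.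

Lemma box_inj lam mu : (forall i j, box lam i j = box mu i j) -> lam = mu.
Proof.
move=> h; apply: part_inj => i; apply/eqP; rewrite eqn_leq.
by apply/andP; split; rewrite leqNgt; apply/negP => hlt;
   have := h i; rewrite /box; [move=> /(_ (part mu i)) | move=> /(_ (part lam i))];
   rewrite hlt ltnn.
Qed.

(** Rows decrease, so those longer than [j] form an initial segment, and counting them amounts to
    testing row [i]. *)
Lemma conj_partE lam i j : (i < conj_part lam j) = box lam i j.
Proof.
rewrite /conj_part /box /part.
have := part_sorted lam; elim: (pseq lam) i => [|x s IH] i hs /=.
  by rewrite nth_nil !ltn0.
have hall : all (geq x) s by exact: (order_path_min geq_trans hs).
case: (ltnP j x) => hjx; last first.
  rewrite add0n; have -> : count (fun y => j < y) s = 0.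
    apply/eqP; rewrite -leqn0 leqNgt -has_count; apply/hasPn => y /(allP hall) /= hy.
    by rewrite -leqNgt (leq_trans hy).
  rewrite ltn0; case: i => [|i] /=; first by rewrite ltnNge hjx.
  case: (ltnP i (size s)) => hi; last by rewrite nth_default.
  have /= hy := allP hall _ (mem_nth 0 hi).
  by apply/esym/negbTE; rewrite -leqNgt (leq_trans hy).
case: i => [|i] /=; first by rewrite hjx.
by rewrite add1n ltnS IH // (path_sorted hs).
Qed.

Definition conjp (lam : int_partition) := part_of (conj_part lam) (part lam 0).

Lemma part_conj lam : part (conjp lam) =1 conj_part lam.
Proof.
apply: part_ofE => [i|].
  by apply: sub_count => x /= /ltnW.
apply/eqP; rewrite -leqn0 leqNgt conj_partE /box ltnn //.
Qed.

Lemma box_conj lam i j : box (conjp lam) i j = box lam j i.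
Proof. by rewrite {1}/box part_conj conj_partE. Qed.

Lemma conjpK : involutive conjp.
Proof. by move=> lam; apply: box_inj => i j; rewrite !box_conj. Qed.

Definition subpart (lam mu : int_partition) :=
  all (fun i => part lam i <= part mu i) (iota 0 (size lam)).

Lemma subpartP lam mu : reflect (forall i, part lam i <= part mu i) (subpart lam mu).
Proof.
apply: (iffP allP) => [h i|h i _]; last exact: h.
case: (ltnP i (size lam)) => hi; first by apply: h; rewrite mem_iota.
by rewrite /part nth_default.
Qed.

Lemma subpart_boxP lam mu : reflect (forall i j, box lam i j -> box mu i j) (subpart lam mu).
Proof.
apply: (iffP (subpartP _ _)) => [h i j hj|h i]; first exact: leq_trans (h i).
by rewrite leqNgt; apply/negP => /h; rewrite /box ltnn.
Qed.

Lemma subpart_refl lam : subpart lam lam. Proof. exact/subpartP. Qed.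

Lemma subpart_anti lam mu : subpart lam mu -> subpart mu lam -> lam = mu.
Proof.
move=> /subpartP h1 /subpartP h2; apply: part_inj => i; apply/eqP.
by rewrite eqn_leq h1 h2.
Qed.

Lemma subpart_conj lam mu : subpart (conjp lam) (conjp mu) = subpart lam mu.
Proof.
by apply/subpart_boxP/subpart_boxP => h i j; have := h j i; rewrite !box_conj.
Qed.

Lemma psizeE (lam : int_partition) K : size lam <= K ->
  sumn lam = \sum_(i < K) part lam i.
Proof.
move=> hK; rewrite sumnE (big_nth 0) -(big_mkord xpredT (part lam)).
rewrite [RHS](@big_cat_nat _ _ _ (size lam)) //=.
rewrite [X in _ = _ + X]big_nat_cond [X in _ = _ + X]big1 ?addn0 // => i /andP[/andP[hi _] _].
by rewrite /part nth_default.
Qed.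

Lemma subpart_size lam mu : subpart lam mu -> size lam <= size mu.
Proof.
move=> /subpartP h; rewrite leqNgt; apply/negP; rewrite -part_pos => hp.
by have := leq_trans hp (h _); rewrite part_pos ltnn.
Qed.

Lemma subpart_sumn lam mu : subpart lam mu -> sumn lam <= sumn mu.
Proof.
move=> h; rewrite (psizeE (subpart_size h)) (psizeE (leqnn _)).
by apply: leq_sum => i _; apply/subpartP.
Qed.

Lemma subpart_eq lam mu : subpart lam mu -> sumn mu <= sumn lam -> lam = mu.
Proof.
move=> h hs; apply: part_inj => i.
have hle := subpart_sumn h.
have e : sumn lam = sumn mu by apply/eqP; rewrite eqn_leq hle hs.
pose K := maxn i.+1 (size mu).
have hK : size mu <= K by rewrite leq_maxr.
have hi : i < K by rewrite leq_maxl.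
move: e; rewrite (psizeE (leq_trans (subpart_size h) hK)) (psizeE hK).
move=> e; apply/eqP.
have hsum : \sum_(k < K) (part mu k - part lam k) = 0.
  by rewrite sumnB ?e ?subnn // => k _; apply/subpartP.
have /eqP := hsum; rewrite sum_nat_eq0 => /forallP /(_ (Ordinal hi)) /=.
by rewrite subn_eq0 => hh; rewrite eqn_leq hh andbT; apply/subpartP.
Qed.

(** * Peeling the first row or the first column off a partition *)

Definition first (b : bool) (lam : int_partition) :=
  if b then conj_part lam 0 else part lam 0.

(** Throughout, the boolean is the parity of a letter: a delta ([false]) consumes a row, an epsilon
    ([true]) a column. *)
Definition rest (b : bool) (lam : int_partition) : int_partition :=
  if b then part_of (fun i => (part lam i).-1) (size lam)
  else part_of (fun i => part lam i.+1) (size lam).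

Arguments rest : simpl never.

Lemma part_rest b lam i :
  part (rest b lam) i = if b then (part lam i).-1 else part lam i.+1.
Proof.
have h0 : part lam (size lam) = 0 by rewrite /part nth_default.
rewrite /rest; case: b; rewrite part_ofE ?h0 //; first 1 last.
- by move=> j; apply: part_decr.
- by rewrite /part nth_default.
- by move=> j; have := part_decr lam (leqnSn j); lia.
Qed.

Lemma box_rest b lam i j :
  box (rest b lam) i j = if b then box lam i j.+1 else box lam i.+1 j.
Proof. by rewrite /box part_rest; case: b => //; lia. Qed.

Lemma restC b c lam : rest b (rest c lam) = rest c (rest b lam).
Proof. by apply: box_inj => i j; rewrite !box_rest; case: b; case: c; rewrite ?box_rest. Qed.

Lemma rest_conj b lam : rest b (conjp lam) = conjp (rest (~~ b) lam).
Proof. by apply: box_inj => i j; rewrite box_rest box_conj; case: b; rewrite ?box_conj box_rest. Qed.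

Lemma first_conj b lam : first b (conjp lam) = first (~~ b) lam.
Proof. by case: b => /=; rewrite ?part_conj // -part_conj conjpK. Qed.

Lemma subpart_rest b lam : subpart (rest b lam) lam.
Proof.
apply/subpartP => i; rewrite part_rest; case: b; first exact: leq_pred.
by apply: part_decr.
Qed.

Lemma subpart_first_rest b lam mu :
  first b lam <= first b mu -> subpart (rest b lam) (rest b mu) -> subpart lam mu.
Proof.
move=> h1 /subpart_boxP h2; apply/subpart_boxP => i j.
case: b h1 h2 => /= h1 h2.
  case: j => [|j]; last by have := h2 i j; rewrite !box_rest.
  by rewrite -!conj_partE => h; apply: leq_trans h1.
case: i => [|i]; last by have := h2 i j; rewrite !box_rest.
by rewrite /box => h; apply: leq_trans h1.
Qed.

Lemma sum_ltn c K : \sum_(j < K) (j < c) = minn c K.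
Proof. by elim: K => [|K IH]; rewrite ?big_ord0 ?minn0 // big_ord_recr IH /=; lia. Qed.

Lemma sumn_conj (lam : int_partition) : sumn (conjp lam) = sumn lam.
Proof.
have sumnE' (mu : int_partition) K : size mu <= K -> part mu 0 <= K ->
    sumn mu = \sum_(i < K) \sum_(j < K) box mu i j.
  move=> h1 h2; rewrite (psizeE h1); apply: eq_bigr => i _.
  have hi : part mu i <= K by apply: leq_trans h2; apply: part_decr.
  by rewrite [RHS]sum_ltn (minn_idPl hi).
pose K := maxn (size lam) (part lam 0).
have sz (mu : int_partition) : size (conjp mu) = part mu 0.
  apply/eqP; rewrite eqn_leq; apply/andP; split; rewrite leqNgt.
    by rewrite -part_pos part_conj conj_partE /box ltnn.
  apply/negP => h; have := h; rewrite -[size _ < _]/(box mu 0 (size (conjp mu))).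
  by rewrite -conj_partE -part_conj part_pos ltnn.
have h1 : size (conjp lam) <= K by rewrite sz leq_maxr.
have h2 : part (conjp lam) 0 <= K by rewrite -sz conjpK leq_maxl.
rewrite (sumnE' _ _ h1 h2) (sumnE' lam K) ?leq_maxl ?leq_maxr //.
rewrite exchange_big /=; apply: eq_bigr => i _; apply: eq_bigr => j _.
by rewrite box_conj.
Qed.

Lemma sumn_first_rest b (lam : int_partition) : sumn lam = first b lam + sumn (rest b lam).
Proof.
have h (mu : int_partition) : sumn mu = part mu 0 + sumn (rest false mu).
  rewrite (@psizeE mu (size mu).+1) ?leqnSn // big_ord_recl; congr (_ + _).
  rewrite (psizeE (subpart_size (subpart_rest false mu))).
  by apply: eq_bigr => i _; rewrite part_rest.
case: b; last exact: h.
by rewrite -sumn_conj h rest_conj sumn_conj part_conj.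
Qed.

Fixpoint hk (t : seq bool) (lam : int_partition) : bool :=
  if t is b :: t' then hk t' (rest b lam) else size lam == 0.

(** A delta shifts the row index by one and an epsilon shortens every row by one, so what survives
    all the letters is decided by one row of [lam]. In particular [hk] depends only on the numbers
    of letters of each kind, which is the hook condition. *)
Lemma hkE t lam : hk t lam = (part lam (count negb t) <= count id t).
Proof.
elim: t lam => [|b t IH] lam /=; first by rewrite leqn0 -[_ == 0]negbK -lt0n -part_pos lt0n negbK.
by rewrite IH part_rest; case: b => /=; rewrite ?add0n ?add1n //; lia.
Qed.

Lemma hk_perm t u lam : perm_eq t u -> hk t lam = hk u lam.
Proof. by move=> h; rewrite !hkE; rewrite (permP h negb) (permP h id). Qed.

Lemma hk_sub t lam mu : subpart lam mu -> hk t mu -> hk t lam.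
Proof. by rewrite !hkE => /subpartP h; apply: leq_trans. Qed.

Definition peel (t : seq bool) lam := foldl (fun l b => rest b l) lam t.

Lemma box_peel t lam i j :
  box (peel t lam) i j = box lam (i + count negb t) (j + count id t).
Proof.
elim: t lam i j => [|b t IH] lam i j /=; first by rewrite !addn0.
by rewrite IH box_rest; case: b => /=; rewrite ?add0n ?add1n ?addnS.
Qed.

Lemma part_peel t lam i :
  part (peel t lam) i = part lam (i + count negb t) - count id t.
Proof.
have h j : (j < part (peel t lam) i) = (j < part lam (i + count negb t) - count id t).
  by have := box_peel t lam i j; rewrite /box => ->; lia.
apply/eqP; rewrite eqn_leq; apply/andP; split; rewrite leqNgt.
  by rewrite h ltnn.
by rewrite -h ltnn.
Qed.

Lemma conj_part_peel t lam j :
  conj_part (peel t lam) j = conj_part lam (j + count id t) - count negb t.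
Proof.
have h i : (i < conj_part (peel t lam) j) = (i < conj_part lam (j + count id t) - count negb t).
  by rewrite conj_partE box_peel -conj_partE; lia.
apply/eqP; rewrite eqn_leq; apply/andP; split; rewrite leqNgt.
  by rewrite h ltnn.
by rewrite -h ltnn.
Qed.

Section Weights.
Variables (I : eqType) (par : I -> bool).

(* lambda^b, computed by peeling off the first row for each delta and the     *)
(* first column for each epsilon ([par = true]), in the order of the letters. *)
Fixpoint wt (s : seq I) (lam : int_partition) (i : I) : nat :=
  if s is x :: s' then
    if i == x then first (par x) lam else wt s' (rest (par x) lam) i
  else 0.

Lemma wt_cat p q lam i : wt (p ++ q) lam i =
  if i \in p then wt p lam i else wt q (peel (map par p) lam) i.
Proof.
elim: p lam => [|x p IH] lam //=; rewrite inE; case: eqP => //=.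
Qed.

(** By [hk], nothing is left of [lam] once all letters are peeled off, so its boxes are all seen by
    the weight and can be compared one row or column at a time. *)
Lemma wt_sub s lam mu : uniq s -> hk (map par s) lam ->
  (forall i, i \in s -> wt s lam i <= wt s mu i) -> subpart lam mu.
Proof.
elim: s lam mu => [|x s IH] lam mu /=.
  move=> _ /nilP h0 _; apply/subpartP => i; by rewrite /part h0 nth_nil.
move=> /andP[xs us] hl h; apply: (@subpart_first_rest (par x)).
  by have := h x; rewrite inE eqxx => /(_ isT).
apply: IH => // i hi; have := h i; rewrite inE hi orbT => /(_ isT).
by case: eqP => // e; rewrite e (negPf xs) in hi.
Qed.

Lemma sumn_wt s (lam : int_partition) : uniq s -> hk (map par s) lam ->
  sumn lam = \sum_(i <- s) wt s lam i.
Proof.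
elim: s lam => [|x s IH] lam /=; first by move=> _ /nilP ->; rewrite big_nil.
move=> /andP[xs us] h; rewrite big_cons eqxx (sumn_first_rest (par x)); congr (_ + _).
rewrite (IH _ us h) big_seq [RHS]big_seq; apply: eq_bigr => i hi.
by case: eqP => // e; rewrite e (negPf xs) in hi.
Qed.

End Weights.

(** * Adding and removing one box *)

Definition box_cover (lam mu : int_partition) := subpart lam mu && (sumn mu == (sumn lam).+1).
(* sig interlaces lam if b = false, the conjugates interlace if b = true.     *)
Definition strip b lam sig := subpart (rest b lam) sig && subpart sig lam.

Lemma box_cover_conj lam mu : box_cover (conjp lam) (conjp mu) = box_cover lam mu.
Proof. by rewrite /box_cover subpart_conj !sumn_conj. Qed.

Lemma strip_conj b lam sig : strip b (conjp lam) (conjp sig) = strip (~~ b) lam sig.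
Proof. by rewrite /strip rest_conj !subpart_conj. Qed.

Definition add_box (lam : int_partition) r := part_of (fun i => part lam i + (i == r)) (size lam + r).+1.
Definition rem_box (lam : int_partition) r := part_of (fun i => part lam i - (i == r)) (size lam).

Definition addable lam r := (r == 0) || (part lam r < part lam r.-1).
Definition removable lam r := part lam r.+1 < part lam r.

Lemma part_add_box lam r : addable lam r ->
  part (add_box lam r) =1 (fun i => part lam i + (i == r)).
Proof.
move=> h; apply: part_ofE => [i|]; last first.
  by rewrite /part nth_default; lia.
have := part_decr lam (leqnSn i); case: (i.+1 =P r) => e; last lia.
by move: h; rewrite /addable -e /=; lia.
Qed.

Lemma part_rem_box lam r : removable lam r ->
  part (rem_box lam r) =1 (fun i => part lam i - (i == r)).
Proof.
move=> h; apply: part_ofE => [i|]; last first.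
  by rewrite /part nth_default.
have := part_decr lam (leqnSn i); case: (i =P r) => [->|e]; last lia.
by move: h; rewrite /removable; lia.
Qed.

Lemma sumn_delta (lam mu : int_partition) r : (forall i, part mu i = part lam i + (i == r)) ->
  sumn mu = (sumn lam).+1.
Proof.
move=> h; pose K := maxn r.+1 (maxn (size lam) (size mu)).
have hr : r < K by rewrite leq_maxl.
have hl : size lam <= K by rewrite /K; lia.
have hm : size mu <= K by rewrite /K; lia.
rewrite (psizeE hl) (psizeE hm) (eq_bigr _ (fun (i : 'I_K) _ => h i)) big_split /=.
rewrite -addn1; congr (_ + _).
rewrite (bigD1 (Ordinal hr)) //= eqxx big1 // => i /eqP ne.
by case: eqP => // e; case: ne; apply: val_inj.
Qed.

(** The topmost row in which [mu] is longer accepts a box, and adding that box already exhausts the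
    size of [mu]. *)
Lemma box_coverP lam mu : reflect (exists r, forall i, part mu i = part lam i + (i == r)) (box_cover lam mu).
Proof.
apply: (iffP andP) => [[h /eqP hs]|[r h]]; last first.
  split; first by apply/subpartP => i; rewrite h leq_addr.
  by rewrite (sumn_delta h).
have [r hr] : exists r, part lam r < part mu r.
  apply: contrapT => hn.
  have h' : subpart mu lam.
    by apply/subpartP => i; rewrite leqNgt; apply/negP => hi; apply: hn; exists i.
  by have := subpart_sumn h'; rewrite hs ltnn.
have hadd k : (forall i, i < k -> part mu i = part lam i) -> part lam k < part mu k -> addable lam k.
  case: k => // k hk1 hk2; rewrite /addable /=.
  by rewrite -(hk1 k) //; apply: leq_trans hk2 _; apply: part_decr.
have [k hk1 hmin] := ex_minnP (ex_intro (fun r => part lam r < part mu r) r hr).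
have ak : addable lam k.
  apply: (hadd k) => // i hi; have /subpartP/(_ i) := h.
  have := hmin i; lia.
exists k => i; rewrite -part_add_box //; congr part; apply/esym.
apply: subpart_eq; last by rewrite hs (sumn_delta (part_add_box ak)).
apply/subpartP => j; rewrite part_add_box //.
have /subpartP/(_ j) := h; case: eqP => [->|]; lia.
Qed.

Lemma box_cover_add lam r : addable lam r -> box_cover lam (add_box lam r).
Proof. by move=> h; apply/box_coverP; exists r; exact: part_add_box. Qed.

Lemma box_cover_rem lam r : removable lam r -> box_cover (rem_box lam r) lam.
Proof.
move=> h; apply/box_coverP; exists r => i; rewrite part_rem_box //.
by move: h; rewrite /removable; case: eqP => [->|]; lia.
Qed.

(** Makes sums over partitions finite: a partition of size at most [D] has at most [D] rows, each of
    length at most [D]. *)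
Definition boxed D : seq int_partition :=
  [seq lam : int_partition <- undup [seq part_of (fun i => nth 0 (map (@nat_of_ord _) t) i) D
                    | t : D.-tuple 'I_D.+1 <- enum {: D.-tuple 'I_D.+1}] | sumn lam <= D].

Lemma boxed_uniq D : uniq (boxed D).
Proof. by rewrite filter_uniq // undup_uniq. Qed.

Lemma leq_part_sumn (lam : int_partition) i : part lam i <= sumn lam.
Proof.
pose K := maxn i.+1 (size lam).
have hi : i < K by rewrite leq_maxl.
have hl : size lam <= K by rewrite leq_maxr.
by rewrite (psizeE hl) (bigD1 (Ordinal hi)) //= leq_addr.
Qed.

Lemma leq_size_sumn (lam : int_partition) : size lam <= sumn lam.
Proof.
rewrite (psizeE (leqnn _)) -[leqLHS]card_ord -sum1_card.
by apply: leq_sum => i _; rewrite part_pos.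
Qed.

Lemma mem_boxed D (lam : int_partition) : (lam \in boxed D) = (sumn lam <= D).
Proof.
rewrite mem_filter; case: (leqP (sumn lam) D) => //= h.
rewrite mem_undup; apply/mapP.
have hs : size lam <= D := leq_trans (leq_size_sumn lam) h.
pose t : D.-tuple 'I_D.+1 := [tuple inord (part lam i) | i < D].
exists t; first by rewrite mem_enum.
have e i : nth 0 (map (@nat_of_ord _) t) i = part lam i.
  case: (ltnP i D) => hi; last first.
    rewrite /part [RHS]nth_default ?(leq_trans hs) // nth_default //.
    by rewrite size_map size_tuple.
  rewrite (nth_map ord0) ?size_tuple // -[X in nth _ _ X]/(nat_of_ord (Ordinal hi)) -tnth_nth.
  by rewrite tnth_mktuple inordK // ltnS (leq_trans (leq_part_sumn _ _) h).
apply: part_inj => i; rewrite part_ofE ?e // => [j|]; last by rewrite /part nth_default.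
by rewrite !e part_decr.
Qed.

(** * Strips, boxes and the Pieri count *)

Lemma strip_rowP (lam sig : int_partition) :
  reflect (forall i, part lam i.+1 <= part sig i <= part lam i) (strip false lam sig).
Proof.
apply: (iffP andP) => [[/subpartP h1 /subpartP h2] i|h].
  by rewrite h2 andbT; have := h1 i; rewrite part_rest.
by split; apply/subpartP => i; have /andP[h1 h2] := h i; rewrite ?part_rest.
Qed.

Lemma addable_le (lam : int_partition) r : addable lam r -> r <= size lam.
Proof.
by case/orP => [/eqP -> //|h]; case: r h => // r h; rewrite -part_pos; apply: leq_trans h.
Qed.

Lemma box_cover_addP (lam mu : int_partition) :
  reflect (exists2 r, addable lam r & mu = add_box lam r) (box_cover lam mu).
Proof.
apply: (iffP idP) => [/box_coverP[r h]|[r h ->]]; last exact: box_cover_add.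
have ar : addable lam r.
  case: r h => // r h; rewrite /addable /=.
  have := part_decr mu (leqnSn r); rewrite !h eqxx.
  by case: eqP; lia.
by exists r => //; apply: part_inj => i; rewrite part_add_box.
Qed.

Lemma box_cover_remP (rho sig : int_partition) :
  reflect (exists2 r, removable sig r & rho = rem_box sig r) (box_cover rho sig).
Proof.
apply: (iffP idP) => [/box_coverP[r h]|[r h ->]]; last exact: box_cover_rem.
have ar : removable sig r.
  rewrite /removable !h eqxx.
  by have := part_decr rho (leqnSn r); case: eqP; lia.
by exists r => //; apply: part_inj => i; rewrite part_rem_box // h; lia.
Qed.

Lemma interlace_add (lam sig : int_partition) r :
  (addable lam r && strip false (add_box lam r) sig) <->
  (forall i, part lam i.+1 + (i.+1 == r) <= part sig i <= part lam i + (i == r)).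
Proof.
split=> [/andP[h /strip_rowP h2] i|h].
  by have := h2 i; rewrite !part_add_box.
have ar : addable lam r.
  case: r h => // r h; rewrite /addable /=.
  by have := h r; rewrite eqxx; case: eqP; lia.
by rewrite ar; apply/strip_rowP => i; rewrite !part_add_box.
Qed.

Lemma interlace_rem (lam sig : int_partition) r :
  (removable sig r && strip false lam (rem_box sig r)) <->
  (0 < part sig r /\ forall i, part lam i.+1 <= part sig i - (i == r) <= part lam i).
Proof.
split=> [/andP[h /strip_rowP h2]|[h0 h]].
  split=> [|i]; first by move: h; rewrite /removable; lia.
  by have := h2 i; rewrite !part_rem_box.
have ar : removable sig r.
  rewrite /removable.
  by have := h r; have := h r.+1; rewrite eqxx; case: eqP; lia.
by rewrite ar; apply/strip_rowP => i; rewrite !part_rem_box.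
Qed.

(** When [sig] already interlaces [lam], both sides reduce to the single extra inequality
    [part lam r.+1 < part sig r]; hence the shift of the row by one. *)
Lemma add_rem_strip (lam sig : int_partition) r : strip false lam sig ->
  (addable lam r.+1 && strip false (add_box lam r.+1) sig)
  = (removable sig r && strip false lam (rem_box sig r)).
Proof.
move=> /strip_rowP h; apply/idP/idP.
  move=> /interlace_add h2; apply/interlace_rem.
  have h3 := h2 r; rewrite eqxx in h3.
  split=> [|i]; first lia.
  have := h i; case: eqP => [->|]; lia.
move=> /interlace_rem [h0 h2]; apply/interlace_add => i.
have := h i; have := h2 i; rewrite eqSS; case: eqP => [->|]; case: eqP; lia.
Qed.

(** Here either side forces [part sig r = (part lam r).+1]: row [r] holds the only violation,
    repaired by lengthening [lam] or by shortening [sig] there. *)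
Lemma add_rem_nstrip (lam sig : int_partition) r : ~~ strip false lam sig ->
  (addable lam r && strip false (add_box lam r) sig)
  = (removable sig r && strip false lam (rem_box sig r)).
Proof.
move=> h; apply/idP/idP.
  move=> /interlace_add h2; apply/interlace_rem.
  have e : part sig r = (part lam r).+1.
    apply: contraNeq h => ne; apply/strip_rowP => i; have := h2 i.
    by case: (i =P r) => [->|]; move/eqP: ne; lia.
  split=> [|i]; first lia.
  have := h2 i; case: (i =P r) => [->|]; last by lia.
  by have := part_decr lam (leqnSn r); lia.
move=> /interlace_rem [h0 h2]; apply/interlace_add.
have e : part sig r = (part lam r).+1.
  apply: contraNeq h => ne; apply/strip_rowP => i; have := h2 i.
  by case: (i =P r) => [->|]; move/eqP: ne; lia.
move=> i; have := h2 i; case: (i =P r) => [->|ne].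
  by case: eqP; have := part_decr lam (leqnSn r); lia.
case: eqP => [e2|]; last by lia.
by have := part_decr sig (leqnSn i); rewrite e2 e; lia.
Qed.

Lemma count_cover_add D (lam sig : int_partition) K : sumn lam < D -> size lam < K ->
  count (fun mu => box_cover lam mu && strip false mu sig) (boxed D)
  = count (fun r => addable lam r && strip false (add_box lam r) sig) (iota 0 K).
Proof.
move=> hD hK; rewrite -!size_filter -[RHS](size_map (add_box lam)).
apply: perm_size; apply: uniq_perm.
- by rewrite filter_uniq // boxed_uniq.
- rewrite map_inj_in_uniq ?filter_uniq ?iota_uniq // => r r'.
  rewrite !mem_filter => /andP[/andP[a1 _] _] /andP[/andP[a2 _] _] e.
  have := part_add_box a1 r; rewrite e part_add_box // eqxx.
  by case: eqP => // _ /eqP; rewrite eqn_add2l.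
move=> mu; rewrite mem_filter mem_boxed.
apply/andP/mapP => [[/andP[c s] _]|[r]].
  move/box_cover_addP: c s => [r ar ->] s; exists r => //.
  by rewrite mem_filter ar s mem_iota /= add0n (leq_ltn_trans (addable_le ar)).
rewrite mem_filter => /andP[/andP[ar s] _] ->; rewrite s box_cover_add //.
by have /andP[_ /eqP ->] := box_cover_add ar.
Qed.

Lemma count_cover_rem D (lam sig : int_partition) K : sumn lam < D -> size sig <= K ->
  count (fun rho => strip false lam rho && box_cover rho sig) (boxed D)
  = count (fun r => removable sig r && strip false lam (rem_box sig r)) (iota 0 K).
Proof.
move=> hD hK; rewrite -!size_filter -[RHS](size_map (rem_box sig)).
apply: perm_size; apply: uniq_perm.
- by rewrite filter_uniq // boxed_uniq.
- rewrite map_inj_in_uniq ?filter_uniq ?iota_uniq // => r r'.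
  rewrite !mem_filter => /andP[/andP[a1 _] _] /andP[/andP[a2 _] _] e.
  have := part_rem_box a1 r; rewrite e part_rem_box // eqxx.
  by move: a1; rewrite /removable; case: eqP => //; lia.
move=> rho; rewrite mem_filter mem_boxed.
apply/andP/mapP => [[/andP[s c] _]|[r]].
  move/box_cover_remP: c s => [r ar ->] s; exists r => //.
  rewrite mem_filter ar s mem_iota /= add0n; apply: leq_trans hK.
  by rewrite -part_pos; move: ar; rewrite /removable; lia.
rewrite mem_filter => /andP[/andP[ar s] _] ->; rewrite s box_cover_rem //; split=> //.
by apply: leq_trans (ltnW hD); apply: subpart_sumn; case/andP: s.
Qed.

(** Rows are matched one to one. If [sig] interlaces [lam], row [r.+1] of [lam] is matched with row
    [r] of [sig], and row 0 of [lam], where a box can always be added, is left over and gives the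
    last term. Otherwise row [r] is matched with row [r]. *)
Lemma local_pieri_row D (lam sig : int_partition) : sumn lam < D ->
  count (fun mu => box_cover lam mu && strip false mu sig) (boxed D)
  = count (fun rho => strip false lam rho && box_cover rho sig) (boxed D)
    + strip false lam sig.
Proof.
move=> hD; pose K := size lam + size sig.
rewrite (@count_cover_add D lam sig K.+1) ?ltnS ?leq_addr //.
case: (boolP (strip false lam sig)) => h; last first.
  rewrite addn0 (@count_cover_rem D lam sig K.+1) //; last by rewrite /K; lia.
  by apply: eq_count => r; apply: add_rem_nstrip.
rewrite (@count_cover_rem D lam sig K) ?leq_addl //= addnC; congr (_ + _).
  by rewrite -[1]addn0 (iotaDl 1 0) count_map; apply: eq_count => r; apply: add_rem_strip.
suff -> : strip false (add_box lam 0) sig by [].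
have : addable lam 0 && strip false (add_box lam 0) sig; last by case/andP.
apply/interlace_add => i; have /strip_rowP/(_ i) := h; rewrite addn0 /=; lia.
Qed.

Lemma perm_boxed_conj D : perm_eq (map conjp (boxed D)) (boxed D).
Proof.
apply: uniq_perm; rewrite ?boxed_uniq ?map_inj_uniq ?boxed_uniq //; first exact: inv_inj conjpK.
move=> lam; rewrite mem_boxed; apply/mapP/idP => [[mu]|h].
  by rewrite mem_boxed => h ->; rewrite sumn_conj.
by exists (conjp lam); rewrite ?mem_boxed ?sumn_conj // conjpK.
Qed.

Lemma local_pieri b D (lam sig : int_partition) : sumn lam < D ->
  count (fun mu => box_cover lam mu && strip b mu sig) (boxed D)
  = count (fun rho => strip b lam rho && box_cover rho sig) (boxed D)
    + strip b lam sig.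
Proof.
case: b; last exact: local_pieri_row.
move=> hD; have h := @local_pieri_row D (conjp lam) (conjp sig).
rewrite sumn_conj in h; move: (h hD).
rewrite -(permP (perm_boxed_conj D)) -[X in _ = X + _ -> _](permP (perm_boxed_conj D)) !count_map strip_conj => e.
rewrite (eq_count (a2 := preim conjp (fun mu => box_cover (conjp lam) mu && strip false mu (conjp sig)))).
  rewrite e; congr (_ + _); apply: eq_count => rho /=.
  by rewrite box_cover_conj strip_conj.
by move=> mu /=; rewrite box_cover_conj strip_conj.
Qed.

(** The number of chains of strips from [lam] down to the empty partition, that is, of semistandard
    supertableaux of shape [lam]. The head of [t] is the letter removed from the outside, so an
    order of letters enters reversed; [D] only bounds the enumeration. *)
Fixpoint sst D (t : seq bool) (lam : int_partition) : nat :=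
  if t is b :: t' then \sum_(sig <- boxed D | strip b lam sig) sst D t' sig
  else size lam == 0.

Lemma sst_gt0 D t (lam : int_partition) : sumn lam <= D -> hk t lam -> 0 < sst D t lam.
Proof.
elim: t lam => [|b t IH] lam hD /=; first by move=> ->.
move=> h; have hs : sumn (rest b lam) <= D.
  by apply: leq_trans hD; apply: subpart_sumn; apply: subpart_rest.
rewrite big_mkcond (bigD1_seq (rest b lam)) ?boxed_uniq ?mem_boxed //=.
by rewrite /strip subpart_refl subpart_rest addn_gt0 IH.
Qed.

Lemma sum_if_count (T : eqType) (r : seq T) (P Q : pred T) (c : nat) :
  \sum_(x <- r | P x) (if Q x then c else 0) = count (fun x => P x && Q x) r * c.
Proof. by rewrite -big_mkcondr big_const_seq iter_addn_0 mulnC. Qed.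

(** The numerical shadow of tensoring with the natural module. [local_pieri] exchanges adding a box
    with removing a strip; its extra term contributes one copy of [sst] for the new letter, and the
    induction hypothesis the remaining [size t] copies. *)
Lemma pieri D t (lam : int_partition) : sumn lam < D ->
  \sum_(mu <- boxed D | box_cover lam mu) sst D t mu = size t * sst D t lam.
Proof.
elim: t lam => [|b t IH] lam hD /=.
  rewrite mul0n big1_seq // => mu /andP[/andP[_ /eqP hs] _].
  by case: eqP => // h0; move: hs; rewrite (size0nil h0).
transitivity (\sum_(sig <- boxed D)
    (count (fun mu => box_cover lam mu && strip b mu sig) (boxed D) * sst D t sig)).
  rewrite [LHS](eq_bigr (fun mu => \sum_(sig <- boxed D) if strip b mu sig then sst D t sig else 0)); last first.
    by move=> mu _; rewrite big_mkcond.
  by rewrite exchange_big /=; apply: eq_bigr => sig _; rewrite sum_if_count.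
rewrite (eq_bigr (fun sig => count (fun rho => strip b lam rho && box_cover rho sig) (boxed D) * sst D t sig + (if strip b lam sig then sst D t sig else 0))); last first.
  by move=> sig _; rewrite local_pieri // mulnDl; case: strip; rewrite ?mul1n ?mul0n.
rewrite big_split /= -big_mkcond /= mulSn addnC; congr (_ + _).
rewrite big_distrr /=.
rewrite [RHS]big_seq_cond [RHS](eq_bigr (fun rho => \sum_(mu <- boxed D) if box_cover rho mu then sst D t mu else 0)); last first.
  move=> rho /andP[_ /andP[_ h]]; rewrite -big_mkcond IH //.
  exact: leq_ltn_trans (subpart_sumn h) hD.
rewrite -big_seq_cond exchange_big /=; apply: eq_bigr => sig _.
by rewrite sum_if_count.
Qed.

(** * Representations of gl(I) on a module *)

Local Open Scope ring_scope.

Section Order.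
Variable I : eqType.
Implicit Types (s : seq I) (i j : I).

Definition before s i j := [&& i \in s, j \in s & (index i s < index j s)%N].

Lemma before_cons s x i j : x \notin s ->
  before (x :: s) i j = ((i == x) && (j \in s)) || before s i j.
Proof.
move=> xs; rewrite /before /= !inE ![x == _]eq_sym.
case: (i =P x) => [->|_]; case: (j =P x) => [->|_] /=; rewrite ?(negPf xs) ?andbF ?orbF ?ltnn //=.
by rewrite ltn0Sn andbT.
Qed.

Lemma before_rcons s x i j : x \notin s ->
  before (rcons s x) i j = ((i \in s) && (j == x)) || before s i j.
Proof.
move=> xs; rewrite /before !mem_rcons !inE -cats1 !index_cat /=.
case: (i =P x) => [->|_]; case: (j =P x) => [->|_] /=; rewrite ?(negPf xs) ?andbF ?orbF ?ltnn ?eqxx ?addn0 //=.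
- by case: ifP => // js; apply/negbTE; rewrite -leqNgt index_size.
- by case: ifP => // is_; rewrite index_mem is_.
by case: ifP => // is_; case: ifP.
Qed.

Lemma before_neq s i j : before s i j -> i != j.
Proof. by case/and3P => _ _; case: eqP => // ->; rewrite ltnn. Qed.

Lemma before_total s i j : i \in s -> j \in s -> [|| i == j, before s i j | before s j i].
Proof.
move=> hi hj; rewrite /before hi hj /=.
case: ltngtP; rewrite ?orbT // => e.
by rewrite -(nth_index i hi) -(nth_index i hj) e eqxx.
Qed.

End Order.

Section Rep.
Variables (F : numClosedFieldType) (I : finType) (par : I -> bool).

Definition sgn i j k l : F := (-1) ^+ ((par i (+) par j) && (par k (+) par l)).

(** The relations carry the signs of the super bracket, but [A] carries no grading: parities are
    recovered from weights only when supermodules are treated. *)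
Record glrep (A : lmodType F) (E : I -> I -> A -> A) : Prop := GLRep {
  gl_lin : forall i j a x y, E i j (a *: x + y) = a *: E i j x + E i j y;
  gl_rel : forall i j k l x, E i j (E k l x) = sgn i j k l *: E k l (E i j x)
    + ((j == k)%:R *: E i l x - (sgn i j k l * (i == l)%:R) *: E k j x) }.

Section General.
Variables (A : lmodType F) (E : I -> I -> A -> A).

Definition subsp (S : A -> Prop) :=
  S 0 /\ forall a x y, S x -> S y -> S (a *: x + y).

Definition hsub (s : seq I) (S : A -> Prop) :=
  subsp S /\ forall i x, i \in s -> S x -> S (E i i x).

Definition jsub (s : seq I) (S : A -> Prop) :=
  subsp S /\ forall i j x, i \in s -> j \in s -> S x -> S (E i j x).

Definition wv (s : seq I) (w : I -> F) (x : A) :=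
  forall i, i \in s -> E i i x = w i *: x.

Definition same (s : seq I) (w w' : I -> F) := all (fun i => w i == w' i) s.

(** A list [s] plays two roles: its entries select the subalgebra of matrices supported on them, and
    its order selects the Borel subalgebra of that subalgebra. *)
Definition sing (s : seq I) (x : A) := forall i j, before s i j -> E i j x = 0.

Definition hwv (s : seq I) (w : I -> F) (v : A) := [/\ v <> 0, wv s w v & sing s v].

Inductive gen (s : seq I) (v : A) : A -> Prop :=
| gen_base : gen s v v
| gen_zero : gen s v 0
| gen_lin a x y : gen s v x -> gen s v y -> gen s v (a *: x + y)
| gen_act i j x : i \in s -> j \in s -> gen s v x -> gen s v (E i j x).

Inductive low (s : seq I) (v : A) : A -> Prop :=
| low_base : low s v v
| low_zero : low s v 0
| low_lin a x y : low s v x -> low s v y -> low s v (a *: x + y)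
| low_act i j x : before s i j -> low s v x -> low s v (E j i x).

(** The image of the lowering operators on [S]. For a submodule [S], the quotient of [S] by it is
    the space of coinvariants, which detects the singular vectors of [S] in the unitary case. *)
Inductive nminus (s : seq I) (S : A -> Prop) : A -> Prop :=
| nminus_zero : nminus s S 0
| nminus_lin a x y : nminus s S x -> nminus s S y -> nminus s S (a *: x + y)
| nminus_act i j x : before s i j -> S x -> nminus s S (E j i x).

Section SubspFacts.
Variables (S : A -> Prop) (hS : subsp S).
Lemma subsp0 : S 0. Proof. by case: hS. Qed.
Lemma subspZ a x : S x -> S (a *: x).
Proof. by move=> hx; rewrite -[_ *: _]addr0; apply: (proj2 hS) => //; apply: subsp0. Qed.
Lemma subspD x y : S x -> S y -> S (x + y).
Proof. by move=> hx; rewrite -[x]scale1r; apply: (proj2 hS). Qed.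
Lemma subspN x : S x -> S (- x).
Proof. by rewrite -scaleN1r; apply: subspZ. Qed.
Lemma subspB x y : S x -> S y -> S (x - y).
Proof. by move=> hx hy; apply: subspD => //; apply: subspN. Qed.
Lemma subsp_sum T (r : seq T) (P : pred T) (x : T -> A) :
  (forall t, P t -> S (x t)) -> S (\sum_(t <- r | P t) x t).
Proof. by move=> h; apply: big_ind => //; [apply: subsp0 | apply: subspD]. Qed.
End SubspFacts.

Lemma subsp_gen s v : subsp (gen s v).
Proof. by split; [apply: gen_zero | apply: gen_lin]. Qed.
Lemma jsub_gen s v : jsub s (gen s v).
Proof. by split; [apply: subsp_gen | apply: gen_act]. Qed.
Lemma subsp_low s v : subsp (low s v).
Proof. by split; [apply: low_zero | apply: low_lin]. Qed.
Lemma subsp_nminus s S : subsp (nminus s S).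
Proof. by split; [apply: nminus_zero | apply: nminus_lin]. Qed.
Lemma subsp_zero : subsp (fun x : A => x = 0).
Proof. by split=> // a x y -> ->; rewrite scaler0 addr0. Qed.

Lemma gen_min s v S : jsub s S -> S v -> forall x, gen s v x -> S x.
Proof.
move=> [[S0 SL] SE] Sv x; elim=> //.
- by move=> *; apply: SL.
- by move=> *; apply: SE.
Qed.

Lemma jsub_hsub s S : jsub s S -> hsub s S.
Proof. by case=> h1 h2; split=> // i x hi; apply: h2. Qed.

Hypothesis rep : glrep E.

Lemma EL i j a x y : E i j (a *: x + y) = a *: E i j x + E i j y.
Proof. exact: gl_lin. Qed.
Lemma E0 i j : E i j 0 = 0.
Proof. by have := EL i j (-1) 0 0; rewrite scaler0 addr0 scaleN1r addNr. Qed.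
Lemma EZ i j a x : E i j (a *: x) = a *: E i j x.
Proof. by rewrite -[a *: x]addr0 EL E0 addr0. Qed.
Lemma ED i j x y : E i j (x + y) = E i j x + E i j y.
Proof. by rewrite -[x]scale1r EL !scale1r. Qed.
Lemma EN i j x : E i j (- x) = - E i j x.
Proof. by rewrite -!scaleN1r EZ. Qed.
Lemma EB i j x y : E i j (x - y) = E i j x - E i j y.
Proof. by rewrite ED EN. Qed.
Lemma Esum i j T (r : seq T) (P : pred T) (x : T -> A) :
  E i j (\sum_(t <- r | P t) x t) = \sum_(t <- r | P t) E i j (x t).
Proof. by apply: (big_morph _ (ED i j) (E0 i j)). Qed.

Lemma Ehh i k l x : E i i (E k l x) =
  E k l (E i i x) + ((i == k)%:R - (i == l)%:R) *: E k l x.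
Proof.
rewrite (gl_rel rep) /sgn addbb /= expr0 scale1r mul1r scalerBl; congr (_ + (_ - _)).
  by case: eqP => [->|]; rewrite ?scale0r.
by case: eqP => [->|]; rewrite ?scale0r.
Qed.

Lemma wv_act s w k l x : wv s w x ->
  wv s (fun i => w i + ((i == k)%:R - (i == l)%:R)) (E k l x).
Proof. by move=> h i hi; rewrite /= Ehh h // EZ [in RHS]scalerDl. Qed.

(** The operator [(E i i - w t i) / (eta i - w t i)] preserves [S], kills a summand whose weight
    differs from [eta] at [i], fixes the part of weight [eta] and only rescales the other summands.
    Induction on the list removes the unwanted summands one by one. *)
Lemma weight_component s S T (r : seq T) (x : T -> A) (w : T -> I -> F) eta y :
  hsub s S -> (forall t, wv s (w t) (x t)) -> wv s eta y ->
  S (y + \sum_(t <- r) x t) -> S (y + \sum_(t <- r | same s (w t) eta) x t).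
Proof.
move=> [sS hS]; elim: r x y => [|t r IH] x y hx hy; first by rewrite !big_nil.
rewrite !big_cons; case: ifP => ht.
  rewrite !addrA; apply: IH => // i hi; rewrite ED hy // hx // scalerDr.
  by move/allP: ht => /(_ i hi) /eqP ->.
move/negbT/allPn: ht => [i hi ne] hs.
have ne' : eta i - w t i != 0 by rewrite subr_eq0 eq_sym.
pose c t' := (w t' i - w t i) / (eta i - w t i).
have e : \sum_(t0 <- r | same s (w t0) eta) c t0 *: x t0 = \sum_(t0 <- r | same s (w t0) eta) x t0.
  apply: eq_bigr => t' /allP/(_ i hi)/eqP e.
  by rewrite /c e divff // scale1r.
rewrite -e; apply: IH => //; first by move=> t' k hk; rewrite EZ hx // !scalerA mulrC.
have := subspZ sS (eta i - w t i)^-1 (subspB sS (hS i _ hi hs) (subspZ sS (w t i) hs)).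
rewrite !ED hy // hx // Esum [w t i *: (y + _)]scalerDr [w t i *: (x t + _)]scalerDr.
rewrite opprD addrACA -scalerBl opprD [w t i *: x t + _ + _]addrACA subrr add0r.
rewrite scalerDr scalerA mulVf // scale1r.
rewrite scaler_sumr -sumrB scaler_sumr.
rewrite (eq_bigr (fun t' => c t' *: x t')) // => t' _.
by rewrite hx // -scalerBl scalerA mulrC.
Qed.

(** A weak form of the Poincare-Birkhoff-Witt theorem: any operator can be moved past the lowering
    ones, at the cost of commutators, until it reaches [v], where it acts by a scalar, by zero or as
    a lowering operator. *)
Lemma gen_low s w v x : hwv s w v -> gen s v x -> low s v x.
Proof.
move=> [_ hw hs].
have h y : low s v y -> forall i j, i \in s -> j \in s -> low s v (E i j y).
  elim=> {y} [|i j _ _|a y z _ IHy _ IHz i j hi hj|a b y hab hy IH i j hi hj].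
  - move=> i j hi hj; case/or3P: (before_total hi hj) => [/eqP <-|/hs ->|h].
    + by rewrite hw //; apply: subspZ (subsp_low s v) _ _ (low_base _ _).
    + exact: low_zero.
    + by apply: low_act => //; apply: low_base.
  - by rewrite E0; apply: low_zero.
  - by rewrite EL; apply: low_lin; [apply: IHy | apply: IHz].
  have /and3P[ha hb _] := hab.
  have sp := subsp_low s v.
  rewrite (gl_rel rep); apply: subspD => //; first by apply: subspZ => //; apply: low_act => //; apply: IH.
  by apply: subspB => //; apply: subspZ => //; apply: IH.
apply: gen_min; last exact: low_base.
by split; [apply: subsp_low | move=> i j y hi hj hy; apply: h].
Qed.

Lemma low_gen s v x : low s v x -> gen s v x.
Proof.
elim=> {x} [|| | i j x /and3P[hi hj _] _ h]; [exact: gen_base | exact: gen_zero | | exact: gen_act].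
by move=> *; apply: gen_lin.
Qed.

(** A linear function of the weight that every lowering operator increases by a positive integer. *)
Definition ht (s : seq I) (w : I -> F) : F := \sum_(i <- s) w i * (index i s)%:R.

Lemma ht_same s w w' : same s w w' -> ht s w = ht s w'.
Proof.
move=> /allP h; rewrite /ht big_seq [RHS]big_seq; apply: eq_bigr => i hi.
by have /eqP -> := h i hi.
Qed.

Lemma ht_act s w k l : uniq s -> k \in s -> l \in s ->
  ht s (fun i => w i + ((i == k)%:R - (i == l)%:R)) = ht s w + ((index k s)%:R - (index l s)%:R).
Proof.
move=> us hk hl; rewrite /ht.
have e j : j \in s -> \sum_(i <- s) (i == j)%:R * (index i s)%:R = (index j s)%:R :> F.
  move=> hj; rewrite (bigD1_seq j) //= eqxx mul1r big1 ?addr0 // => i /negPf ->.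
  by rewrite mul0r.
rewrite -(e k hk) -(e l hl) -sumrB -big_split /=; apply: eq_bigr => i _; ring.
Qed.

(** A vector of [low] is a multiple of [v] plus weight vectors whose [ht] exceeds that of [w] by a
    positive integer. This integer is nonzero in characteristic 0, so extracting the component of
    weight [w] leaves only the multiple of [v]. *)
Lemma low_top s w v x : uniq s -> hwv s w v -> low s v x -> wv s w x ->
  exists c, x = c *: v.
Proof.
move=> us [_ hw hs] hl hx.
pose T := {p : A * (I -> F) | wv s p.2 p.1 /\ exists n : nat, ht s p.2 = ht s w + n.+1%:R}.
have {hl} [c [r e]] : exists c (r : seq T), x = c *: v + \sum_(t <- r) (sval t).1.
  elim: hl => {x hx} [|| a x y _ [c [r ->]] _ [c' [r' ->]] | i j x hij _ [c [r ->]]].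
  - by exists 1, [::]; rewrite big_nil scale1r addr0.
  - by exists 0, [::]; rewrite big_nil scale0r addr0.
  - have hz (t : T) : wv s (sval t).2 (a *: (sval t).1) /\ exists n : nat, ht s (sval t).2 = ht s w + n.+1%:R.
      by case: t => -[z wz] /= [h1 h2]; split=> // k hk; rewrite EZ h1 // scalerA mulrC -scalerA.
    exists (a * c + c'), (map (fun t : T => exist _ (a *: (sval t).1, (sval t).2) (hz t)) r ++ r').
    rewrite big_cat big_map /= -scaler_sumr scalerDr scalerA scalerDl addrACA //.
  have /and3P[hi hj hlt] := hij.
  have hv : wv s (fun k => w k + ((k == j)%:R - (k == i)%:R)) (c *: E j i v) /\
      exists n : nat, ht s (fun k => w k + ((k == j)%:R - (k == i)%:R)) = ht s w + n.+1%:R.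
    split; first by move=> k hk; rewrite EZ (wv_act _ _ hw) // scalerA mulrC -scalerA.
    exists (index j s - index i s).-1; rewrite ht_act //.
    by rewrite prednK ?subn_gt0 // natrB // ltnW.
  have hz (t : T) : wv s (fun k => (sval t).2 k + ((k == j)%:R - (k == i)%:R)) (E j i (sval t).1) /\
      exists n : nat, ht s (fun k => (sval t).2 k + ((k == j)%:R - (k == i)%:R)) = ht s w + n.+1%:R.
    case: t => -[z wz] /= [h1 [n h2]]; split; first by apply: wv_act.
    exists (n.+1 + (index j s - index i s).-1)%N; rewrite ht_act // h2.
    rewrite -addrA; congr (_ + _); rewrite -addnS prednK ?subn_gt0 // natrD natrB // ltnW //.
  exists 0, ((exist _ (_, _) hv : T) :: map (fun t : T => exist _ (_, _) (hz t)) r).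
  by rewrite scale0r add0r big_cons big_map /= ED EZ Esum.
have h := @weight_component s _ T r (fun t => (sval t).1) (fun t => (sval t).2) w (c *: v - x)
  (conj subsp_zero _) _ _ _.
have z : \sum_(t <- r | same s (sval t).2 w) (sval t).1 = 0.
  apply: big1 => -[[z wz] /= [_ [n h1]]] /ht_same; rewrite h1 => /eqP.
  by rewrite -subr_eq0 addrAC subrr add0r pnatr_eq0.
exists c; apply/esym/eqP; rewrite -subr_eq0; apply/eqP.
rewrite -[LHS]addr0 -[X in _ + X]z; apply: h.
- by move=> i y hi ->; rewrite E0.
- by move=> [[z' wz] /= []].
- by move=> i hi; rewrite EB EZ hw // hx // scalerBr !scalerA mulrC.
by rewrite addrAC -e subrr.
Qed.

Definition irred s v := forall S, jsub s S -> (forall x, S x -> gen s v x) ->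
  forall x, S x -> x <> 0 -> S v.
End General.

End Rep.

(** * Uniqueness of highest weight modules *)

Section HighestWeightUnique.
Variables (F : numClosedFieldType) (I : finType) (par : I -> bool).
Variables (A B : lmodType F) (EA : I -> I -> A -> A) (EB' : I -> I -> B -> B).
Hypotheses (repA : glrep par EA) (repB : glrep par EB').

Let EP i j (p : A * B) : A * B := (EA i j p.1, EB' i j p.2).

Lemma glrep_prod : glrep par EP.
Proof.
split=> [i j a x y | i j k l x].
  exact: (f_equal2 pair (gl_lin repA i j a x.1 y.1) (gl_lin repB i j a x.2 y.2)).
exact: (f_equal2 pair (gl_rel repA i j k l x.1) (gl_rel repB i j k l x.2)).
Qed.

(** The submodule [G] of the product generated by [(a, b)] is the graph of the isomorphism. If it
    contained some [(0, y)] with [y] nonzero, irreducibility would put [(0, b)] in it; this vector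
    has weight [w], so it would be a multiple of [(a, b)] by [low_top], which is absurd. The other
    side is symmetric. *)
Lemma hw_iso s w a b : uniq s -> hwv EA s w a -> hwv EB' s w b ->
  irred EA s a -> irred EB' s b ->
  exists phi : A -> B, [/\ forall x, gen EA s a x -> gen EB' s b (phi x),
    forall c x y, gen EA s a x -> gen EA s a y -> phi (c *: x + y) = c *: phi x + phi y,
    forall i j x, i \in s -> j \in s -> gen EA s a x -> phi (EA i j x) = EB' i j (phi x),
    forall x, gen EA s a x -> phi x = 0 -> x = 0
  & forall y, gen EB' s b y -> exists2 x, gen EA s a x & phi x = y].
Proof.
move=> us ha hb ia ib.
have [a0 wa sa] := ha; have [b0 wb sb] := hb.
have hab : hwv EP s w (a, b).
  split; first by case.
    by move=> i hi; rewrite /EP /= wa // wb.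
  by move=> i j hij; rewrite /EP /= sa // sb.
pose G := gen EP s (a, b).
have GA p : G p -> gen EA s a p.1.
  elim=> {p} [|| c x y _ h1 _ h2 | i j x hi hj _ h] /=; [exact: gen_base | exact: gen_zero | exact: gen_lin | exact: gen_act].
have GB p : G p -> gen EB' s b p.2.
  elim=> {p} [|| c x y _ h1 _ h2 | i j x hi hj _ h] /=; [exact: gen_base | exact: gen_zero | exact: gen_lin | exact: gen_act].
have top p : G p -> wv EP s w p -> exists c, p = c *: (a, b).
  by move=> hp; apply: (low_top glrep_prod us hab); apply: (gen_low glrep_prod hab).
have G0b y : G (0, y) -> y = 0.
  move=> hy; apply: contrapT => y0.
  have hj : jsub EB' s (fun y => G (0, y)).
    split; first split; first exact: gen_zero.
      move=> c x z hx hz; have z0 : 0 = c *: 0 + 0 :> A by rewrite scaler0 addr0.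
      by have -> : (0, c *: x + z) = c *: ((0, x) : A * B) + (0, z) := f_equal2 pair z0 erefl; apply: gen_lin.
    by move=> i j x hi hj hx; have := gen_act hi hj hx; rewrite /EP /= (E0 repA).
  have hb' := ib _ hj (fun y h => GB (0, y) h) y hy y0.
  have [|c [ca cb]] := top _ hb'.
    move=> i hi; have z0 : EA i i 0 = w i *: 0 by rewrite (E0 repA) scaler0.
    exact: (f_equal2 pair z0 (wb i hi)).
  move/esym/eqP: ca; rewrite scaler_eq0 => /orP[/eqP c0|/eqP //].
  by apply: b0; rewrite cb c0 scale0r.
have Ga0 x : G (x, 0) -> x = 0.
  move=> hx; apply: contrapT => x0.
  have hj : jsub EA s (fun x => G (x, 0)).
    split; first split; first exact: gen_zero.
      move=> c y z hy hz; have z0 : 0 = c *: 0 + 0 :> B by rewrite scaler0 addr0.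
      by have -> : (c *: y + z, 0) = c *: ((y, 0) : A * B) + (z, 0) := f_equal2 pair erefl z0; apply: gen_lin.
    by move=> i j y hi hj hy; have := gen_act hi hj hy; rewrite /EP /= (E0 repB).
  have ha' := ia _ hj (fun x h => GA (x, 0) h) x hx x0.
  have [|c [ca cb]] := top _ ha'.
    move=> i hi; have z0 : EB' i i 0 = w i *: 0 by rewrite (E0 repB) scaler0.
    exact: (f_equal2 pair (wa i hi) z0).
  move/esym/eqP: cb; rewrite scaler_eq0 => /orP[/eqP c0|/eqP //].
  by apply: a0; rewrite ca c0 scale0r.
have spG : subsp G by exact: subsp_gen.
have exG x : gen EA s a x -> exists y, G (x, y).
  elim=> {x} [|| c x y _ [x' hx] _ [y' hy] | i j x hi hj _ [y h]].
  - by exists b; apply: gen_base.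
  - by exists 0; apply: gen_zero.
  - by exists (c *: x' + y'); apply: (gen_lin c hx hy).
  by exists (EB' i j y); apply: (gen_act hi hj h).
have exG' y : gen EB' s b y -> exists x, G (x, y).
  elim=> {y} [|| c x y _ [x' hx] _ [y' hy] | i j x hi hj _ [y h]].
  - by exists a; apply: gen_base.
  - by exists 0; apply: gen_zero.
  - by exists (c *: x' + y'); apply: (gen_lin c hx hy).
  by exists (EA i j y); apply: (gen_act hi hj h).
have unG x y y' : G (x, y) -> G (x, y') -> y = y'.
  move=> h h'; apply/eqP; rewrite -subr_eq0; apply/eqP/G0b.
  by have -> : (0, y - y') = ((x, y) : A * B) - (x, y') := f_equal2 pair (esym (subrr x)) erefl; apply: subspB.
(* Outside the module generated by [a] the set is empty and [phi] takes the default value 0; hence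
   all the clauses are restricted to generated vectors. *)
pose phi x := xget 0 [set y | G (x, y)].
have phiG x : gen EA s a x -> G (x, phi x).
  by move=> /exG [y hy]; rewrite /phi; apply: (@xgetPex _ 0 [set y | G (x, y)]); exists y.
exists phi; split.
- by move=> x /phiG /GB.
- by move=> c x y hx hy; apply: (unG (c *: x + y)); [apply: phiG; apply: gen_lin | apply: (gen_lin c (phiG _ hx) (phiG _ hy))].
- by move=> i j x hi hj hx; apply: (unG (EA i j x)); [apply: phiG; apply: gen_act | apply: (gen_act hi hj (phiG _ hx))].
- by move=> x /phiG hx h; apply: Ga0; rewrite -h.
move=> y /exG' [x hx]; have hx' := GA _ hx; exists x => //.
exact: unG (phiG _ hx') hx.
Qed.
End HighestWeightUnique.

(** * Changing the order of two adjacent letters *)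

Section Adjacent.
Variable I : eqType.
Implicit Types (p q s : seq I) (x y i j : I).

Lemma uniq_swap p q x y : uniq (p ++ x :: y :: q) = uniq (p ++ y :: x :: q).
Proof.
by apply: perm_uniq; rewrite perm_cat2l; apply/permP => a /=; rewrite addnCA.
Qed.

Lemma before_swap p q x y i j : uniq (p ++ x :: y :: q) ->
  before (p ++ y :: x :: q) i j ->
  (i = y /\ j = x) \/ (before (p ++ x :: y :: q) i j /\ ~ (i = x /\ j = y)).
Proof.
elim: p => [|z p IH] /= h.
  have h' : uniq (y :: x :: q) by rewrite -(uniq_swap [::]).
  have [/= /andP[h1 h2] /andP[h3 h4]] := (h, h').
  have [h5 _] := andP h2; have [h6 _] := andP h4.
  rewrite !before_cons //; move: h1 h3; rewrite !inE !negb_or => /andP[nxy _] /andP[nyx _].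
  move=> /orP[/andP[/eqP -> /orP[/eqP ->|hj]]|/orP[/andP[/eqP -> hj]|hb]]; [by left|right|right|right].
  - by rewrite eqxx hj !orbT; split=> // -[_ e]; rewrite e (negPf h5) in hj.
  - by rewrite eqxx hj !orbT; split=> // -[_ e]; rewrite e (negPf h5) in hj.
  rewrite hb !orbT; split=> // -[_ e]; move/and3P: hb => [_ hj _].
  by rewrite e (negPf h5) in hj.
have [hz hu] := andP h.
rewrite !before_cons //; last first.
  by move: hz; rewrite !mem_cat !inE !negb_or => /and4P[-> -> -> ->].
have mem_s k : (k \in p ++ y :: x :: q) = (k \in p ++ x :: y :: q).
  by rewrite !mem_cat !inE; case: (k \in p) => //=; rewrite orbCA.
move=> /orP[/andP[/eqP -> hj]|/(IH hu) [?|[hb hn]]]; [right|by left|right].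
  rewrite eqxx -mem_s hj; split=> // -[e _].
  by move: hz; rewrite e mem_cat inE eqxx orbT.
by rewrite hb orbT.
Qed.

Lemma before_adjl p q x y i : uniq (p ++ x :: y :: q) ->
  before (p ++ x :: y :: q) i y -> i != x -> before (p ++ x :: y :: q) i x.
Proof.
elim: p => [|z p IH] /= h.
  have /and3P[h1 h2 h3] := h.
  rewrite !before_cons // => /orP[/andP[-> _] //|/orP[/andP[_ hy]|/and3P[_ hy _]]];
  by rewrite (negPf h2) in hy.
have [hz hu] := andP h; rewrite !before_cons // => /orP[/andP[-> _] _|h1 h2].
  by rewrite mem_cat inE eqxx !orbT.
by rewrite (IH hu h1 h2) orbT.
Qed.

Lemma before_adjr p q x y j : uniq (p ++ x :: y :: q) ->
  before (p ++ x :: y :: q) x j -> j != y -> before (p ++ x :: y :: q) y j.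
Proof.
elim: p => [|z p IH] /= h.
  have /and3P[h1 h2 h3] := h.
  rewrite !before_cons // !eqxx /= => /orP[|/orP[/andP[/eqP e _]|/and3P[hx _ _]]].
  - by rewrite inE => /orP[/eqP -> |-> _]; rewrite ?eqxx ?orbT.
  - by move: h1; rewrite e inE eqxx.
  by move: h1; rewrite inE hx orbT.
have [hz hu] := andP h; rewrite !before_cons // => /orP[/andP[/eqP e _]|h1 h2].
  by move: hz; rewrite -e mem_cat inE eqxx orbT.
by rewrite (IH hu h1 h2) orbT.
Qed.

Lemma before_adj p q x y : uniq (p ++ x :: y :: q) -> before (p ++ x :: y :: q) x y.
Proof.
elim: p => [|z p IH] /= /andP[h hu]; rewrite before_cons //; first by rewrite eqxx inE eqxx.
by rewrite IH ?orbT.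
Qed.
End Adjacent.

Section Polynomial.
Variables (F : numClosedFieldType) (I : finType) (par : I -> bool).
Variables (A : lmodType F) (E : I -> I -> A -> A).
Hypothesis rep : glrep par E.

Definition natw (w : I -> nat) : I -> F := fun i => (w i)%:R.

Record wvec := WVec {
  wval : A; wwt : I -> nat; wvecP : forall i, E i i wval = (wwt i)%:R *: wval }.

Definition polyrep := forall x : A, exists r : seq wvec, x = \sum_(t <- r) wval t.

Hypothesis polyA : polyrep.

(** Were [c] not a natural number, no summand of [x] would have eigenvalue [c], and extracting the
    component of eigenvalue [c] inside the zero subspace would give [x = 0]. *)
Lemma poly_eig i c x : E i i x = c *: x -> x <> 0 -> exists n : nat, c = n%:R.
Proof.
move=> hx x0; have [r e] := polyA x.
apply: contrapT => hn; apply: x0.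
have z : \sum_(t <- r | same [:: i] (natw (wwt t)) (fun _ => c)) wval t = 0.
  by apply: big1 => t; rewrite /same /= andbT => /eqP h; case: hn; exists (wwt t i).
apply/eqP; rewrite -oppr_eq0 -[- x]addr0 -[X in _ + X]z; apply/eqP.
refine (@weight_component _ _ par _ _ rep [:: i] (fun x => x = 0) wvec r wval (fun t => natw (wwt t)) (fun _ => c) (- x) _ _ _ _).
- by split; [apply: subsp_zero | move=> j y _ ->; rewrite (E0 rep)].
- by move=> t j _; rewrite wvecP.
- by move=> j; rewrite inE => /eqP ->; rewrite (EN rep) hx scalerN.
by rewrite -e addNr.
Qed.

Lemma act_weight (s : seq I) w k l x : l \in s -> k != l -> wv E s (natw w) x -> E k l x <> 0 ->
  (0 < w l)%N /\ wv E s (natw (fun i => w i + (i == k) - (i == l))%N) (E k l x).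
Proof.
move=> hl nkl hx ne0.
have [n hn] := poly_eig (wv_act rep k l hx hl) ne0.
have hw : w l = n.+1.
  apply/eqP; move: hn; rewrite /natw eqxx eq_sym (negPf nkl) sub0r => hn.
  by rewrite -(eqr_nat F) -[n.+1]addn1 natrD -hn subrK.
split=> [|i hi]; first by rewrite hw.
rewrite (wv_act rep k l hx) //; congr (_ *: _); rewrite /natw.
case: (i =P l) => [->|_]; last by rewrite subn0 subr0 natrD.
by rewrite [l == k]eq_sym (negPf nkl) hw addn0 subn1 sub0r /= -[n.+1]addn1 natrD addrK.
Qed.

Section Swap.
Variables (p q : seq I) (x y : I) (w : I -> nat) (v : A).
Let s := p ++ x :: y :: q.
Let s' := p ++ y :: x :: q.
Hypotheses (us : uniq s) (hv : hwv E s (natw w) v).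

Let u k := iter k (E y x) v.

Let xs : x \in s. Proof. by rewrite mem_cat inE eqxx orbT. Qed.
Let ys : y \in s. Proof. by rewrite mem_cat !inE eqxx !orbT. Qed.
Let nxy : x != y. Proof. exact: before_neq (before_adj us). Qed.

Lemma mem_swap i : (i \in s') = (i \in s).
Proof. by rewrite !mem_cat !inE; case: (i \in p) => //=; rewrite orbCA. Qed.

(** The commutator of [E i j] with [E y x] involves only [E i x] (if [j = y]) and [E y j] (if
    [i = x]). Since [x] and [y] are adjacent these are again raising operators other than [E x y],
    so induction on [k] applies. *)
Lemma swap_sing k i j : before s i j -> ~ (i = x /\ j = y) -> E i j (u k) = 0.
Proof.
elim: k i j => [|k IH] i j hb hn; first by have [_ _ h] := hv; apply: h.
rewrite /u iterS (gl_rel rep) -/(u k) IH // (E0 rep) scaler0 add0r.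
apply/eqP; rewrite subr_eq0; apply/eqP.
case: (j =P y) => [ej|_]; case: (i =P x) => [ei|ni]; rewrite /= ?mulr0 ?scale0r //.
- by case: hn.
- have hb' : before s i x by move: hb; rewrite ej => hb; exact: (before_adjl us hb (introN eqP ni)).
  by rewrite (IH i x hb') ?scaler0 // => -[e _].
have hb' : before s y j.
  by move: hb; rewrite ei => hb; apply: (before_adjr us hb); apply/eqP => ej; apply: hn.
by rewrite (IH y j hb') ?scaler0 // => -[e _]; move: nxy; rewrite e eqxx.
Qed.

Lemma swap_gen k : gen E s v (u k).
Proof. by elim: k => [|k IH]; [apply: gen_base | apply: gen_act]. Qed.

Lemma swap_wv k : wv E s (fun i => (w i)%:R + ((i == y)%:R - (i == x)%:R) * k%:R) (u k).
Proof.
elim: k => [|k IH] i hi; first by have [_ h _] := hv; rewrite mulr0 addr0 h.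
rewrite /u iterS (wv_act rep y x IH) // -/(u k); congr (_ *: _).
by rewrite -[k.+1]addn1 natrD; ring.
Qed.

Lemma swap_bound k : u k <> 0 -> (k <= w x)%N.
Proof.
move=> h; have [n hn] := poly_eig (swap_wv k xs) h.
move: hn; rewrite eqxx (negPf nxy) sub0r mulN1r => /eqP.
by rewrite subr_eq -natrD eqr_nat => /eqP ->; rewrite leq_addl.
Qed.

Lemma swap_hwv k w' : u k <> 0 -> u k.+1 = 0 ->
  (forall i, (w i)%:R + ((i == y)%:R - (i == x)%:R) * k%:R = (w' i)%:R :> F) ->
  hwv E s' (natw w') (u k).
Proof.
move=> h0 h1 hw; split=> // [i|i j].
  by rewrite mem_swap => hi; rewrite swap_wv // hw.
move=> /(before_swap us) [[-> ->]|[hb hn]]; first exact: h1.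
exact: swap_sing.
Qed.

(** The odd reflection. [E y x] squares to zero and [E x y (E y x v)] is [w x + w y] times [v]. If
    this scalar is nonzero, [E y x v] is the new highest weight vector. If it is zero, then
    [w x = 0], and [E y x v] vanishes since its weight at [x] would be negative; [v] itself stays
    highest. *)
Lemma swap_odd : par x != par y ->
  exists v' w', [/\ gen E s v v', hwv E s' (natw w') v',
    forall i, i != x -> i != y -> w' i = w i
  & if (w x + w y == 0)%N then w' x = 0%N /\ w' y = 0%N
    else w x = (w' x).+1 /\ w' y = (w y).+1].
Proof.
move=> pxy; have [v0 hw hs] := hv.
have pyx : par y (+) par x = true by move: pxy; case: (par x); case: (par y).
have pxy' : par x (+) par y = true by move: pxy; case: (par x); case: (par y).
have sq z : E y x (E y x z) = 0.
  have /eqP := gl_rel rep y x y x z.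
  rewrite /sgn pyx /= expr1 scaleN1r (negPf nxy) [y == x]eq_sym (negPf nxy) mulr0 !scale0r subr0 addr0.
  by rewrite -subr_eq0 opprK -mulr2n -scaler_nat scaler_eq0 pnatr_eq0 /= => /eqP.
have e1 : E x y (u 1) = (w x + w y)%:R *: v.
  rewrite /u /= (gl_rel rep) /sgn pxy' pyx /= expr1 (hs x y) ?before_adj // (E0 rep) scaler0 add0r !eqxx scale1r.
  by rewrite mulr1 !hw // scaleN1r opprK /natw natrD scalerDl.
case: eqP => h0.
  exists v, w; split=> //; first exact: gen_base; last by split; lia.
  apply: (@swap_hwv 0) => //; last by move=> i; rewrite mulr0 addr0.
  apply: contrapT => /swap_bound; lia.
have u1 : u 1 <> 0.
  move=> h; move: e1; rewrite h (E0 rep) => /esym/eqP; rewrite scaler_eq0 pnatr_eq0.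
  by case/orP => /eqP.
have hx := swap_bound u1.
exists (u 1), (fun i => w i + (i == y) - (i == x))%N; split=> //.
- exact: swap_gen.
- apply: swap_hwv => // [|i]; first exact: sq.
  rewrite mulr1; case: (i =P x) => [->|_]; last by rewrite subr0 subn0 natrD.
  by rewrite (negPf nxy) sub0r addn0 natrB.
- by move=> i /negPf -> /negPf ->; lia.
by rewrite !eqxx (negPf nxy) [y == x]eq_sym (negPf nxy); lia.
Qed.

(** The representation theory of sl(2) for the pair [x], [y]: the last nonzero [u k] exists because
    the weight at [x] drops at each step and must stay nonnegative, and the formula for
    [E x y (u k.+1)] forces [w x = w y + k]. *)
Lemma swap_even : par x = par y ->
  (w y <= w x)%N /\ exists v' w', [/\ gen E s v v', hwv E s' (natw w') v',
    forall i, i != x -> i != y -> w' i = w i & w' x = w y /\ w' y = w x].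
Proof.
move=> pxy; have [v0 hw hs] := hv.
have e1 k : E x y (u k.+1) = ((k.+1)%:R * ((w x)%:R - (w y)%:R - k%:R)) *: u k.
  elim: k => [|k IH].
    rewrite /u /= (gl_rel rep) /sgn pxy addbb /= expr0 (hs x y) ?before_adj // (E0 rep) scaler0 add0r !eqxx.
    by rewrite !hw // mulr1 !scale1r subr0 mul1r scalerBl.
  rewrite {1}/u iterS -/(u k.+1) (gl_rel rep) /sgn pxy addbb /= expr0 !eqxx IH (EZ rep).
  rewrite -[E y x (u k)]/(u k.+1) !swap_wv // !eqxx [y == x]eq_sym (negPf nxy) mulr1 !scale1r.
  rewrite -scalerBl -scalerDl; congr (_ *: _); rewrite /= -[k.+2]addn1 -[k.+1]addn1 !natrD; ring.
have ex : exists k, u k.+1 == 0.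
  exists (w x); apply/eqP; apply: contrapT => /swap_bound; lia.
have [k /eqP hk hmin] := ex_minnP ex.
have uk : u k <> 0.
  case: k hk hmin => // k _ hmin h.
  by have := hmin k; rewrite h eqxx => /(_ isT); lia.
have wxy : w x = (w y + k)%N.
  have := e1 k; rewrite hk (E0 rep) => /esym/eqP; rewrite scaler_eq0 mulf_eq0 pnatr_eq0 /=.
  case/orP => [|/eqP //]; rewrite subr_eq0 subr_eq addrC -natrD eqr_nat => /eqP ->; lia.
split; first by rewrite wxy leq_addr.
exists (u k), (fun i => if i == x then w y else if i == y then w x else w i); split=> //.
- exact: swap_gen.
- apply: swap_hwv => // i; case: (i =P x) => [->|_].
    by rewrite (negPf nxy) wxy natrD sub0r mulN1r addrK.
  case: (i =P y) => [->|_]; first by rewrite subr0 mul1r wxy natrD.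
  by rewrite subr0 mul0r addr0.
- by move=> i /negPf -> /negPf ->.
by rewrite !eqxx [y == x]eq_sym (negPf nxy).
Qed.
End Swap.
End Polynomial.

(** * Highest weights of polynomial modules *)

Section PartitionLetters.
Local Open Scope nat_scope.
Implicit Types lam mu rho : int_partition.

Lemma cons_part b rho k : first b rho <= k ->
  exists lam, first b lam = k /\ rest b lam = rho.
Proof.
have h (mu : int_partition) : part mu 0 <= k -> exists lam, first false lam = k /\ rest false lam = mu.
  move=> hk; exists (part_of (fun i => if i is j.+1 then part mu j else k) (size mu).+1).
  have e : part (part_of (fun i => if i is j.+1 then part mu j else k) (size mu).+1)
      =1 (fun i => if i is j.+1 then part mu j else k).
    apply: part_ofE => [[|i] //|]; first exact: part_decr.
    by rewrite /part nth_default.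
  split; first by rewrite /first e.
  by apply: part_inj => i; rewrite part_rest e.
case: b; last exact: h.
rewrite -[true]/(~~ false) -first_conj => /h [lam [h1 h2]].
exists (conjp lam); rewrite first_conj h1; split=> //.
by rewrite rest_conj h2 conjpK.
Qed.

Lemma first_mono b lam mu : subpart lam mu -> first b lam <= first b mu.
Proof.
case: b => /=; last by move/subpartP.
move/subpart_boxP => h; rewrite leqNgt; apply/negP.
by rewrite conj_partE => /h; rewrite -conj_partE ltnn.
Qed.

Lemma first_rest_neg b lam : first b (rest (~~ b) lam) = (first b lam).-1.
Proof.
case: b; last by rewrite /= part_rest.
by rewrite -[true]/(~~ false) -!first_conj -rest_conj /= part_rest.
Qed.

Lemma first_pos b lam : (0 < first b lam) = (0 < size lam).
Proof. by case: b => /=; rewrite ?conj_partE /box part_pos. Qed.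

Lemma first_size0 b lam : first b lam = 0 -> lam = empty_part.
Proof.
move=> h; have : ~~ (0 < size lam) by rewrite -(first_pos b) h.
by rewrite -eqn0Ngt => /nilP h'; apply: val_inj.
Qed.

Lemma first_empty b : first b empty_part = 0.
Proof. by case: b. Qed.

Lemma rest_empty b : rest b empty_part = empty_part.
Proof.
by apply: part_inj => i; rewrite part_rest /part !nth_nil; case: b.
Qed.

Lemma wt_inj (I : eqType) (par : I -> bool) s lam mu : uniq s ->
  hk (map par s) lam -> hk (map par s) mu ->
  (forall i, i \in s -> wt par s lam i = wt par s mu i) -> lam = mu.
Proof.
move=> us hl hm h; by apply: subpart_anti; apply: (wt_sub (par := par) us) => // i hi; rewrite h.
Qed.
End PartitionLetters.

Section HighestWeights.
Variables (F : numClosedFieldType) (I : finType) (par : I -> bool).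

Section AnyModule.
Variables (A : lmodType F) (E : I -> I -> A -> A).

Lemma hwv_ext s w w' v : (forall i, i \in s -> w i = w' i) -> hwv E s w v -> hwv E s w' v.
Proof. by move=> h [v0 hw hs]; split=> // i hi; rewrite -h // hw. Qed.

Lemma hwv_subset s s' w v : {subset s' <= s} -> (forall i j, before s' i j -> before s i j) ->
  hwv E s w v -> hwv E s' w v.
Proof. by move=> h1 h2 [v0 hw hs]; split=> // [i /h1|i j /h2]; [apply: hw | apply: hs]. Qed.

Lemma hwv_behead x s w v : x \notin s -> hwv E (x :: s) w v -> hwv E s w v.
Proof.
move=> xs; apply: hwv_subset => [i|i j h]; first by rewrite inE => ->; rewrite orbT.
by rewrite before_cons // h orbT.
Qed.

Lemma gen_sub s s' v x : {subset s <= s'} -> gen E s v x -> gen E s' v x.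
Proof.
move=> h; elim=> {x} [|| c x y _ h1 _ h2 | i j x hi hj _ h1]; [exact: gen_base | exact: gen_zero | exact: gen_lin | ].
by apply: gen_act => //; apply: h.
Qed.

Lemma gen_trans s u v x : gen E s u v -> gen E s v x -> gen E s u x.
Proof. by move=> h; apply: gen_min => //; apply: jsub_gen. Qed.
End AnyModule.

Variables (A : lmodType F) (E : I -> I -> A -> A).
Hypotheses (rep : glrep par E) (polyA : polyrep E).

(* Moving the first letter past the second one shows, by induction, that the  *)
(* row or column of the first letter fits on the partition of the others.     *)
Lemma hw_partition s w v : uniq s -> hwv E s (natw F w) v ->
  exists lam, hk (map par s) lam /\ forall i, i \in s -> w i = wt par s lam i.
Proof.
move: {2}(size s) (leqnn (size s)) => n; elim: n s w v => [|n IH] [|x s] w v //= hn.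
- by exists empty_part.
- by exists empty_part.
move=> /andP[xs us] hv; have us' : uniq (x :: s) by rewrite /= xs.
have [rho [hr hw]] := IH s w v hn us (hwv_behead xs hv).
suff /cons_part [lam [h1 h2]] : (first (par x) rho <= w x)%N.
  exists lam; rewrite h2; split=> // i; rewrite inE h1.
  by case: (i =P x) => [-> //|_] /= hi; rewrite hw.
case: s xs us us' hn hv hr hw => [|y s] xs us us' hn hv hr hw.
  by move: hr => /= /nilP hr; rewrite (_ : rho = empty_part) ?first_empty //; apply: val_inj.
have hy : w y = first (par y) rho by rewrite hw ?inE ?eqxx //= eqxx.
case: (par x =P par y) => pxy.
  have [h _] := swap_even rep polyA (p := [::]) us' hv pxy.
  by rewrite pxy -hy.
have [v' [w' [_ hv' hw' hrule]]] := swap_odd rep polyA (p := [::]) us' hv (introN eqP pxy).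
have ny : par y = ~~ par x by move: pxy; case: (par x); case: (par y).
move: hrule; case: eqP => [h0 _|_ [hx _]].
  move/eqP: h0; rewrite addn_eq0 => /andP[_ /eqP wy0].
  by move: hy; rewrite wy0 => /esym /first_size0 ->; rewrite first_empty.
have uy : uniq (y :: x :: s) by rewrite -(uniq_swap [::]).
have [/= /andP[yx uxs]] := uy; have [_ us2] := andP uxs.
have [tau [ht hw2]] := IH (x :: s) w' v' hn uxs (hwv_behead yx hv').
(* Both sides describe the weight on [s], which the exchange of [x] and [y] leaves unchanged. As [x]
   and [y] have opposite parities, peeling [rho] by [y] shortens its first line of type [x] by
   exactly one; this matches [w' x = w x - 1]. *)
have e : rest (par y) rho = rest (par x) tau.
  apply: (@wt_inj _ par s) => // i hi.
  have ix : i != x by apply: contraTneq hi => ->; case/andP: uxs.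
  have iy : i != y by apply: contraTneq hi => ->; case/andP: us.
  have := hw i; have := hw2 i; rewrite !inE hi !orbT /= (negPf ix) (negPf iy).
  by move=> /(_ isT) <- /(_ isT) <-; rewrite hw'.
have hx' : w' x = first (par x) tau by rewrite hw2 ?inE ?eqxx //= eqxx.
rewrite hx hx'.
have := first_mono (par x) (subpart_rest (par x) tau).
by rewrite -e ny first_rest_neg; case: (first _ rho).
Qed.

(** The exchange rules agree with peeling in the other order: for letters of different parity the
    row and the column peeled share a corner box, which is counted for the letter that comes first;
    the remaining partition is the same by [restC]. *)
Lemma swap_wt p q x y lam v : uniq (p ++ x :: y :: q) ->
  hwv E (p ++ x :: y :: q) (natw F (wt par (p ++ x :: y :: q) lam)) v ->
  exists2 v', gen E (p ++ x :: y :: q) v v'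
  & hwv E (p ++ y :: x :: q) (natw F (wt par (p ++ y :: x :: q) lam)) v'.
Proof.
move=> us hv; set k := peel (map par p) lam.
have nxy : x != y := before_neq (before_adj us).
have [xp yp] : x \notin p /\ y \notin p.
  by move: us; rewrite cat_uniq /= !negb_or => /and3P[_ /and3P[-> ->]].
have wx : wt par (p ++ x :: y :: q) lam x = first (par x) k.
  by rewrite wt_cat (negPf xp) /= eqxx.
have wy : wt par (p ++ x :: y :: q) lam y = first (par y) (rest (par x) k).
  by rewrite wt_cat (negPf yp) /= eq_sym (negPf nxy) eqxx.
have wx' : wt par (p ++ y :: x :: q) lam x = first (par x) (rest (par y) k).
  by rewrite wt_cat (negPf xp) /= (negPf nxy) eqxx.
have wy' : wt par (p ++ y :: x :: q) lam y = first (par y) k.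
  by rewrite wt_cat (negPf yp) /= eqxx.
have wo i : i != x -> i != y -> wt par (p ++ x :: y :: q) lam i = wt par (p ++ y :: x :: q) lam i.
  by move=> /negPf ix /negPf iy; rewrite !wt_cat /= ix iy restC.
have fin w' v' : gen E (p ++ x :: y :: q) v v' -> hwv E (p ++ y :: x :: q) (natw F w') v' ->
    (forall i, i != x -> i != y -> w' i = wt par (p ++ x :: y :: q) lam i) ->
    w' x = first (par x) (rest (par y) k) -> w' y = first (par y) k ->
    exists2 v', gen E (p ++ x :: y :: q) v v'
    & hwv E (p ++ y :: x :: q) (natw F (wt par (p ++ y :: x :: q) lam)) v'.
  move=> hg hv' h1 h2 h3; exists v' => //; apply: hwv_ext hv' => i _; congr _%:R.
  case: (eqVneq i x) => [->|ix]; first by rewrite wx'.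
  case: (eqVneq i y) => [->|iy]; first by rewrite wy'.
  by rewrite h1 // wo.
case: (par x =P par y) => pxy.
  have [_ [v' [w' [hg hv' hw' [h1 h2]]]]] := swap_even rep polyA us hv pxy.
  by apply: (fin w' v'); rewrite ?h1 ?h2 ?wx ?wy // pxy.
have [v' [w' [hg hv' hw' hrule]]] := swap_odd rep polyA us hv (introN eqP pxy).
have ny : par y = ~~ par x by move: pxy; case: (par x); case: (par y).
have nx : par x = ~~ par y by rewrite ny negbK.
apply: (fin w' v') => //; move: hrule; rewrite wx wy.
  case: eqP => [|_ [h _]]; last by rewrite [in RHS]ny first_rest_neg h.
  by move=> h [-> _]; rewrite [in RHS]ny first_rest_neg; lia.
have : (0 < first (par x) k)%N = (0 < first (par y) k)%N by rewrite !first_pos.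
rewrite [X in rest X]nx first_rest_neg.
by case: eqP => [h|_] hh [h1 ->]; lia.
Qed.

Lemma hwv_to_front p N q lam v : uniq (p ++ N :: q) ->
  hwv E (p ++ N :: q) (natw F (wt par (p ++ N :: q) lam)) v ->
  exists2 v', gen E (p ++ N :: q) v v'
  & hwv E (N :: p ++ q) (natw F (wt par (N :: p ++ q) lam)) v'.
Proof.
elim/last_ind: p q v => [|p z IH] q v us hv; first by exists v => //; apply: gen_base.
rewrite cat_rcons in us hv *.
have [v1 g1 h1] := swap_wt us hv.
have us1 : uniq (p ++ N :: z :: q) by rewrite -uniq_swap.
have [v2 g2 h2] := IH _ _ us1 h1.
exists v2; last by rewrite cat_rcons.
apply: gen_trans g1 _; apply: gen_sub g2 => i.
by rewrite !mem_cat !inE; case: (i \in p) => //=; rewrite orbCA.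
Qed.
End HighestWeights.

(** * Unitary polynomial modules *)

Section Subspaces.
Variables (F : fieldType) (X : vectType F).

(** Turns a predicate into a subspace object. It is meaningful when [S] is closed under linear
    combinations: a subspace of maximal dimension inside [S] is then all of [S] ([vspanP]).
    Otherwise it is the zero subspace. *)
Definition vspan (S : X -> Prop) : {vspace X} := xget 0%VS [set U : {vspace X} | forall x, x \in U <-> S x].
End Subspaces.

Section Subspaces2.
Variables (F : numClosedFieldType) (X : vectType F).

Lemma vspanP (S : X -> Prop) : subsp S -> forall x, x \in vspan S <-> S x.
Proof.
move=> hS; rewrite /vspan.
suff ex : exists U : {vspace X}, forall x, x \in U <-> S x.
  exact: (@xgetPex _ 0%VS [set U : {vspace X} | forall x, x \in U <-> S x]).
pose P n := `[< exists2 U : {vspace X}, \dim U = n & forall x, x \in U -> S x >].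
have exP : exists n, P n.
  exists 0%N; apply/asboolP; exists 0%VS; first by rewrite dimv0.
  by move=> x; rewrite memv0 => /eqP ->; apply: subsp0.
have bP n : P n -> (n <= \dim {:X})%N by move=> /asboolP [U <- _]; apply/dimvS/subvf.
have [n /asboolP [U dU hU] hmax] := ex_maxnP exP bP.
exists U => x; split; first exact: hU.
move=> Sx; have hP : P (\dim (U + <[x]>)%VS).
  apply/asboolP; exists (U + <[x]>)%VS => // y /memv_addP [u uU [z /vlineP [c ->] ->]].
  by apply: subspD => //; [apply: hU | apply: subspZ].
have := hmax _ hP; rewrite -dU (geq_leqif (dimv_leqif_sup (addvSl U <[x]>))) => /subvP -> //.
by apply: (subvP (addvSr U <[x]>)); rewrite memv_line.
Qed.
End Subspaces2.

Section Unitary.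
Variables (F : numClosedFieldType) (I : finType) (par : I -> bool).
Variables (X : vectType F) (E : I -> I -> X -> X) (dot : X -> X -> F).

(** A positive definite contravariant form. By [dot_adj], without any sign even for odd operators,
    the orthogonal complement of a submodule is a submodule and raising operators are adjoint to
    lowering ones. *)
Record herm_form : Prop := HermForm {
  dot_lin : forall a x y z, dot (a *: x + y) z = a * dot x z + dot y z;
  dot_conj : forall x y, dot y x = (dot x y)^*;
  dot_ge0 : forall x, 0 <= dot x x;
  dot_eq0 : forall x, dot x x = 0 -> x = 0;
  dot_adj : forall i j x y, dot (E i j x) y = dot x (E j i y) }.

Hypotheses (rep : glrep par E) (polyX : polyrep E) (herm : herm_form).

Lemma dot0l z : dot 0 z = 0.
Proof. by have := dot_lin herm (-1) 0 0 z; rewrite scaler0 addr0 mulN1r addNr. Qed.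
Lemma dotDl x y z : dot (x + y) z = dot x z + dot y z.
Proof. by rewrite -[x]scale1r (dot_lin herm) mul1r scale1r. Qed.
Lemma dotZl a x z : dot (a *: x) z = a * dot x z.
Proof. by rewrite -[a *: x]addr0 (dot_lin herm) dot0l addr0. Qed.
Lemma dot0r z : dot z 0 = 0.
Proof. by rewrite (dot_conj herm) dot0l rmorph0. Qed.
Lemma dotDr x y z : dot z (x + y) = dot z x + dot z y.
Proof. by rewrite (dot_conj herm (x + y)) dotDl rmorphD /= (dot_conj herm x z) (dot_conj herm y z). Qed.
Lemma dotZr a x z : dot z (a *: x) = a^* * dot z x.
Proof. by rewrite (dot_conj herm (a *: x)) dotZl rmorphM /= (dot_conj herm x z). Qed.

(** The products with a basis of [U] define a linear map from [V] to a space of dimension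
    [\dim U < \dim V], which must have a nonzero kernel. *)
Lemma exists_orth (U V : {vspace X}) : (U <= V)%VS -> ~~ (V <= U)%VS ->
  exists z, [/\ z \in V, z <> 0 & forall y, y \in U -> dot z y = 0].
Proof.
move=> UV nVU; pose f (x : X) : 'rV[F]_(\dim U) := \row_k dot x (vbasis U)`_k.
have lf : linear f.
  by move=> a x y; apply/rowP => k; rewrite !mxE (dot_lin herm).
pose fL := GRing.isLinear.Build _ _ _ _ f lf.
pose g : {linear X -> 'rV[F]_(\dim U)} := HB.pack f fL.
have := limg_ker_dim (linfun g) V.
have d1 : (\dim (linfun g @: V) <= \dim U)%N.
  by apply: leq_trans (dimvS (subvf _)) _; rewrite dimvf /dim /= mul1n.
have d2 : (\dim U < \dim V)%N.
  by rewrite (ltn_leqif (dimv_leqif_sup UV)).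
move=> hd; pose z := vpick (V :&: lker (linfun g)).
have z0 : z != 0.
  rewrite /z vpick0 -dimv_eq0 -lt0n; lia.
have := memv_pick (V :&: lker (linfun g)); rewrite -/z memv_cap memv_ker => /andP[zV /eqP].
rewrite lfunE /= => /rowP hz.
exists z; split=> //; first exact/eqP.
move=> y /coord_vbasis ->.
apply: (big_ind (fun y => dot z y = 0)); first exact: dot0r.
  by move=> a b ha hb; rewrite dotDr ha hb addr0.
by move=> k _; have := hz k; rewrite !mxE dotZr => ->; rewrite mulr0.
Qed.

Lemma index_weight_shift (s : seq I) w i j : uniq s -> before s i j -> (0 < w j)%N ->
  (\sum_(k <- s) (w k + (k == i) - (k == j)) * index k s < \sum_(k <- s) w k * index k s)%N.
Proof.
move=> us hij wj; have /and3P[hi hj hlt] := hij; have nij := before_neq hij.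
have e1 k : k \in s -> index k s = (\sum_(l <- s) (l == k) * index l s)%N.
  by move=> hk; rewrite (bigD1_seq k) //= eqxx mul1n big1 ?addn0 // => l /negPf ->.
suff e : ((\sum_(k <- s) (w k + (k == i) - (k == j)) * index k s) + index j s
   = (\sum_(k <- s) w k * index k s) + index i s)%N.
  by rewrite -(ltn_add2r (index j s)) e ltn_add2l.
rewrite (e1 j hj) (e1 i hi) -!big_split /=; apply: eq_bigr => k _.
by rewrite -!mulnDl; congr (_ * _)%N; case: (k =P j) => [->|_]; lia.
Qed.

(** A nonzero weight vector is isolated in [S]; raising operators are then applied as long as one
    acts nontrivially. This stops because each of them decreases the natural number
    [\sum_(k <- s) w k * index k s]. *)
Lemma exists_hwv s (S : X -> Prop) x : uniq s -> jsub E s S -> S x -> x <> 0 ->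
  exists z w, S z /\ hwv E s (natw F w) z.
Proof.
move=> us jS Sx x0.
have [z [w [Sz z0 hz]]] : exists z w, [/\ S z, z <> 0 & wv E s (natw F w) z].
  have [r e] := polyX x.
  move: {2}(size r) (leqnn (size r)) => n; elim: n r x Sx x0 e => [|n IH] [|t r] x Sx x0 e //= hn.
  - by rewrite big_nil in e.
  - by rewrite big_nil in e.
  pose P (t' : wvec E) := same s (natw F (wwt t')) (natw F (wwt t)).
  have Sc : S (\sum_(t' <- t :: r | P t') wval t').
    rewrite -[X in S X]add0r.
    apply: (weight_component rep (jsub_hsub jS)); rewrite ?add0r -?e //.
      by move=> t' i _; rewrite wvecP.
    by move=> i _; rewrite (E0 rep) scaler0.
  case: (pselect (\sum_(t' <- t :: r | P t') wval t' = 0)) => h; last first.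
    exists (\sum_(t' <- t :: r | P t') wval t'), (wwt t); split=> // i hi.
    rewrite (Esum rep) scaler_sumr; apply: eq_bigr => t' /allP/(_ i hi)/eqP e'.
    by rewrite wvecP -e'.
  apply: (IH [seq t' <- r | ~~ P t'] x) => //; last first.
    by rewrite size_filter (leq_trans (count_size _ _)).
  rewrite e (bigID P) /= h add0r big_filter big_cons /=.
  by have -> : P t by apply/allP => i _ /=.
move: {2}(\sum_(k <- s) w k * index k s)%N (leqnn (\sum_(k <- s) w k * index k s)%N) => n.
elim: n {-2}n (leqnn n) z w Sz z0 hz => [|N IH] n hnN z w Sz z0 hz hn;
  (case: (pselect (sing E s z)) => [hs|hns]; first by exists z, w);
  (have [i [j [hij hE]]] : exists i j, before s i j /\ E i j z <> 0
     by apply: contrapT => h; apply: hns => i j hij; apply: contrapT => hE; apply: h; exists i, j);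
  have /and3P[hi hj hlt] := hij;
  have [wj hw'] := act_weight rep polyX hj (before_neq hij) hz hE;
  have hdec := index_weight_shift us hij wj.
  by have := leq_trans hdec (leq_trans hn hnN); rewrite ltn0.
apply: (IH (\sum_(k <- s) (w k + (k == i) - (k == j)) * index k s)%N _ (E i j z) _ _ hE hw') => //.
  by rewrite -ltnS; apply: leq_trans hdec (leq_trans hn hnN).
by apply: (proj2 jS).
Qed.
End Unitary.

(** * Coinvariants, irreducibility and complete reducibility *)

Section Coinvariants.
Variables (F : numClosedFieldType) (I : finType) (par : I -> bool).
Variables (X : vectType F) (E : I -> I -> X -> X) (dot : X -> X -> F).
Hypotheses (rep : glrep par E) (polyX : polyrep E) (herm : herm_form E dot).

Lemma nminus_hsub s (U : X -> Prop) : jsub E s U -> hsub E s (nminus E s U).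
Proof.
move=> jU; split; first exact: subsp_nminus.
move=> i x hi; elim=> {x} [|a x y _ h1 _ h2|k l x hkl hx].
- by rewrite (E0 rep); apply: nminus_zero.
- by rewrite (EL rep); apply: nminus_lin.
rewrite (Ehh rep); apply: (subspD (subsp_nminus _ _ _)).
  by apply: nminus_act => //; apply: (proj2 jU).
by apply: (subspZ (subsp_nminus _ _ _)); apply: nminus_act.
Qed.

Lemma nminus_orth s (U : X -> Prop) z n : sing E s z -> nminus E s U n -> dot z n = 0.
Proof.
move=> hz; elim=> {n} [|a x y _ h1 _ h2|i j x hij _].
- exact: (dot0r herm).
- by rewrite (dotDr herm) (dotZr herm) h1 h2 mulr0 addr0.
by rewrite -(dot_adj herm) hz // (dot0l herm).
Qed.

Lemma sing_lin s a x y : sing E s x -> sing E s y -> sing E s (a *: x + y).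
Proof. by move=> hx hy i j h; rewrite (EL rep) hx // hy // scaler0 addr0. Qed.

Section Cover.
Variables (s : seq I) (U : X -> Prop) (T : Type) (m : T -> X) (w : T -> I -> F).
Hypotheses (jU : jsub E s U) (hm : forall t, wv E s (w t) (m t)).
Hypothesis hcov : forall x, U x -> exists r : seq (F * T),
  nminus E s U (x - \sum_(p <- r) p.1 *: m p.2).

Lemma cover_weight z eta : U z -> wv E s eta z -> exists r : seq (F * T),
  nminus E s U (z - \sum_(p <- r | same s (w p.2) eta) p.1 *: m p.2).
Proof.
move=> Uz hz; have [r hr] := hcov Uz; exists r; rewrite -sumrN.
apply: (weight_component rep (nminus_hsub jU)) => //; last by rewrite sumrN.
by move=> p i hi; rewrite (EN rep) (EZ rep) hm // scalerN !scalerA mulrC.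
Qed.

(** The family [m] spans [U] modulo [nminus]. If no member had weight [eta], then [z] would lie in
    [nminus], to which it is orthogonal as a singular vector; so [dot z z = 0]. *)
Lemma cover_exists z eta : U z -> z <> 0 -> wv E s eta z -> sing E s z ->
  exists t, same s (w t) eta.
Proof.
move=> Uz z0 hz sz; have [r hr] := cover_weight Uz hz.
apply: contrapT => hn; apply: z0; apply: (dot_eq0 herm).
move: hr; rewrite big1 ?subr0; first exact: nminus_orth.
by move=> p hp; case: hn; exists p.2.
Qed.

(** The coinvariants of weight [eta] are spanned by one vector [m t], and singular vectors inject
    into coinvariants: some combination [k *: z - z'] lies in [nminus] and is singular, hence
    orthogonal to itself. *)
Lemma cover_unique z z' eta : U z -> U z' -> z <> 0 -> wv E s eta z -> wv E s eta z' ->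
  sing E s z -> sing E s z' ->
  (forall t t', same s (w t) eta -> same s (w t') eta -> exists c, m t' = c *: m t) ->
  exists c, z' = c *: z.
Proof.
move=> Uz Uz' z0 hz hz' sz sz' hpr.
have [t ht] := cover_exists Uz z0 hz sz.
have one y : U y -> wv E s eta y -> exists c, nminus E s U (y - c *: m t).
  move=> Uy hy; have [r hr] := cover_weight Uy hy.
  suff [c e] : exists c, \sum_(p <- r | same s (w p.2) eta) p.1 *: m p.2 = c *: m t.
    by exists c; rewrite -e.
  apply: (big_ind (fun y => exists c, y = c *: m t)); first by exists 0; rewrite scale0r.
    by move=> _ _ [c ->] [c' ->]; exists (c + c'); rewrite scalerDl.
  move=> p hp; have [c ->] := hpr t p.2 ht hp.
  by exists (p.1 * c); rewrite scalerA.
have [c hc] := one z Uz hz; have [c' hc'] := one z' Uz' hz'.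
have c0 : c != 0.
  apply/eqP => c0; apply: z0; apply: (dot_eq0 herm).
  by move: hc; rewrite c0 scale0r subr0; apply: nminus_orth.
exists (c' / c); apply/eqP; rewrite -subr_eq0 -oppr_eq0 opprB; apply/eqP.
set k := c' / c; have hn : nminus E s U (k *: z + - z').
  have -> : k *: z + - z' = k *: (z - c *: m t) + -1 *: (z' - c' *: m t).
    rewrite !scalerBr scalerA divfK // !scaleN1r opprK.
    by rewrite addrACA addNr addr0.
  apply: nminus_lin => //; rewrite -[_ *: _]addr0; apply: nminus_lin => //; exact: nminus_zero.
apply: (dot_eq0 herm); apply: nminus_orth hn.
rewrite -scaleN1r addrC; apply: sing_lin => //.
by rewrite -[k *: z]addr0; apply: sing_lin => // i j _; rewrite (E0 rep).
Qed.
End Cover.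

Lemma low_cover s v x : jsub E s (gen E s v) -> low E s v x ->
  exists r : seq (F * unit), nminus E s (gen E s v) (x - \sum_(p <- r) p.1 *: v).
Proof.
move=> jU; elim=> {x} [|| a x y _ [r1 h1] _ [r2 h2] | i j x hij hx _].
- by exists [:: (1, tt)]; rewrite big_seq1 scale1r subrr; apply: nminus_zero.
- by exists [::]; rewrite big_nil subrr; apply: nminus_zero.
- exists ([seq (a * p.1, tt) | p <- r1] ++ r2).
  rewrite big_cat big_map /= (eq_bigr (fun p => a *: (p.1 *: v))); last by move=> p _; rewrite scalerA.
  by rewrite -scaler_sumr opprD addrACA -scalerBr; apply: nminus_lin.
exists [::]; rewrite big_nil subr0; apply: nminus_act => //; exact: low_gen hx.
Qed.

(** Modulo [nminus] the generated module is spanned by [v] alone, so every highest weight vector of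
    a nonzero submodule [S] has the weight of [v] and is proportional to it. *)
Lemma hwv_irred s w v : uniq s -> hwv E s w v -> irred E s v.
Proof.
move=> us hv S jS hS x Sx x0; have [v0 wv' sv] := hv.
have [z [eta [Sz [z0 hz sz]]]] := exists_hwv rep polyX us jS Sx x0.
have jU := jsub_gen E s v.
have hcov y : gen E s v y -> exists r : seq (F * unit), nminus E s (gen E s v) (y - \sum_(p <- r) p.1 *: v).
  by move=> /(gen_low rep hv); apply: low_cover.
have [t /allP ht] := cover_exists (m := fun _ => v) (w := fun _ => w) jU (fun _ => wv') hcov (hS _ Sz) z0 hz sz.
have wz : wv E s w z by move=> i hi; rewrite hz //; have /eqP -> := ht i hi.
have [|c ->] := cover_unique (m := fun _ => v) (w := fun _ => w) jU (fun _ => wv') hcov (hS _ Sz) (gen_base _ _ _) z0 wz wv' sz sv.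
  by move=> _ _ _ _; exists 1; rewrite scale1r.
by apply: subspZ (proj1 jS) _ _ Sz.
Qed.

Lemma vspan_gen s v x : x \in vspan (gen E s v) <-> gen E s v x.
Proof. by apply: vspanP; apply: subsp_gen. Qed.

(** The default is 0 when [U] has no such vector: the module generated by 0 is zero, so missing
    weights do not disturb sums of subspaces. *)
Definition pick_hwv (s : seq I) (U : {vspace X}) (w : I -> nat) : X :=
  xget 0 [set z | z \in U /\ hwv E s (natw F w) z].

(** If the sum [Y] missed part of [U], the orthogonal complement of [U :&: Y] in [U] would be a
    nonzero submodule and contain a highest weight vector. By uniqueness this is a multiple of the
    chosen one, which lies in [Y], so it would be orthogonal to itself. *)
Lemma sing_decomp s (U : {vspace X}) (T : eqType) (L : seq T) (w : T -> I -> nat) :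
  uniq s -> jsub E s (fun x => x \in U) ->
  (forall z eta, z \in U -> hwv E s (natw F eta) z ->
     exists2 t, t \in L & forall i, i \in s -> eta i = w t i) ->
  (forall z z' eta, z \in U -> z' \in U -> hwv E s (natw F eta) z -> hwv E s (natw F eta) z' ->
     exists c, z' = c *: z) ->
  (U <= \sum_(t <- L) vspan (gen E s (pick_hwv s U (w t))))%VS.
Proof.
move=> us jU hex hun; set Y := (\sum_(t <- L) _)%VS.
have jY : jsub E s (fun x => x \in Y).
  split; first by split; [apply: mem0v | move=> a x y hx hy; apply: memvD => //; apply: memvZ].
  move=> i j x hi hj; rewrite /Y; elim: L x {hex Y} => [|t L IH] x.
    by rewrite !big_nil memv0 => /eqP ->; rewrite (E0 rep) mem0v.
  rewrite !big_cons => /memv_addP [u hu [u' hu' ->]]; rewrite (ED rep).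
  apply: memv_add; last exact: IH.
  by apply/vspan_gen; apply: gen_act => //; apply/vspan_gen.
apply: contraT => nUY.
have hcap : (U :&: Y <= U)%VS by apply: capvSl.
have ncap : ~~ (U <= U :&: Y)%VS by rewrite subv_cap subvv.
have [z [zU z0 hz]] := exists_orth herm hcap ncap.
have jS : jsub E s (fun x => x \in U /\ forall y, (y \in U) && (y \in Y) -> dot x y = 0).
  have [sU hU] := jU; have [_ hY] := jY.
  split; first split.
  - by split=> [|y _]; [apply: mem0v | apply: (dot0l herm)].
  - move=> a x y [xU hx] [yU hy]; split; first by apply: (proj2 sU).
    by move=> u hu; rewrite (dot_lin herm) hx // hy // mulr0 addr0.
  move=> i j x hi hj [xU hx]; split; first exact: hU.
  by move=> y /andP[yU yY]; rewrite (dot_adj herm) hx // hU // hY.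
have [|z' [eta [[z'U hz'] hv]]] := exists_hwv rep polyX us jS (x := z) _ z0.
  by split=> // y; rewrite -memv_cap; apply: hz.
have [t tL ht] := hex _ _ z'U hv.
have hv' : hwv E s (natw F (w t)) z' by apply: hwv_ext hv => i hi; rewrite /natw ht.
have [pU hp] : pick_hwv s U (w t) \in U /\ hwv E s (natw F (w t)) (pick_hwv s U (w t)).
  by apply: (@xgetPex _ 0 [set z | z \in U /\ hwv E s (natw F (w t)) z]); exists z'.
have [c e] := hun _ _ _ pU z'U hp hv'.
have z'Y : z' \in Y.
  rewrite e; apply: memvZ.
  have : pick_hwv s U (w t) \in vspan (gen E s (pick_hwv s U (w t))).
    by apply/vspan_gen; apply: gen_base.
  apply/subvP; rewrite /Y; elim: L tL {hex Y jY nUY hcap ncap hz jS hz' z'U} => // t' L IH.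
  rewrite inE big_cons => /orP[/eqP <-|/IH h]; first exact: addvSl.
  exact: subv_trans h (addvSr _ _).
by have [[]] := hv; apply: (dot_eq0 herm); apply: hz'; rewrite z'U.
Qed.
End Coinvariants.

(** * Branching bounds *)

Section Branching.
Variables (F : numClosedFieldType) (I : finType) (par : I -> bool).
Variables (X : vectType F) (E : I -> I -> X -> X) (dot : X -> X -> F).
Hypotheses (rep : glrep par E) (polyX : polyrep E) (herm : herm_form E dot).

Section Monomials.
(* [L j] is the root vector of gl(t u N) that lies outside gl(t), is lowering *)
(* for the order with N in front ([fr]) or at the end, and involves [j].      *)
Variables (fr : bool) (N : I) (t : seq I) (v : X) (w : I -> F).
Hypothesis Nt : N \notin t.
Let s := if fr then N :: t else rcons t N.
Let L j x := if fr then E j N x else E N j x.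
Hypothesis hv : hwv E s w v.

Let ts i : i \in t -> i \in s.
Proof. by rewrite /s; case: fr; rewrite ?mem_rcons inE => ->; rewrite orbT. Qed.
Let Ns : N \in s.
Proof. by rewrite /s; case: fr; rewrite ?mem_rcons inE eqxx. Qed.
Let neN i : i \in t -> (i == N) = false.
Proof. by move=> hi; apply/negbTE; apply: contraNneq Nt => <-. Qed.
Let neN' i : i \in t -> (N == i) = false.
Proof. by rewrite eq_sym; apply: neN. Qed.

Let before_ts i j : before t i j -> before s i j.
Proof.
by rewrite /s; case: fr => h; rewrite ?before_cons ?before_rcons // h orbT.
Qed.

Let L1 i j : before s i j -> before t i j \/ exists2 a, a \in t & forall x, E j i x = L a x.
Proof.
rewrite /s /L; case: fr; rewrite ?before_cons ?before_rcons // => /orP[/andP[]|]; try by left.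
  by move=> /eqP -> hj; right; exists j.
by move=> hi /eqP ->; right; exists i.
Qed.

Let L2 a b j y : before t a b -> j \in t -> exists c1 c2 j', j' \in t /\
  L j (E b a y) = c1 *: E b a (L j y) + c2 *: L j' y.
Proof.
move=> /and3P[ha hb _] hj; rewrite /L; case: fr.
  exists (sgn F par j N b a), (- (sgn F par j N b a * (j == a)%:R)), b; split=> //.
  by rewrite (gl_rel rep) neN' // scale0r sub0r scaleNr.
exists (sgn F par N j b a), (j == b)%:R, a; split=> //.
by rewrite (gl_rel rep) neN' // mulr0 scale0r subr0.
Qed.

Let L3 j k y : j \in t -> k \in t -> exists c, L j (L k y) = c *: L k (L j y).
Proof.
move=> hj hk; rewrite /L; case: fr.
  by exists (sgn F par j N k N); rewrite (gl_rel rep) neN' // neN // mulr0 !scale0r subrr addr0.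
by exists (sgn F par N j N k); rewrite (gl_rel rep) neN' // neN // mulr0 !scale0r subrr addr0.
Qed.

Let sg : F := if fr then 1 else -1.

Let L4 i k y : i \in t -> k \in t -> E i i (L k y) = L k (E i i y) + (sg * (i == k)%:R) *: L k y.
Proof.
move=> hi hk; rewrite /L /sg; case: fr; rewrite (Ehh rep) neN //; congr (_ + _ *: _).
  by rewrite subr0 mul1r.
by rewrite sub0r mulN1r.
Qed.

Let Llin j a x y : L j (a *: x + y) = a *: L j x + L j y.
Proof. by rewrite /L; case: fr; rewrite (EL rep). Qed.
Let LZ j a x : L j (a *: x) = a *: L j x.
Proof. by rewrite /L; case: fr; rewrite (EZ rep). Qed.
Let L0 j : L j 0 = 0.
Proof. by rewrite /L; case: fr; rewrite (E0 rep). Qed.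

Let gen_L j x : j \in t -> gen E s v x -> gen E s v (L j x).
Proof. by move=> hj hx; rewrite /L; case: fr; apply: gen_act => //; apply: ts. Qed.

Let mon l := foldr L v l.

Let gen_mon l : all (mem t) l -> gen E s v (mon l).
Proof. by elim: l => [_|j l IH /= /andP[hj hl]]; [apply: gen_base | apply: gen_L => //; apply: IH]. Qed.

Let mon_wv l : all (mem t) l -> wv E t (fun i => w i + sg * (count_mem i l)%:R) (mon l).
Proof.
elim: l => [_ i hi|k l IH /= /andP[hk hl] i hi]; first by have [_ h _] := hv; rewrite mulr0 addr0 h // ts.
rewrite L4 // IH // LZ -scalerDl; congr (_ *: _).
by rewrite natrD (eq_sym k) mulrDr [_ * (i == k)%:R + _]addrC addrA.
Qed.

Let mon_pull x l : x \in l -> all (mem t) l -> exists c, mon l = c *: L x (mon (rem x l)).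
Proof.
elim: l => // y l IH; rewrite inE /= => hx /andP[hy hl].
case: (y =P x) => [->|nyx]; first by exists 1; rewrite scale1r.
have {}hx : x \in l by case/orP: hx => // /eqP e; case: nyx.
have [c ->] := IH hx hl; have xt : x \in t by apply: (allP hl).
have [c' e] := L3 (mon (rem x l)) hy xt.
by exists (c * c'); rewrite LZ e /= scalerA.
Qed.

Let mon_perm l l' : perm_eq l l' -> all (mem t) l -> exists c, mon l' = c *: mon l.
Proof.
elim: l l' => [|x l IH] l' h /= hl.
  by exists 1; rewrite (perm_nilP (etrans (perm_sym _ _) h : perm_eq l' [::])) scale1r.
have [hx hl'] := andP hl.
have hall : all (mem t) l' by rewrite -(perm_all _ h).
have xl' : x \in l' by rewrite -(perm_mem h) inE eqxx.
have hr : perm_eq l (rem x l').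
  by rewrite -(perm_cons x); apply: perm_trans h _; apply: perm_to_rem.
have [c ->] := mon_pull xl' hall; have [c' ->] := IH _ hr hl'.
by exists (c * c'); rewrite LZ scalerA.
Qed.

(** Products with the lowering operators of gl([t]) on the left and the operators [L j] on the
    right. Every vector of [low] can be brought to this form because the commutator of an [L j] with
    a lowering operator of gl([t]) is a multiple of some [L j']. *)
Inductive mm : X -> Prop :=
| mm_mon l : all (mem t) l -> mm (mon l)
| mm_zero : mm 0
| mm_lin a x y : mm x -> mm y -> mm (a *: x + y)
| mm_act a b x : before t a b -> mm x -> mm (E b a x).

Let mm_sub : subsp mm. Proof. by split; [apply: mm_zero | apply: mm_lin]. Qed.

Let mm_L j x : j \in t -> mm x -> mm (L j x).
Proof.
move=> hj hx; elim: hx j hj => {x} [l hl|| a x y _ h1 _ h2 | a b x hab hx IH] j hj.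
- by apply: (mm_mon (l := j :: l)); rewrite /= hj.
- by rewrite L0; apply: mm_zero.
- by rewrite Llin; apply: mm_lin; [apply: h1 | apply: h2].
have [c1 [c2 [j' [hj' ->]]]] := L2 x hab hj.
apply: mm_lin; first by apply: mm_act => //; apply: IH.
by apply: (subspZ mm_sub); apply: IH.
Qed.

Let low_mm x : low E s v x -> mm x.
Proof.
elim=> {x} [|| a x y _ h1 _ h2 | i j x hij _ hx].
- by apply: (mm_mon (l := [::])).
- exact: mm_zero.
- exact: mm_lin.
by have [h|[a ha ->]] := L1 hij; [apply: mm_act | apply: mm_L].
Qed.

Let mm_gen x : mm x -> gen E s v x.
Proof.
elim=> {x} [l|| a x y _ h1 _ h2 | i j x /before_ts/and3P[hi hj _] _ hx].
- exact: gen_mon.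
- exact: gen_zero.
- exact: gen_lin.
exact: gen_act.
Qed.

Let T := {l : seq I | all (mem t) l}.
Let m (l : T) := mon (sval l).
Let wm (l : T) i : F := w i + sg * (count_mem i (sval l))%:R.

Let cov x : gen E s v x -> exists r : seq (F * T),
  nminus E t (gen E s v) (x - \sum_(p <- r) p.1 *: m p.2).
Proof.
move=> /(gen_low rep hv) /low_mm; elim=> {x} [l hl|| a x y _ [r1 h1] _ [r2 h2] | i j x hij hx _].
- by exists [:: (1, exist _ l hl : T)]; rewrite big_seq1 scale1r /m /= subrr; apply: nminus_zero.
- by exists [::]; rewrite big_nil subrr; apply: nminus_zero.
- exists ([seq (a * p.1, p.2) | p <- r1] ++ r2).
  rewrite big_cat big_map /= (eq_bigr (fun p => a *: (p.1 *: m p.2))); last by move=> p _; rewrite scalerA.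
  by rewrite -scaler_sumr opprD addrACA -scalerBr; apply: nminus_lin.
by exists [::]; rewrite big_nil subr0; apply: nminus_act => //; apply: mm_gen.
Qed.

Let jt : jsub E t (gen E s v).
Proof. by split; [apply: subsp_gen | move=> i j x hi hj; apply: gen_act; apply: ts]. Qed.

(** Modulo the image of the lowering operators of gl([t]), the module is spanned by monomials in the
    [L j]; each factor raises the coordinate at [j] by one if [N] is first and lowers it by one if
    [N] is last. *)
Lemma branch_weight z eta : gen E s v z -> hwv E t eta z ->
  exists l : seq I, forall i, i \in t -> eta i = w i + (if fr then 1 else -1) * (count_mem i l)%:R.
Proof.
move=> hz [z0 wz sz].
have [l /allP hl] := cover_exists (m := m) (w := wm) rep herm jt (fun l => mon_wv (proj2_sig l)) cov hz z0 wz sz.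
by exists (sval l) => i hi; have /eqP <- := hl i hi.
Qed.

(** Two monomials of equal weight contain each [L j] equally often, and the [L j] commute up to
    scalars, so the monomials are proportional. *)
Lemma branch_unique z z' eta : gen E s v z -> gen E s v z' -> hwv E t eta z -> hwv E t eta z' ->
  exists c, z' = c *: z.
Proof.
move=> hz hz' [z0 wz sz] [_ wz' sz'].
apply: (cover_unique (m := m) (w := wm) rep herm jt (fun l => mon_wv (proj2_sig l)) cov hz hz' z0 wz wz' sz sz').
move=> l l' /allP h /allP h'; apply: mon_perm; last exact: (proj2_sig l).
rewrite /perm_eq; apply/allP => i; rewrite mem_cat => hi.
have it : i \in t by case/orP: hi => hi; [apply: (allP (proj2_sig l)) | apply: (allP (proj2_sig l'))].
have := h i it; rewrite -(eqP (h' i it)) /wm (inj_eq (addrI _)).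
have sg0 : sg != 0 by rewrite /sg; case: fr; rewrite ?oppr_eq0 oner_eq0.
by rewrite (inj_eq (mulfI sg0)) eqr_nat.
Qed.
End Monomials.

(** With [N] last the weight of [z] can only be below that of [lam] on [t]. With [N] first it can
    only be above the weight of [lam] with the row or column of [N] removed. These are the two
    halves of interlacing. *)
Lemma branch_strip t N lam v z eta : uniq (rcons t N) -> hk (map par (rcons t N)) lam ->
  hwv E (rcons t N) (natw F (wt par (rcons t N) lam)) v ->
  gen E (rcons t N) v z -> hwv E t (natw F eta) z ->
  exists sig, [/\ hk (map par t) sig, strip (par N) lam sig & forall i, i \in t -> eta i = wt par t sig i].
Proof.
move=> us hl hv hz hzt; have := us; rewrite rcons_uniq => /andP[Nt ut].
have [sig [hs he]] := hw_partition rep polyX ut hzt.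
exists sig; split=> //; apply/andP; split; last first.
  have [l hw] := branch_weight (fr := false) Nt hv hz hzt.
  apply: (wt_sub ut hs) => i hi; rewrite -he //.
  move: (hw i hi); rewrite /natw mulN1r => /eqP; rewrite eq_sym subr_eq -natrD eqr_nat => /eqP.
  by rewrite -cats1 wt_cat hi => ->; rewrite leq_addr.
have pe : perm_eq (rcons t N) (N :: t) by rewrite perm_rcons.
have us' : uniq (N :: t) by rewrite -(perm_uniq pe).
have hl' : hk (map par t) (rest (par N) lam).
  by have := hl; rewrite (hk_perm _ (perm_map par pe)).
have [v' g' hv'] : exists2 v', gen E (rcons t N) v v' & hwv E (N :: t) (natw F (wt par (N :: t) lam)) v'.
  have := @hwv_to_front _ _ par _ _ rep polyX t N [::] lam v; rewrite cats0 cats1.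
  by apply.
(* By irreducibility the highest weight vector [v'] for the other order generates [v] back, so [z]
   lies in the module it generates. *)
have irr := hwv_irred rep polyX herm us hv.
have gv : gen E (rcons t N) v' v.
  apply: (irr (gen E (rcons t N) v')).
  - exact: jsub_gen.
  - by move=> x; apply: gen_trans.
  - exact: gen_base.
  by case: hv'.
have hz' : gen E (N :: t) v' z.
  by apply: (@gen_sub _ _ _ _ (rcons t N)); [move=> i; rewrite (perm_mem pe) | apply: gen_trans gv hz].
have [l hw] := branch_weight (fr := true) Nt hv' hz' hzt.
apply: (wt_sub ut hl') => i hi; rewrite -he //.
move: (hw i hi); rewrite /natw mul1r -natrD => /eqP; rewrite eqr_nat => /eqP -> /=.
by rewrite (_ : i == N = false) ?leq_addr //; apply/negbTE; apply: contraNneq Nt => <-.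
Qed.

Lemma branch_decomp D t N lam v : uniq (rcons t N) -> hk (map par (rcons t N)) lam ->
  (sumn lam <= D)%N ->
  hwv E (rcons t N) (natw F (wt par (rcons t N) lam)) v ->
  (vspan (gen E (rcons t N) v) <=
   \sum_(sig <- boxed D | strip (par N) lam sig && hk (map par t) sig)
      vspan (gen E t (pick_hwv E t (vspan (gen E (rcons t N) v)) (wt par t sig))))%VS.
Proof.
move=> us hl hD hv; have := us; rewrite rcons_uniq => /andP[Nt ut].
rewrite -big_filter.
apply: (sing_decomp rep polyX herm) => //.
- split; first by split; [apply: mem0v | move=> a x y hx hy; apply: memvD => //; apply: memvZ].
  move=> i j x hi hj /vspan_gen hx; apply/vspan_gen.
  by apply: gen_act => //; rewrite mem_rcons inE ?hi ?hj orbT.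
- move=> z eta /vspan_gen hz hzt.
  have [sig [h1 h2 h3]] := branch_strip us hl hv hz hzt.
  exists sig => //; rewrite mem_filter h1 h2 mem_boxed.
  by apply: leq_trans hD; apply: subpart_sumn; case/andP: h2.
move=> z z' eta /vspan_gen hz /vspan_gen hz' h h'.
exact: (branch_unique (fr := false) Nt hv hz hz' h h').
Qed.

Lemma pick_hwvP s (U : {vspace X}) w :
  (pick_hwv E s U w \in U /\ hwv E s (natw F w) (pick_hwv E s U w)) \/ pick_hwv E s U w = 0.
Proof.
rewrite /pick_hwv; case: (pselect (exists z, z \in U /\ hwv E s (natw F w) z)) => h.
  by left; apply: (@xgetPex _ 0 [set z | z \in U /\ hwv E s (natw F w) z]).
by right; apply: xgetPN => z hz; apply: h; exists z.
Qed.

Lemma vspan_gen0 s : vspan (gen E s 0) = 0%VS.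
Proof.
apply/eqP; rewrite -subv0; apply/subvP => x /vspan_gen.
have h : jsub E s (fun x => x \in 0%VS).
  split; first by split; [apply: mem0v | move=> a y z hy hz; apply: memvD => //; apply: memvZ].
  by move=> i j y _ _; rewrite memv0 => /eqP ->; rewrite (E0 rep) mem0v.
by move/(gen_min h); apply; apply: mem0v.
Qed.

(** Removing the last letter splits the module into at most one constituent for each strip, which is
    the recursion defining [sst]; hence the reversal of the list. *)
Lemma dim_gen_le D s lam v : uniq s -> hk (map par s) lam -> (sumn lam <= D)%N ->
  hwv E s (natw F (wt par s lam)) v ->
  (\dim (vspan (gen E s v)) <= sst D (rev (map par s)) lam)%N.
Proof.
elim/last_ind: s lam v => [|t N IH] lam v us hl hD hv.
  move: hl => /= ->; apply: (@leq_trans (\dim <[v]>%VS)); last by rewrite dim_vline; case: (v != 0).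
  apply: dimvS; apply/subvP => x /vspan_gen.
  apply: (gen_min (S := fun x => x \in <[v]>%VS)); last exact: memv_line.
  by split=> //; split; [apply: mem0v | move=> a y z hy hz; apply: memvD => //; apply: memvZ].
apply: leq_trans (dimvS (branch_decomp us hl hD hv)) _.
apply: leq_trans (dimv_leq_sum _ _ _) _.
rewrite map_rcons rev_rcons /= big_mkcondr /=.
rewrite big_seq_cond [leqRHS]big_seq_cond; apply: leq_sum => sig; rewrite mem_boxed => /andP[hD' _].
case: ifP => // hs; have := us; rewrite rcons_uniq => /andP[Nt ut].
have [[_ h]|->] := pick_hwvP t (vspan (gen E (rcons t N) v)) (wt par t sig); first exact: IH.
by rewrite vspan_gen0 dimv0.
Qed.
End Branching.

(** * Tensoring with the natural module *)

Section Tensor.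
Variables (F : numClosedFieldType) (I : finType) (par : I -> bool).
Variables (X : vectType F) (E : I -> I -> X -> X) (dot : X -> X -> F).
Hypotheses (rep : glrep par E) (polyX : polyrep E) (herm : herm_form E dot).

Local Notation TX := {ffun I -> X}.

Definition tsgn i j k : F := (-1) ^+ ((par i (+) par j) && par k).

(* C^I (x) X, the function f standing for the sum of the e_k (x) f k. *)
Definition tens_act i j (f : TX) : TX :=
  [ffun k => tsgn i j k *: E i j (f k) + (k == i)%:R *: f j].

Definition tens_dot (f g : TX) : F := \sum_k dot (f k) (g k).

Definition tens_elt k (x : X) : TX := [ffun m => (m == k)%:R *: x].

(** The term [u7] appears on the right with both signs: in [glrep_tens] it comes once from the
    product in the opposite order and once from the commutator. *)
Lemma addr_shuffle (V : zmodType) (u1 u2 u3 u4 u5 u6 u7 : V) :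
  u1 + (u2 - u3) + u4 + (u5 + u6) = u1 + u5 + (u4 + u7) + (u2 + u6 - (u3 + u7)).
Proof.
rewrite opprD [u2 + u6 + _]addrACA -[RHS]addrA [u4 + u7 + _]addrACA.
rewrite [u7 + _]addrC subrK [RHS]addrACA; congr (_ + _).
by rewrite -addrA [u2 - u3 + u4]addrC.
Qed.

Lemma glrep_tens : glrep par tens_act.
Proof.
split=> [i j a f g|i j k l f]; apply/ffunP => m; rewrite !ffunE.
  rewrite (EL rep) !scalerDr !scalerA addrACA; by congr (_ *: _ + _ *: _ + _); apply: mulrC.
rewrite !(ED rep) !(EZ rep) (gl_rel rep i j k l) !scalerDr !scalerN !scalerA.
(* The identities [c2] to [c5] and [c7] are the compatibilities of Koszul signs, one for each kind
   of term in the expansion; the Kronecker deltas first identify two indices, and the signs are then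
   compared for all parities. *)
have c2 : tsgn i j m * (tsgn k l m * (j == k)%:R) = (j == k)%:R * tsgn i l m.
  case: eqP => [->|_]; rewrite ?mulr0 ?mul0r // /tsgn.
  by case: (par i); case: (par k); case: (par l); case: (par m); rewrite /= ?expr0 ?expr1; ring.
have c3 : tsgn i j m * tsgn k l m * (sgn F par i j k l * (i == l)%:R)
    = sgn F par i j k l * (i == l)%:R * tsgn k j m.
  case: eqP => [->|_]; rewrite ?mulr0 ?mul0r // /tsgn /sgn.
  by case: (par j); case: (par k); case: (par l); case: (par m); rewrite /= ?expr0 ?expr1; ring.
have c4 : tsgn i j m * (m == k)%:R = sgn F par i j k l * (m == k)%:R * tsgn i j l.
  case: eqP => [->|_]; rewrite ?mulr0 ?mul0r ?mulr0 // /tsgn /sgn.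
  by case: (par i); case: (par j); case: (par k); case: (par l); rewrite /= ?expr0 ?expr1; ring.
have c5 : (m == i)%:R * tsgn k l j = sgn F par i j k l * tsgn k l m * (m == i)%:R.
  case: eqP => [->|_]; rewrite ?mulr0 ?mul0r ?mulr0 // /tsgn /sgn.
  by case: (par i); case: (par j); case: (par k); case: (par l); rewrite /= ?expr0 ?expr1; ring.
have c7 : sgn F par i j k l * ((m == k)%:R * (l == i)%:R) = sgn F par i j k l * (i == l)%:R * (m == k)%:R.
  by rewrite (eq_sym i l); ring.
rewrite c2 c3 c4 c5 c7 [(m == i)%:R * _]mulrC [_ * sgn F par i j k l]mulrC.
rewrite [tsgn i j m * tsgn k l m]mulrC mulrA.
exact: addr_shuffle.
Qed.

Lemma tens_eltE k x m : tens_elt k x m = (m == k)%:R *: x.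
Proof. by rewrite ffunE. Qed.

Lemma tens_elt_lin k a x y : tens_elt k (a *: x + y) = a *: tens_elt k x + tens_elt k y.
Proof. by apply/ffunP => m; rewrite !ffunE scalerDr !scalerA mulrC. Qed.

Lemma tens_eltZ k a x : tens_elt k (a *: x) = a *: tens_elt k x.
Proof. by apply/ffunP => m; rewrite !ffunE !scalerA mulrC. Qed.

Lemma tens_sum (f : TX) : f = \sum_k tens_elt k (f k).
Proof.
apply/ffunP => m; rewrite sum_ffunE (bigD1 m) //= tens_eltE eqxx scale1r big1 ?addr0 // => k ne.
by rewrite tens_eltE eq_sym (negPf ne) scale0r.
Qed.

Lemma tens_actE i j k x :
  tens_act i j (tens_elt k x) = tsgn i j k *: tens_elt k (E i j x) + (j == k)%:R *: tens_elt i x.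
Proof.
apply/ffunP => m; rewrite !ffunE (EZ rep) !scalerA; congr (_ + _); last by rewrite mulrC.
by case: (m =P k) => [->|_]; rewrite ?mulr0 ?scale0r.
Qed.

Lemma tens_actii i k x :
  tens_act i i (tens_elt k x) = tens_elt k (E i i x) + (i == k)%:R *: tens_elt k x.
Proof.
rewrite tens_actE /tsgn addbb /= expr0 scale1r; congr (_ + _).
by case: eqP => [->|]; rewrite ?scale0r.
Qed.

Lemma polyrep_tens : polyrep tens_act.
Proof.
move=> f; rewrite (tens_sum f).
apply: (big_ind (fun f => exists r : seq (wvec tens_act), f = \sum_(t <- r) wval t)).
- by exists [::]; rewrite big_nil.
- by move=> _ _ [r1 ->] [r2 ->]; exists (r1 ++ r2); rewrite big_cat.
move=> k _; have [r ->] := polyX (f k).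
have hw (t : wvec E) i : tens_act i i (tens_elt k (wval t)) = (wwt t i + (i == k))%:R *: tens_elt k (wval t).
  by rewrite tens_actii wvecP tens_eltZ natrD scalerDl.
exists [seq WVec (hw t) | t <- r]; rewrite big_map /=.
apply/ffunP => m; rewrite ffunE sum_ffunE scaler_sumr.
by apply: eq_bigr => t _; rewrite ffunE.
Qed.

Lemma herm_tens : herm_form tens_act tens_dot.
Proof.
have tsgn_conj i j k : (tsgn i j k)^* = tsgn i j k.
  by rewrite /tsgn; case: (_ && _); rewrite /= ?expr0 ?expr1 ?rmorphN rmorph1.
split=> [a f g h|f g|f|f|i j f g]; rewrite /tens_dot.
- rewrite mulr_sumr -big_split /=; apply: eq_bigr => k _.
  by rewrite !ffunE (dot_lin herm).
- by rewrite rmorph_sum; apply: eq_bigr => k _; apply: (dot_conj herm).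
- by apply: sumr_ge0 => k _; apply: (dot_ge0 herm).
- move=> /eqP; rewrite psumr_eq0; last by move=> k _; apply: (dot_ge0 herm).
  move=> /allP h; apply/ffunP => k; rewrite ffunE; apply: (dot_eq0 herm).
  by have /(_ (mem_index_enum k)) /eqP := h k.
have e (h : I -> F) l : \sum_k h k * (k == l)%:R = h l.
  rewrite (bigD1 l) //= eqxx mulr1 big1 ?addr0 // => k /negPf ->; exact: mulr0.
transitivity (\sum_k (tsgn i j k * dot (E i j (f k)) (g k)) + dot (f j) (g i)).
  rewrite -(e (fun k => dot (f j) (g k)) i) -big_split; apply: eq_bigr => k _ /=.
  by rewrite ffunE (dotDl herm) !(dotZl herm); congr (_ + _); apply: mulrC.
rewrite -(e (fun k => dot (f k) (g i)) j) -big_split; apply: eq_bigr => k _ /=.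
rewrite ffunE (dotDr herm) !(dotZr herm) tsgn_conj rmorph_nat (dot_adj herm).
by congr (_ + _); [rewrite /tsgn addbC | apply: mulrC].
Qed.
End Tensor.

Section TensorStep.
Variables (F : numClosedFieldType) (I : finType) (par : I -> bool).
Variables (X : vectType F) (E : I -> I -> X -> X) (dot : X -> X -> F).
Hypotheses (rep : glrep par E) (polyX : polyrep E) (herm : herm_form E dot).
Variables (s : seq I) (lam : int_partition) (v : X) (D : nat).
Hypotheses (us : uniq s) (hs : forall i, i \in s).
Hypotheses (hl : hk (map par s) lam) (hD : (sumn lam < D)%N).
Hypothesis hv : hwv E s (natw F (wt par s lam)) v.

Local Notation TX := {ffun I -> X}.
Local Notation TE := (tens_act par E).
Let rT := glrep_tens rep.
Let pT := polyrep_tens (par := par) rep polyX.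
Let hT := herm_tens par herm.

Let TM (f : TX) := forall k, gen E s v (f k).

Let jTM : jsub TE s TM.
Proof.
split; first split.
- by move=> k; rewrite ffunE; apply: gen_zero.
- by move=> a x y hx hy k; rewrite !ffunE; apply: gen_lin.
move=> i j f hi hj hf k; rewrite ffunE; have sp := subsp_gen E s v.
by apply: (subspD sp); apply: (subspZ sp) => //; apply: gen_act.
Qed.

Let w i k : F := natw F (wt par s lam) k + (k == i)%:R.

Let hm i : wv TE s (w i) (tens_elt i v).
Proof.
move=> k hk'; have [_ h _] := hv.
by rewrite (tens_actii rep) h // tens_eltZ -scalerDl.
Qed.

(** Up to sign, the vector with component [E j i x] at [k] is the image under the lowering operator
    [E j i] of the one with component [x] at [k], plus, when [i = k], a multiple of the one with
    component [x] at [j]. Induction on [x] leaves only components equal to [v]. *)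
Let cov_elt k x : low E s v x -> exists r : seq (F * I),
  nminus TE s TM (tens_elt k x - \sum_(p <- r) p.1 *: tens_elt p.2 v).
Proof.
move=> hx; elim: hx k => {x} [|| a x y _ h1 _ h2 | i j x hij hx IH] k.
- by exists [:: (1, k)]; rewrite big_seq1 scale1r subrr; apply: nminus_zero.
- exists [::]; rewrite big_nil subr0 (_ : tens_elt k 0 = 0); first exact: nminus_zero.
  by apply/ffunP => m; rewrite !ffunE scaler0.
- have [r1 h1'] := h1 k; have [r2 h2'] := h2 k.
  exists ([seq (a * p.1, p.2) | p <- r1] ++ r2).
  rewrite big_cat big_map /= (eq_bigr (fun p => a *: (p.1 *: tens_elt p.2 v))); last by move=> p _; rewrite scalerA.
  by rewrite -scaler_sumr tens_elt_lin opprD addrACA -scalerBr; apply: nminus_lin.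
have sgn2 : tsgn F par j i k * tsgn F par j i k = 1 by rewrite /tsgn -signr_addb addbb.
have e : tens_elt k (E j i x) = tsgn F par j i k *: TE j i (tens_elt k x)
    + (- (tsgn F par j i k * (i == k)%:R)) *: tens_elt j x.
  by rewrite (tens_actE rep) scalerDr !scalerA sgn2 scale1r scaleNr addrK.
have [r hr] := IH j.
exists [seq (- (tsgn F par j i k * (i == k)%:R) * p.1, p.2) | p <- r].
rewrite big_map /= (eq_bigr (fun p => (- (tsgn F par j i k * (i == k)%:R)) *: (p.1 *: tens_elt p.2 v))); last by move=> p _; rewrite scalerA.
rewrite -scaler_sumr e -addrA -scalerBr; apply: nminus_lin; last first.
  by apply: (subspZ (subsp_nminus _ _ _)).
apply: nminus_act => // m; rewrite ffunE; apply: (subspZ (subsp_gen E s v)).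
exact: low_gen.
Qed.

Let cov f : TM f -> exists r : seq (F * I),
  nminus TE s TM (f - \sum_(p <- r) p.1 *: tens_elt p.2 v).
Proof.
move=> hf; rewrite (tens_sum f).
apply: (big_ind (fun g => exists r : seq (F * I), nminus TE s TM (g - \sum_(p <- r) p.1 *: tens_elt p.2 v))).
- by exists [::]; rewrite big_nil subrr; apply: nminus_zero.
- move=> x y [r1 h1] [r2 h2]; exists (r1 ++ r2); rewrite big_cat opprD addrACA.
  exact: (subspD (subsp_nminus _ _ _)).
by move=> k _; apply: cov_elt; apply: (gen_low rep hv).
Qed.

(** The coinvariants are spanned by the vectors with a single component [v], so the weight is that
    of [lam] plus one at a single index. Being also the weight of a hook partition by
    [hw_partition], it adds one box. *)
Let tens_weight z eta : TM z -> hwv TE s (natw F eta) z ->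
  exists mu, [/\ hk (map par s) mu, box_cover lam mu & forall i, i \in s -> eta i = wt par s mu i].
Proof.
move=> hz hzv; have [mu [hmu he]] := hw_partition rT pT us hzv.
have [z0 wz sz] := hzv.
have [i /allP hi] := cover_exists (m := fun i => tens_elt i v) (w := w) rT hT jTM hm cov hz z0 wz sz.
have e k : wt par s mu k = (wt par s lam k + (k == i))%N.
  have /eqP := hi k (hs k); rewrite /w /natw he // -natrD => /eqP.
  by rewrite eqr_nat => /eqP ->.
exists mu; split=> //; apply/andP; split.
  by apply: (wt_sub us hl) => k _; rewrite e leq_addr.
rewrite (sumn_wt us hmu) (sumn_wt us hl) (eq_bigr _ (fun k _ => e k)) big_split /= -addn1.
rewrite eqn_add2l (bigD1_seq i) //= eqxx big1 // => k /negPf ->.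
by [].
Qed.

Let tens_unique z z' eta : TM z -> TM z' -> hwv TE s (natw F eta) z -> hwv TE s (natw F eta) z' ->
  exists c, z' = c *: z.
Proof.
move=> hz hz' [z0 wz sz] [_ wz' sz'].
apply: (cover_unique (m := fun i => tens_elt i v) (w := w) rT hT jTM hm cov hz hz' z0 wz wz' sz sz').
move=> i i' /allP h /allP h'; exists 1; rewrite scale1r.
suff -> : i' = i by [].
have := h i (hs i); rewrite -(eqP (h' i (hs i))) /w eqxx (inj_eq (addrI _)).
by rewrite eqr_nat; case: (i =P i') => [->|].
Qed.

Let vTM : subsp TM. Proof. by case: jTM. Qed.

Let dim_TM : (#|I| * \dim (vspan (gen E s v)) <= \dim (vspan TM))%N.
Proof.
set M := vspan (gen E s v).
pose f (g : {ffun I -> subvs_of M}) : TX := [ffun k => vsval (g k)].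
have lf : linear f by move=> a x y; apply/ffunP => k; rewrite !ffunE; exact: linearP.
pose fL := GRing.isLinear.Build _ _ _ _ f lf.
pose fl : {linear {ffun I -> subvs_of M} -> TX} := HB.pack f fL.
have hker : (fullv :&: lker (linfun fl) = 0)%VS.
  apply/eqP; rewrite -subv0; apply/subvP => g; rewrite memv_cap memv_ker lfunE /= => /andP[_ /eqP h].
  rewrite memv0; apply/eqP/ffunP => k; move/ffunP/(_ k): h; rewrite !ffunE => h.
  exact: val_inj.
have hd := limg_dim_eq hker.
have e : \dim {:{ffun I -> subvs_of M}} = (#|I| * \dim M)%N.
  by rewrite dimvf.
rewrite -e -hd; apply: dimvS; apply/subvP => _ /memv_imgP [g _ ->].
apply/(vspanP vTM) => k; rewrite lfunE /= ffunE; apply/vspan_gen; exact: subvsP.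
Qed.

(** The constituents cover the tensor product, each has dimension at most its [sst], and by [pieri]
    these bounds add up to at most the dimension of the product. All bounds are therefore
    equalities, and since [sst] is positive for [mu], its constituent is nonzero. *)
Lemma tens_step mu : \dim (vspan (gen E s v)) = sst D (rev (map par s)) lam ->
  hk (map par s) mu -> box_cover lam mu ->
  exists z : TX, hwv TE s (natw F (wt par s mu)) z /\
    \dim (vspan (gen TE s z)) = sst D (rev (map par s)) mu.
Proof.
move=> hdim hmu hcov; set t := rev (map par s).
pose L := [seq nu <- boxed D | box_cover lam nu & hk (map par s) nu].
pose pk nu := pick_hwv TE s (vspan TM) (wt par s nu).
have hmuD : (sumn mu <= D)%N by case/andP: hcov => _ /eqP ->.
have hdec : (vspan TM <= \sum_(nu <- L) vspan (gen TE s (pk nu)))%VS.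
  apply: (sing_decomp rT pT hT) => //.
  - split; first by split; [apply: mem0v | move=> a x y hx hy; apply: memvD => //; apply: memvZ].
    by move=> i j x hi hj /(vspanP vTM) hx; apply/(vspanP vTM); apply: (proj2 jTM).
  - move=> z eta /(vspanP vTM) hz hzv.
    have [nu [h1 h2 h3]] := tens_weight hz hzv; exists nu => //.
    rewrite mem_filter h2 h1 mem_boxed /=.
    by case/andP: h2 => _ /eqP ->.
  move=> z z' eta /(vspanP vTM) hz /(vspanP vTM) hz'; exact: tens_unique.
have hle nu : nu \in L -> (\dim (vspan (gen TE s (pk nu))) <= sst D t nu)%N.
  rewrite mem_filter mem_boxed => /andP[/andP[_ hnu] hnuD].
  have [[_ h]|h] := pick_hwvP TE s (vspan TM) (wt par s nu).
    exact: (dim_gen_le rT pT hT).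
  by rewrite /pk h (vspan_gen0 rT) dimv0.
have hsum : (\sum_(nu <- L) sst D t nu <= \sum_(nu <- L) \dim (vspan (gen TE s (pk nu))))%N.
  apply: leq_trans (leq_trans (dimvS hdec) (dimv_leq_sum _ _ _)).
  apply: leq_trans dim_TM; rewrite hdim.
  have -> : #|I| = size t.
    rewrite size_rev size_map cardE; apply/eqP; rewrite eq_sym; apply/eqP/perm_size/uniq_perm => //.
      exact: enum_uniq.
    by move=> i; rewrite hs mem_enum.
  rewrite -(pieri t hD) big_filter big_mkcond [leqRHS]big_mkcond.
  by apply: leq_sum => nu _; case: box_cover => //; case: hk.
have muL : mu \in L by rewrite mem_filter hcov hmu mem_boxed.
have uL : uniq L by rewrite filter_uniq // boxed_uniq.
have dmu : \dim (vspan (gen TE s (pk mu))) = sst D t mu.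
  apply/eqP; rewrite eqn_leq hle //=; move: hsum.
  rewrite (bigD1_seq mu) //= [leqRHS](bigD1_seq mu) //= => hsum.
  have h2 : (\sum_(nu <- L | nu != mu) \dim (vspan (gen TE s (pk nu))) <= \sum_(nu <- L | nu != mu) sst D t nu)%N.
    rewrite big_seq_cond [leqRHS]big_seq_cond; apply: leq_sum => nu /andP[hnu _]; exact: hle.
  by move: (leq_trans hsum (leq_add (leqnn _) h2)); rewrite leq_add2r.
exists (pk mu); split=> //.
have [[_ //]|h] := pick_hwvP TE s (vspan TM) (wt par s mu).
have hmu' : hk t mu by rewrite (hk_perm _ (_ : perm_eq t (map par s))) // perm_rev.
by have := sst_gt0 hmuD hmu'; rewrite -dmu /pk h (vspan_gen0 rT) dimv0.
Qed.
End TensorStep.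

(** * Existence of unitary models of the exact dimension *)

Lemma strip_empty b sig : strip b empty_part sig = (sig == empty_part).
Proof.
apply/idP/eqP => [/andP[_ h]|->]; last by rewrite /strip rest_empty subpart_refl.
by apply: subpart_anti => //; apply/subpartP => i; rewrite /part nth_nil.
Qed.

Lemma sst_empty D t : sst D t empty_part = 1%N.
Proof.
elim: t => //= b t IH; rewrite (eq_bigl _ _ (strip_empty b)) -big_filter.
rewrite (_ : [seq _ <- _ | _] = [:: empty_part]) ?big_seq1 //.
apply: perm_small_eq => //; apply: uniq_perm => // [|sig]; first exact: filter_uniq (boxed_uniq D).
by rewrite mem_filter mem_boxed inE; case: eqP => [->|].
Qed.

Lemma exists_box_cover (mu : int_partition) : (0 < sumn mu)%N -> exists lam, box_cover lam mu.
Proof.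
move=> h; exists (rem_box mu (size mu).-1); apply: box_cover_rem.
have hsz : (0 < size mu)%N by case: (mu) h => -[].
by rewrite /removable (prednK hsz) [leqLHS]/= [X in (X < _)%N]/part nth_default // part_pos prednK.
Qed.

Section Existence.
Variables (F : numClosedFieldType) (I : finType) (par : I -> bool).
Variables (s : seq I) (D : nat).
Hypotheses (us : uniq s) (hs : forall i, i \in s).

(** Induction on the size: the trivial module on the ground field serves the empty partition, and
    [tens_step] supplies the module for a partition with one more box. *)
Lemma exists_model (lam : int_partition) : hk (map par s) lam -> (sumn lam <= D)%N ->
  exists (X : vectType F) (E : I -> I -> X -> X) (dot : X -> X -> F) (v : X),
  [/\ glrep par E, polyrep E, herm_form E dot, hwv E s (natw F (wt par s lam)) v
    & \dim (vspan (gen E s v)) = sst D (rev (map par s)) lam].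
Proof.
move: {2}(sumn lam) (erefl (sumn lam)) => d; elim: d lam => [|d IH] lam hd hl hD.
  have -> : lam = empty_part.
    apply: subpart_eq; last by rewrite hd.
    by apply/subpartP => i; have := leq_part_sumn lam i; rewrite hd leqn0 => /eqP ->.
  exists F^o, (fun _ _ _ => 0), (fun x y => (x : F) * (y : F)^*), 1.
  have rep : glrep (F := F) (A := F^o) par (fun _ _ _ => 0).
    by split=> *; rewrite !scaler0 ?subr0 addr0.
  have pol : polyrep (F := F) (A := F^o) (I := I) (fun _ _ _ => 0).
    move=> x; have h (i : I) : 0 = 0%:R *: x by rewrite scale0r.
    by exists [:: WVec (E := fun _ _ _ => 0) (wwt := fun _ => 0%N) h]; rewrite big_seq1.
  have her : herm_form (F := F) (X := F^o) (I := I) (fun _ _ _ => 0) (fun x y => (x : F) * (y : F)^*).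
    split=> [a x y z|x y|x|x|i j x y].
    - by rewrite mulrDl mulrA.
    - by rewrite rmorphM /= conjCK mulrC.
    - exact: mul_conjC_ge0.
    - by move/eqP; rewrite mul_conjC_eq0 => /eqP.
    - by rewrite mul0r rmorph0 mulr0.
  have hv : hwv (F := F) (A := F^o) (fun _ _ _ => 0) s (natw F (wt par s empty_part)) 1.
    split=> [|i _|//]; first by apply/eqP; rewrite oner_eq0.
    have -> : natw F (wt par s empty_part) i = 0; last by rewrite scale0r.
    rewrite /natw; elim: (s) => //= x s' IHs; rewrite rest_empty first_empty.
    by case: eqP.
  split=> //; rewrite sst_empty; apply/eqP; rewrite eqn_leq; apply/andP; split.
    have := dim_gen_le (D := D) rep pol her us _ _ hv; rewrite sst_empty; apply => //.
    by rewrite hkE /part nth_nil.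
  rewrite lt0n dimv_eq0; apply/eqP => h0.
  have /vspan_gen := gen_base (F := F) (A := F^o) (fun _ _ _ : _ => 0) s 1.
  rewrite h0 memv0 oner_eq0 //.
have [|mu hmu] := @exists_box_cover lam; first by rewrite hd.
have /andP[h1 /eqP h2] := hmu.
have hmuD : (sumn mu < D)%N by rewrite -h2.
have hmud : sumn mu = d by move: h2; rewrite hd => -[].
have [X [E [dot [v [rep pol her hv hdim]]]]] := IH mu hmud (hk_sub h1 hl) (ltnW hmuD).
have [z [h3 h4]] := tens_step rep pol her us hs (hk_sub h1 hl) hmuD hv hdim hl hmu.
exists {ffun I -> X}, (tens_act par E), (tens_dot dot), z; split=> //.
- exact: glrep_tens.
- exact: polyrep_tens.
exact: herm_tens.
Qed.
End Existence.

(** * Every interlacing partition occurs *)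

Section FullBranching.
Variables (F : numClosedFieldType) (I : finType) (par : I -> bool).
Variables (X : vectType F) (E : I -> I -> X -> X) (dot : X -> X -> F).
Hypotheses (rep : glrep par E) (polyX : polyrep E) (herm : herm_form E dot).
Variables (t : seq I) (N : I) (lam : int_partition) (v : X) (D : nat).
Hypotheses (us : uniq (rcons t N)) (hl : hk (map par (rcons t N)) lam) (hD : (sumn lam <= D)%N).
Hypothesis hv : hwv E (rcons t N) (natw F (wt par (rcons t N) lam)) v.
Hypothesis hdim : \dim (vspan (gen E (rcons t N) v)) = sst D (rev (map par (rcons t N))) lam.

Definition branch_list : seq int_partition :=
  [seq sig <- boxed D | strip (par N) lam sig && hk (map par t) sig].

Let U := vspan (gen E (rcons t N) v).
Let z sig := pick_hwv E t U (wt par t sig).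

Let ut : uniq t. Proof. by move: us; rewrite rcons_uniq => /andP[]. Qed.

Let dec : (U <= \sum_(sig <- branch_list) vspan (gen E t (z sig)))%VS.
Proof. by rewrite big_filter; exact: (branch_decomp rep polyX herm us hl hD hv). Qed.

Let zU sig : z sig \in U.
Proof. by case: (pick_hwvP E t U (wt par t sig)) => [[]|h] //; rewrite /z h mem0v. Qed.

Let genU sig x : gen E t (z sig) x -> gen E (rcons t N) v x.
Proof.
move=> h; apply: (@gen_trans _ _ _ _ _ _ (z sig)); first by apply/vspan_gen; apply: zU.
by apply: gen_sub h => i; rewrite mem_rcons inE orbC => ->.
Qed.

Let dim_le sig : sig \in branch_list ->
  (\dim (vspan (gen E t (z sig))) <= sst D (rev (map par t)) sig)%N.
Proof.
rewrite mem_filter mem_boxed => /andP[/andP[_ hs] hsD].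
have [[_ h]|h] := pick_hwvP E t U (wt par t sig); first exact: (dim_gen_le rep polyX herm).
by rewrite /z h (vspan_gen0 rep) dimv0.
Qed.

Let sst_sum : (\sum_(sig <- branch_list) sst D (rev (map par t)) sig <= \dim U)%N.
Proof.
rewrite /U hdim map_rcons rev_rcons /= big_filter big_mkcond [leqRHS]big_mkcond.
by apply: leq_sum => sig _; case: strip => //; case: hk.
Qed.

Let dim_eq sig : sig \in branch_list ->
  \dim (vspan (gen E t (z sig))) = sst D (rev (map par t)) sig.
Proof.
move=> hs; apply/eqP; rewrite eqn_leq dim_le //=.
have uL : uniq branch_list by rewrite filter_uniq // boxed_uniq.
have := leq_trans sst_sum (leq_trans (dimvS dec) (dimv_leq_sum _ _ _)).
rewrite (bigD1_seq sig) //= [leqRHS](bigD1_seq sig) //= => hsum.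
have h2 : (\sum_(nu <- branch_list | nu != sig) \dim (vspan (gen E t (z nu)))
    <= \sum_(nu <- branch_list | nu != sig) sst D (rev (map par t)) nu)%N.
  rewrite big_seq_cond [leqRHS]big_seq_cond; apply: leq_sum => nu /andP[hnu _]; exact: dim_le.
by move: (leq_trans hsum (leq_add (leqnn _) h2)); rewrite leq_add2r.
Qed.

Let z_hwv sig : sig \in branch_list -> hwv E t (natw F (wt par t sig)) (z sig).
Proof.
move=> hs; have [[_ //]|h] := pick_hwvP E t U (wt par t sig).
have := dim_eq hs; rewrite /z h (vspan_gen0 rep) dimv0 => e.
move: hs; rewrite mem_filter mem_boxed => /andP[/andP[_ hk'] hsD].
have hk2 : hk (rev (map par t)) sig.
  by rewrite (hk_perm _ (_ : perm_eq (rev (map par t)) (map par t))) // perm_rev.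
by have := sst_gt0 hsD hk2; rewrite -e.
Qed.

(** The chosen submodules cover [U], while their dimension bounds add up to at most [\dim U] by the
    recursion for [sst]. So every bound is attained, each chosen vector is nonzero, and the sum is
    direct. *)
Lemma full_branching : exists z : int_partition -> X,
  [/\ forall sig, sig \in branch_list -> hwv E t (natw F (wt par t sig)) (z sig),
      forall sig x, gen E t (z sig) x -> gen E (rcons t N) v x,
      forall y, gen E (rcons t N) v y -> exists p : int_partition -> X,
        (forall sig, sig \in branch_list -> gen E t (z sig) (p sig)) /\
        y = \sum_(sig <- branch_list) p sig
    & forall p : int_partition -> X, (forall sig, sig \in branch_list -> gen E t (z sig) (p sig)) ->
        \sum_(sig <- branch_list) p sig = 0 -> forall sig, sig \in branch_list -> p sig = 0].
Proof.
pose L := in_tuple branch_list.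
pose W i := vspan (gen E t (z (tnth L i))).
have sumW : (\sum_(sig <- branch_list) vspan (gen E t (z sig)) = \sum_i W i)%VS.
  exact: big_tnth.
have uL : uniq branch_list by rewrite filter_uniq // boxed_uniq.
have nthL sig : sig \in branch_list -> exists i, tnth L i = sig.
  by move=> /seq_tnthP [i ->]; exists i.
exists z; split=> //.
- move=> y hy; have : y \in (\sum_i W i)%VS.
    by rewrite -sumW; apply: (subvP dec); apply/vspan_gen.
  move=> /memv_sumP [y_ hy_ ->].
  exists (fun sig => \sum_(i | tnth L i == sig) y_ i); split.
    move=> sig hs; apply/(vspan_gen E); apply: memv_suml => i /eqP <-.
    exact: hy_.
  rewrite [RHS]big_tnth; apply: eq_bigr => i _; rewrite (big_pred1 i) // => j.
  rewrite -/L /=; apply/eqP/eqP => [|-> //].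
  rewrite !(tnth_nth empty_part) => /eqP; rewrite nth_uniq // => /eqP; exact: val_inj.
have dir : directv (\sum_i W i).
  apply/directvP => /=; rewrite -sumW; apply/eqP; rewrite eqn_leq; apply/andP; split.
    by rewrite -(big_tnth _ _ _ xpredT (fun sig => \dim (vspan (gen E t (z sig))))); apply: dimv_leq_sum.
  rewrite -(big_tnth _ _ _ xpredT (fun sig => \dim (vspan (gen E t (z sig))))).
  apply: leq_trans (dimvS dec); apply: leq_trans sst_sum.
  rewrite big_seq [leqRHS]big_seq; apply: leq_sum => sig; exact: dim_le.
move=> p hp; rewrite big_tnth => h sig /nthL [i <-].
move/directv_sum_independent: dir => /(_ (fun i => p (tnth L i))); apply => //.
by move=> j _; apply/vspan_gen; apply: hp; apply: mem_tnth.
Qed.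
End FullBranching.

(** * Supermodules *)

Section Bracket.
Variables (F : fieldType) (m n : nat).
Implicit Types (A B : 'M[F]_(m + n)) (i j k l : 'I_(m + n)).

Lemma gl_part_homog p A : gl_homog p A -> gl_part (~~ p) A = 0.
Proof.
move=> /matrixP h; apply/matrixP => i j; have := h i j; rewrite !mxE.
by case: eqP => [->|_ <-]; case: p {h} => //=; rewrite if_same.
Qed.

Lemma sbracket_homog p q A B : gl_homog p A -> gl_homog q B ->
  sbracket A B = A *m B - (-1) ^+ (p && q) *: (B *m A).
Proof.
move=> hA hB; have hA' := gl_part_homog hA; have hB' := gl_part_homog hB.
rewrite /sbracket !big_bool; rewrite /gl_homog in hA hB.
case: p q hA hB hA' hB' => [] [] /= hA hB hA' hB';
  by rewrite hA hB hA' hB' ?(mulmx0, mul0mx, scaler0, oppr0, subr0, addr0, add0r).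
Qed.

Lemma gl_homog_delta i j : gl_homog (parity i (+) parity j) (delta_mx i j : 'M[F]_(m + n)).
Proof.
apply/matrixP => k l; rewrite !mxE; case: eqP => // ne.
by case: (k =P i) => [ek|_] //=; case: (l =P j) => [el|_] //=; rewrite ek el in ne.
Qed.

Lemma gl_homog_diag (h : 'rV[F]_(m + n)) : gl_homog false (diag_mx h).
Proof.
apply/matrixP => k l; rewrite !mxE; case: eqP => // ne.
by case: (k =P l) => [ek|_] //; rewrite ek addbb in ne.
Qed.

Lemma sbracket_delta i j k l :
  sbracket (delta_mx i j) (delta_mx k l : 'M[F]_(m + n))
  = (j == k)%:R *: delta_mx i l
    - ((-1) ^+ ((parity i (+) parity j) && (parity k (+) parity l)) * (i == l)%:R) *: delta_mx k j.
Proof.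
rewrite (sbracket_homog (gl_homog_delta i j) (gl_homog_delta k l)) !mul_delta_mx_cond.
by rewrite -!scaler_nat scalerA (eq_sym l).
Qed.

Lemma root_space_delta i j : root_space (coord_wt F i - coord_wt F j) (delta_mx i j).
Proof.
move=> h; rewrite (sbracket_homog (gl_homog_diag h) (gl_homog_delta i j)) /= expr0 scale1r.
have -> : wt_eval (coord_wt F i - coord_wt F j) h = h 0 i - h 0 j.
  rewrite /wt_eval (eq_bigr (fun k => (k == i)%:R * h 0 k - (k == j)%:R * h 0 k)); last first.
    by move=> k _; rewrite !mxE /= mulrBl.
  rewrite sumrB; congr (_ - _).
    by rewrite (bigD1 i) //= eqxx mul1r big1 ?addr0 // => k /negPf ->; rewrite mul0r.
  by rewrite (bigD1 j) //= eqxx mul1r big1 ?addr0 // => k /negPf ->; rewrite mul0r.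
apply/matrixP => k l; rewrite mul_diag_mx mul_mx_diag !mxE.
case: (k =P i) => [->|_]; last by rewrite !(mulr0, mul0r) subrr.
case: (l =P j) => [->|_]; last by rewrite !(mulr0, mul0r) subrr.
by rewrite !(mulr1, mul1r).
Qed.
End Bracket.

Section SupermoduleOps.
Variables (F : numClosedFieldType) (m n : nat) (V : supermodule F m n).
Notation I := 'I_(m + n).

Definition sm_op (i j : I) (v : V) : V := sm_act (delta_mx i j) v.

Lemma sm_act0l (v : V) : sm_act 0 v = 0.
Proof.
by have := act_linl v (-1) 0 0; rewrite scaler0 addr0 scaleN1r addNr.
Qed.
Lemma sm_actDl A B (v : V) : sm_act (A + B) v = sm_act A v + sm_act B v.
Proof. by rewrite -[A]scale1r act_linl !scale1r. Qed.
Lemma sm_actZl a A (v : V) : sm_act (a *: A) v = a *: sm_act A v.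
Proof. by rewrite -[a *: A]addr0 act_linl sm_act0l addr0. Qed.
Lemma sm_actBl A B (v : V) : sm_act (A - B) v = sm_act A v - sm_act B v.
Proof. by rewrite -[- B]scaleN1r sm_actDl sm_actZl scaleN1r. Qed.
Lemma sm_act_suml T (r : seq T) (G : T -> 'M[F]_(m + n)) (v : V) :
  sm_act (\sum_(t <- r) G t) v = \sum_(t <- r) sm_act (G t) v.
Proof. by apply: (big_morph (fun A => sm_act A v)); [move=> A B; apply: sm_actDl | apply: sm_act0l]. Qed.

Lemma sm_actE A (v : V) : sm_act A v = \sum_i \sum_j A i j *: sm_op i j v.
Proof.
rewrite {1}[A]matrix_sum_delta sm_act_suml; apply: eq_bigr => i _.
by rewrite sm_act_suml; apply: eq_bigr => j _; rewrite sm_actZl.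
Qed.

Lemma glrep_sm : glrep (@parity m n) sm_op.
Proof.
split=> [i j a x y|i j k l x]; first exact: act_linr.
have := act_bracket x (gl_homog_delta F i j) (gl_homog_delta F k l).
rewrite sbracket_delta sm_actBl !sm_actZl => h.
by apply/eqP; rewrite /sgn addrC -subr_eq -[X in X == _]h.
Qed.

Lemma homogZ p a (x : V) : homog p x -> homog p (a *: x).
Proof. by move=> h; rewrite -[a *: x]addr0; apply: homogD => //; apply: homog0. Qed.
Lemma homogDD p (x y : V) : homog p x -> homog p y -> homog p (x + y).
Proof. by move=> h h'; rewrite -[x]scale1r; apply: homogD. Qed.
Lemma homog_sum p T (r : seq T) (P : pred T) (x : T -> V) :
  (forall t, P t -> homog p (x t)) -> homog p (\sum_(t <- r | P t) x t).
Proof. by move=> h; apply: big_ind => //; [apply: homog0 | move=> a b; apply: homogDD]. Qed.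

Lemma homog_eq p (x y : V) : homog p x -> homog (~~ p) y -> homog p (x + y) -> y = 0.
Proof.
move=> hx hy hxy; have h : homog p y.
  by rewrite -[y](addKr x) -scaleN1r; apply: homogD.
by case: p h hy {hx hxy} => /= h h'; apply: homog_disj.
Qed.

Lemma homog_op p i j (x : V) : homog p x -> homog ((parity i (+) parity j) (+) p) (sm_op i j x).
Proof. by move=> h; apply: act_homog => //; apply: gl_homog_delta. Qed.

Section HighestWeight.
Variables (s : seq I) (w : I -> F) (v : V) (p0 : bool).
Hypotheses (us : uniq s) (hs : forall i, i \in s) (hv : hwv sm_op s w v) (v0 : homog p0 v).

Definition odd_weight (w' : I -> F) : F := \sum_(i <- s | parity i) w' i.

(* Homogeneous weight vectors whose parity differs from [p0] by the parity of *)
(* the change of the odd part of the weight.                                  *)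
Record hwvec := HWVec {
  hval : V; hwt : I -> F; hpar : bool; hval_wv : wv sm_op s hwt hval; hval_homog : homog hpar hval;
  hwt_par : exists a b : nat, odd_weight hwt + a%:R = odd_weight w + b%:R /\ hpar = p0 (+) odd (a + b) }.

Lemma odd_weight_act (w' : I -> F) k l :
  odd_weight (fun i => w' i + ((i == k)%:R - (i == l)%:R)) = odd_weight w' + ((parity k)%:R - (parity l)%:R).
Proof.
rewrite /odd_weight big_split /= sumrB.
have e j : \sum_(i <- s | parity i) (i == j)%:R = (parity j)%:R :> F.
  rewrite big_mkcond (bigD1_seq j) //= eqxx big1 ?addr0 => [|i /negPf ->]; last by case: ifP.
  by case: (parity j).
by rewrite !e.
Qed.

Lemma gen_homog_weight x : gen sm_op s v x -> exists r : seq hwvec, x = \sum_(t <- r) hval t.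
Proof.
have [_ hw _] := hv.
elim=> {x} [|| c x y _ [r1 ->] _ [r2 ->] | i j x hi hj _ [r ->]].
- have hp : exists a b : nat, odd_weight w + a%:R = odd_weight w + b%:R /\ p0 = p0 (+) odd (a + b).
    by exists 0%N, 0%N; rewrite addbF.
  by exists [:: HWVec hw v0 hp]; rewrite big_seq1.
- by exists [::]; rewrite big_nil.
- have hz (t : hwvec) : wv sm_op s (hwt t) (c *: hval t).
    by move=> i hi; rewrite (EZ glrep_sm) (hval_wv t) // !scalerA mulrC.
  exists ([seq HWVec (hz t) (homogZ c (hval_homog t)) (hwt_par t) | t <- r1] ++ r2).
  by rewrite big_cat big_map /= scaler_sumr.
have hz (t : hwvec) := wv_act glrep_sm i j (hval_wv t).
have hp (t : hwvec) : exists a b : nat,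
    odd_weight (fun k => hwt t k + ((k == i)%:R - (k == j)%:R)) + a%:R = odd_weight w + b%:R
    /\ (parity i (+) parity j) (+) hpar t = p0 (+) odd (a + b).
  have [a [b [h1 h2]]] := hwt_par t.
  exists (a + parity j)%N, (b + parity i)%N; split.
    rewrite odd_weight_act !natrD; move: h1 => /(congr1 (fun x => x + (parity i)%:R)) h1.
    by rewrite [RHS]addrA -h1; ring.
  by rewrite h2 !oddD !oddb; case: p0 (odd a) (odd b) (parity i) (parity j) => [] [] [] [] [].
exists [seq HWVec (hz t) (homog_op i j (hval_homog t)) (hp t) | t <- r].
by rewrite big_map (Esum glrep_sm).
Qed.

(** Weight determines parity: the change of the odd coordinates is an integer read off from the
    weight in characteristic 0, and its parity is the change of parity. *)
Lemma same_hpar (t t' : hwvec) : same s (hwt t) (hwt t') -> hpar t = hpar t'.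
Proof.
move=> /allP h; have [a [b [h1 ->]]] := hwt_par t; have [a' [b' [h1' ->]]] := hwt_par t'.
have e : odd_weight (hwt t) = odd_weight (hwt t').
  by rewrite /odd_weight; apply: eq_bigr => i _; have /eqP := h i (hs i).
have : (b + a')%:R = (b' + a)%:R :> F.
  apply: (addrI (odd_weight w)); rewrite !natrD !addrA -h1 -h1' e; ring.
move/eqP; rewrite eqr_nat => /eqP hh; congr (_ (+) _).
have := congr1 odd hh; rewrite !oddD.
by case: (odd a) (odd b) (odd a') (odd b') => [] [] [] [].
Qed.

(** Submodules are graded automatically. A submodule contains the weight components of its vectors,
    and by [same_hpar] each of these is homogeneous; the sum of the even ones is [x0]. *)
Lemma jsub_graded S : jsub sm_op s S -> (forall x, S x -> gen sm_op s v x) ->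
  forall x0 x1, homog false x0 -> homog true x1 -> S (x0 + x1) -> S x0 /\ S x1.
Proof.
move=> jS hS x0 x1 h0 h1 Sx.
have key (r : seq hwvec) : S (\sum_(t <- r) hval t) -> S (\sum_(t <- r | ~~ hpar t) hval t).
  move: {2}(size r) (leqnn (size r)) => N; elim: N r => [|N IH] [|t r] //=; try by rewrite !big_nil.
  move=> hN hr; pose P t' := same s (hwt t') (hwt t).
  have Sc : S (\sum_(t' <- t :: r | P t') hval t').
    rewrite -[X in S X]add0r.
    apply: (weight_component glrep_sm (jsub_hsub jS)); rewrite ?add0r //.
      by move=> t'; apply: hval_wv.
    by move=> i _; rewrite (E0 glrep_sm) scaler0.
  have Pt : P t by apply/allP => i _ /=.
  have Sr : S (\sum_(t' <- [seq t' <- r | ~~ P t']) hval t').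
    have := subspB (proj1 jS) hr Sc; rewrite [X in S (X - _)](bigID P) /= addrAC subrr add0r.
    by rewrite big_cons Pt /= big_filter.
  have := IH _ _ Sr; rewrite size_filter => /(_ (leq_trans (count_size _ _) hN)).
  rewrite big_filter_cond => Sr'.
  rewrite (bigID P) /=; apply: (subspD (proj1 jS)).
    case: (boolP (hpar t)) => ht.
      rewrite big1; first exact: subsp0 (proj1 jS).
      by move=> t' /andP[h2 h3]; rewrite (same_hpar h3) ht in h2.
    rewrite (eq_bigl P) // => t'; case: (boolP (P t')) => h3; rewrite ?andbF //.
    by rewrite (same_hpar h3) ht.
  rewrite big_cons Pt andbF; move: Sr'; congr (S _); apply: eq_bigl => t' /=.
  by rewrite andbC.
have [r e] := gen_homog_weight (hS _ Sx).
have hx0 : x0 = \sum_(t <- r | ~~ hpar t) hval t.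
  have e1 : x0 - \sum_(t <- r | ~~ hpar t) hval t = \sum_(t <- r | hpar t) hval t - x1.
    apply/eqP; rewrite subr_eq addrAC eq_sym subr_eq; apply/eqP.
    by rewrite e [RHS](bigID hpar).
  apply/eqP; rewrite -subr_eq0; apply/eqP; apply: homog_disj.
    rewrite addrC -scaleN1r; apply: homogD => //; apply: homog_sum => t; have := hval_homog t.
    by case: (hpar t).
  rewrite e1 addrC -scaleN1r; apply: homogD => //; apply: homog_sum => t; have := hval_homog t.
  by case: (hpar t).
have S0 : S x0 by rewrite hx0; apply: key; rewrite -e.
split=> //; rewrite -[x1](addKr x0) addrC.
by apply: (subspB (proj1 jS)).
Qed.

Hypothesis simpleV : simple_sm V.

Lemma simple_gen x : gen sm_op s v x.
Proof.
have [_ simp] := simpleV; have jg := jsub_gen sm_op s v.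
have : sub_supermodule (gen sm_op s v : set V).
  split; first exact: gen_zero; first exact: gen_lin.
    move=> A y hy; rewrite sm_actE; apply: (subsp_sum (proj1 jg)) => i _.
    apply: (subsp_sum (proj1 jg)) => j _; apply: (subspZ (proj1 jg)).
    exact: gen_act.
  exact: jsub_graded.
case/simp => h; last by have : setT x by []; rewrite -h.
have : (gen sm_op s v : set V) v by apply: gen_base.
by rewrite h => e; have [] := hv.
Qed.

(** Simplicity of a supermodule concerns graded submodules only; by [jsub_graded] it applies to all
    submodules, as [hw_iso] requires. *)
Lemma simple_irred : irred sm_op s v.
Proof.
move=> S jS _ x Sx x0; have [_ simp] := simpleV.
have : sub_supermodule (S : set V).
  have sp := proj1 jS; split; first exact: subsp0; first by move=> a y z; apply: (proj2 sp).
    move=> A y hy; rewrite sm_actE; apply: (subsp_sum sp) => i _.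
    apply: (subsp_sum sp) => j _; apply: (subspZ sp).
    exact: (proj2 jS).
  by apply: jsub_graded => // y _; apply: simple_gen.
case/simp => h; last by have : (setT : set V) v by []; rewrite -h.
by have : (S : set V) x by []; rewrite h.
Qed.
End HighestWeight.
End SupermoduleOps.

(** * The order attached to an epsilon-delta sequence *)

Section Labels.
Local Open Scope nat_scope.
Variables (m n : nat) (b : edseq m n).

Lemma size_edseq : size b = m + n.
Proof. by rewrite -(count_predC is_delta) (count_delta b) (count_epsilon b). Qed.

Lemma size_labels : size (labels b) = m + n.
Proof. by rewrite size_map size_iota size_edseq. Qed.

Definition label_at p :=
  if nth Delta b p is Delta then count is_delta (take p b) else m + count is_epsilon (take p b).

Lemma nth_labels p : p < size b -> nth 0 (labels b) p = label_at p.
Proof. by move=> hp; rewrite (nth_map 0) ?size_iota // nth_iota. Qed.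

Lemma count_take_lt (P : pred letter) p q : p < q -> q <= size b -> P (nth Delta b p) ->
  count P (take p b) < count P (take q b).
Proof.
move=> pq qs hP; have -> : take q b = take p b ++ nth Delta b p :: drop p.+1 (take q b).
  have ps : p < size (take q b) by rewrite size_takel.
  have := cat_take_drop p (take q b).
  by rewrite (take_takel _ (ltnW pq)) (drop_nth Delta ps) (nth_take _ pq) => ->.
by rewrite count_cat /= hP -[ltnLHS]addn0 ltn_add2l.
Qed.

Lemma count_take_size (P : pred letter) p : p < size b -> P (nth Delta b p) ->
  count P (take p b) < count P b.
Proof. by move=> hp hP; rewrite -{2}(take_size b); apply: count_take_lt. Qed.

Lemma label_at_lt p : p < size b -> label_at p < m + n.
Proof.
rewrite /label_at => hp; case e : (nth Delta b p).
  have := @count_take_size is_delta p hp; rewrite e count_delta => /(_ isT) h.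
  exact: leq_trans h (leq_addr _ _).
by have := @count_take_size is_epsilon p hp; rewrite e count_epsilon ltn_add2l; apply.
Qed.

Lemma label_at_parity p : p < size b -> (m <= label_at p) = is_epsilon (nth Delta b p).
Proof.
rewrite /label_at => hp; case e : (nth Delta b p); last by rewrite leq_addr.
have := @count_take_size is_delta p hp; rewrite e count_delta => /(_ isT).
by move=> h; apply/negbTE; rewrite -ltnNge.
Qed.

Lemma labels_uniq : uniq (labels b).
Proof.
apply/(uniqP 0) => p q; rewrite !inE size_map size_iota => hp hq.
rewrite !nth_labels //.
have main p' q' : p' < q' -> q' < size b -> label_at p' <> label_at q'.
  move=> hpq hq'; have hp' := ltn_trans hpq hq' => e.
  have := label_at_parity hp'; rewrite e label_at_parity //.
  move: e; rewrite /label_at.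
  have := @count_take_lt is_delta p' q' hpq (ltnW hq').
  have := @count_take_lt is_epsilon p' q' hpq (ltnW hq').
  by case: (nth Delta b p'); case: (nth Delta b q') => //= h1 h2; try (have := h1 isT); try (have := h2 isT); lia.
by case: (ltngtP p q) => // h e; [case: (main p q) | case: (main q p)].
Qed.

Lemma labels_lt i : i \in labels b -> i < m + n.
Proof.
move=> hi; have := nth_index 0 hi; have := hi; rewrite -index_mem size_map size_iota => hlt.
by rewrite nth_labels // => <-; apply: label_at_lt.
Qed.

Definition ord_labels : seq 'I_(m + n) := pmap insub (labels b).

Lemma val_ord_labels : map val ord_labels = labels b.
Proof.
rewrite pmap_filter; last by move=> x; case: insubP.
by apply/all_filterP/allP => i /labels_lt h; rewrite insubT.
Qed.

Lemma ord_labels_uniq : uniq ord_labels.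
Proof. by rewrite pmap_sub_uniq // labels_uniq. Qed.

Lemma size_ord_labels : size ord_labels = m + n.
Proof. by rewrite -(size_map val) val_ord_labels size_labels. Qed.

Lemma mem_ord_labels i : i \in ord_labels.
Proof.
have : ord_labels =i enum 'I_(m + n).
  have h1 : {subset ord_labels <= enum 'I_(m + n)} by move=> x _; rewrite mem_enum.
  have h2 : size (enum 'I_(m + n)) <= size ord_labels by rewrite size_ord_labels size_enum_ord.
  by have [_ h] := uniq_min_size ord_labels_uniq h1 h2.
by move=> ->; rewrite mem_enum.
Qed.

Lemma positionE (i : 'I_(m + n)) : position b i = index i ord_labels.
Proof. by rewrite /position -val_ord_labels index_map //; apply: val_inj. Qed.

Lemma before_position i j : before ord_labels i j = (position b i < position b j).
Proof. by rewrite /before !mem_ord_labels !positionE. Qed.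

Lemma position_lt (i : 'I_(m + n)) : position b i < size b.
Proof. by rewrite positionE size_edseq -[leqRHS]size_ord_labels index_mem mem_ord_labels. Qed.

Lemma label_at_position (i : 'I_(m + n)) : label_at (position b i) = i.
Proof.
rewrite -nth_labels ?position_lt // nth_index // -val_ord_labels.
by apply: map_f; apply: mem_ord_labels.
Qed.

Lemma parity_ord_labels : map (@parity m n) ord_labels = map is_epsilon b.
Proof.
rewrite /parity (map_comp (leq m) val) val_ord_labels.
apply: (@eq_from_nth _ true); first by rewrite !size_map size_iota.
move=> p; rewrite !size_map size_iota => hp.
by rewrite (nth_map 0) ?size_map ?size_iota // nth_labels // label_at_parity // (nth_map Delta).
Qed.

Lemma count_neg_parity p : count negb (map is_epsilon (take p b)) = count is_delta (take p b).
Proof. by rewrite count_map; apply: eq_count => x /=; rewrite negbK. Qed.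

(** When a letter is reached, the earlier deltas have removed rows and the earlier epsilons columns.
    For the delta of index [i], exactly [i] rows are gone, so its row is row [i] of [lam] shortened
    by the number of preceding epsilons; the truncated subtraction is the maximum with 0. Epsilons
    are dual. *)
Lemma wt_ord_labels (F : fieldType) lam i :
  lambda_wt F b lam 0%R i = (wt (@parity m n) ord_labels lam i)%:R%R.
Proof.
set p := position b i.
have hp : p < size ord_labels by rewrite size_ord_labels -[leqRHS]size_edseq; apply: position_lt.
have ei : nth i ord_labels p = i by rewrite /p positionE nth_index // mem_ord_labels.
have -> : wt (@parity m n) ord_labels lam i = first (parity i) (peel (map is_epsilon (take p b)) lam).
  rewrite -{1}(cat_take_drop p ord_labels) wt_cat (drop_nth i hp) ei /= eqxx.
  rewrite map_take parity_ord_labels -map_take.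
  case: ifP => // h; have := ord_labels_uniq.
  by rewrite -(cat_take_drop p ord_labels) cat_uniq (drop_nth i hp) ei /= h => /and3P[].
rewrite mxE; congr (_%:R)%R; have h := label_at_position i; rewrite -/p in h.
have := label_at_parity (position_lt i); rewrite -/p h => hpar.
rewrite /parity hpar; move: h hpar; rewrite /label_at.
case: (splitP i) => j ej.
  case e : (nth Delta b p) => /= h.
    by rewrite part_peel count_neg_parity count_map add0n h ej.
  by have := ltn_ord j; lia.
case e : (nth Delta b p) => /= h; first by rewrite ej leq_addr.
move: h; rewrite ej => /addnI h _.
by rewrite conj_part_peel count_neg_parity count_map add0n h.
Qed.

Lemma hook_hk lam : hook m n lam <-> hk (map (@parity m n) ord_labels) lam.
Proof.
rewrite hkE parity_ord_labels /hook.
have -> : count negb (map is_epsilon b) = m.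
  by have := count_neg_parity (size b); rewrite take_size count_delta.
by have -> : count id (map is_epsilon b) = n by rewrite count_map; exact: count_epsilon.
Qed.
End Labels.

Section HatLabels.
Local Open Scope nat_scope.
Variables (m n : nat) (b : edseq m n).
Hypothesis hmn : 1 <= m + n.

Let k := (size b).-1.
Let sz : size b = k.+1. Proof. by rewrite /k prednK // size_edseq. Qed.

(** The label of a letter depends only on the letters before it, except that epsilon labels start at
    [mhat b] instead of [m]; [hat_idx] corrects exactly this offset. *)
Lemma hat_labels :
  map val (map (@hat_idx m n b) (ord_labels (hat b))) = take k (labels b).
Proof.
have sk : size (hat b) = k by rewrite /= /del_last size_takel // leq_pred.
have sh : size (ord_labels (hat b)) = k by rewrite size_ord_labels -(size_edseq (hat b)) sk.
apply: (@eq_from_nth _ 0).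
  by rewrite !size_map sh size_takel // size_labels -(size_edseq b) leq_pred.
move=> p; rewrite !size_map sh => hp.
have hpb : p < size b by rewrite sz ltnS ltnW.
rewrite nth_take // nth_labels //.
have hp' : p < size (ord_labels (hat b)) by rewrite sh.
have [a0 _] : exists a0 : 'I_(mhat b + nhat b), true.
  by case: (ord_labels (hat b)) hp' => // a *; exists a.
rewrite -map_comp (nth_map a0) //= /hat_idx; set a := nth a0 _ p.
have va : a = label_at (hat b) p :> nat.
  have := nth_labels (b := hat b) (p := p); rewrite sk => /(_ hp) <-.
  by rewrite -val_ord_labels (nth_map a0).
have pe := label_at_parity (b := hat b) (p := p); rewrite sk in pe; move: (pe hp) va => {}pe.
have en : nth Delta (hat b) p = nth Delta b p by rewrite /= nth_take.
have et : take p (hat b) = take p b by rewrite /= take_takel // ltnW.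
move=> va; rewrite /label_at en et in va pe; rewrite /label_at.
case: (splitP a) => j ej /=; move: va pe; rewrite ej; case: (nth Delta b p) => //= va.
- by have := ltn_ord j; rewrite va -ltn_subRL subnn.
- by rewrite -va leq_addr.
by move: va => /addnI ->.
Qed.
End HatLabels.

Section LastLetter.
Local Open Scope nat_scope.
Variables (m n : nat) (b : edseq m n).
Hypothesis hmn : 1 <= m + n.

Let k := (size b).-1.
Let sz : size b = k.+1. Proof. by rewrite /k prednK // size_edseq. Qed.
Let eb : del_last b ++ [:: nth Delta b k] = b.
Proof. by rewrite /del_last -/k cats1 -take_nth ?sz // -sz take_size. Qed.

Lemma ord_labels_rcons : exists2 N, ord_labels b = rcons (map (@hat_idx m n b) (ord_labels (hat b))) N
  & parity N = is_epsilon (nth Delta b k).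
Proof.
have szo : size (ord_labels b) = k.+1 by rewrite size_ord_labels -(size_edseq b) sz.
have [N0 _] : exists N0 : 'I_(m + n), true.
  by case: (ord_labels b) szo => // a *; exists a.
exists (nth N0 (ord_labels b) k).
  have -> : map (@hat_idx m n b) (ord_labels (hat b)) = take k (ord_labels b).
    apply: (inj_map val_inj); rewrite (hat_labels b hmn) -/k.
    by rewrite -val_ord_labels map_take.
  by rewrite -take_nth ?szo // -szo take_size.
have hk' : k < size b by rewrite sz.
rewrite -(nth_map N0 true (@parity m n)) ?szo // parity_ord_labels.
by rewrite (nth_map Delta).
Qed.

Lemma letter_counts : m = mhat b + is_delta (nth Delta b k) /\ n = nhat b + is_epsilon (nth Delta b k).
Proof.
split; [rewrite -[LHS](count_delta b) | rewrite -[LHS](count_epsilon b)];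
  by rewrite -[X in count _ X]eb count_cat /= addn0.
Qed.

(** Deleting the last letter lowers exactly one of the two counts, so one of the two interlacing
    conditions is vacuous and the other is the strip condition for the parity of [N]; for an epsilon
    it is read on conjugates. *)
Lemma branching_setP N lam sig : parity N = is_epsilon (nth Delta b k) :> bool ->
  branching_set b lam sig <->
  strip (@parity m n N) lam sig && hk (map (@parity m n) (map (@hat_idx m n b) (ord_labels (hat b)))) sig.
Proof.
move=> hN; rewrite hN -map_comp (eq_map (@parity_hat_idx m n b)).
have [em en] := letter_counts.
rewrite /branching_set /=; split.
  move=> [/hook_hk hk1 h1 h2]; rewrite hk1 andbT; move: em en h1 h2.
  case: (nth Delta b k) => /=.
    rewrite addn0 => _ en _ /(_ (esym en)) h; apply/strip_rowP => i.
    by have [h1 h2] := h i; rewrite h1 h2.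
  rewrite addn0 => em _ /(_ (esym em)) h _; rewrite -[is_epsilon Epsilon]/(~~ false) -strip_conj.
  by apply/strip_rowP => i; rewrite !part_conj; have [h1 h2] := h i; rewrite h1 h2.
move=> /andP[hs hk1]; split; first exact: (proj2 (hook_hk (hat b) sig) hk1).
  move=> e; move: em hs; rewrite -[X in X = _ -> _]e; case: (nth Delta b k) => /=; first lia.
  move=> _; rewrite -[is_epsilon Epsilon]/(~~ false) -strip_conj => /strip_rowP h i.
  by have := h i; rewrite !part_conj => /andP[].
move=> e; move: en hs; rewrite -[X in X = _ -> _]e; case: (nth Delta b k) => /=; last lia.
by move=> _ /strip_rowP h i; have := h i => /andP[].
Qed.
End LastLetter.

(** * The total weight, and pulling back along an injection of indices *)

Section TotalWeight.
Variables (F : numClosedFieldType) (I : finType) (par : I -> bool).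
Variables (A : lmodType F) (E : I -> I -> A -> A).
Hypothesis rep : glrep par E.

(** The sum of the [E i i] over [s] commutes with all the operators of gl([s]), hence acts on the
    generated module by the scalar it has on [v]. *)
Lemma total_weight s w v x w' : uniq s -> hwv E s w v -> gen E s v x -> wv E s w' x -> x <> 0 ->
  \sum_(i <- s) w' i = \sum_(i <- s) w i.
Proof.
move=> us [_ hw _] hx hw' x0.
have e : \sum_(i <- s) E i i x = (\sum_(i <- s) w i) *: x.
  elim: hx {hw' x0} => {x} [|| a x y _ h1 _ h2 | k l x hk hl _ h].
  - by rewrite scaler_suml big_seq [RHS]big_seq; apply: eq_bigr => i hi; apply: hw.
  - by rewrite scaler0 big1 // => i _; apply: (E0 rep).
  - rewrite (eq_bigr (fun i => a *: E i i x + E i i y)); last by move=> i _; apply: (EL rep).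
    by rewrite big_split /= -scaler_sumr h1 h2 scalerDr !scalerA mulrC.
  rewrite (eq_bigr (fun i => E k l (E i i x) + ((i == k)%:R - (i == l)%:R) *: E k l x)); last first.
    by move=> i _; apply: (Ehh rep).
  have d j : j \in s -> \sum_(i <- s) (i == j)%:R = 1 :> F.
    by move=> hj; rewrite (bigD1_seq j) //= eqxx big1 ?addr0 // => i /negPf ->.
  rewrite big_split /= -(Esum rep) h (EZ rep) -scaler_suml sumrB !d // subrr scale0r addr0.
  by [].
have : (\sum_(i <- s) w' i) *: x = (\sum_(i <- s) w i) *: x.
  by rewrite -e scaler_suml big_seq [RHS]big_seq; apply: eq_bigr => i hi; rewrite hw'.
move/eqP; rewrite -subr_eq0 -scalerBl scaler_eq0 subr_eq0 => /orP[/eqP //|/eqP //].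
Qed.
End TotalWeight.

Section Reindex.
Variables (F : numClosedFieldType) (I J : finType) (h : J -> I) (parI : I -> bool) (parJ : J -> bool).
Hypotheses (hinj : injective h) (hpar : forall a, parI (h a) = parJ a).
Variables (A : lmodType F) (E : I -> I -> A -> A).

Definition pull_op a c := E (h a) (h c).

Lemma glrep_pull : glrep parI E -> glrep parJ pull_op.
Proof.
move=> [hl hr]; split=> [a c|a c d e x]; first exact: hl.
by rewrite /pull_op hr /sgn !hpar !(inj_eq hinj).
Qed.

Lemma before_map s a c : before (map h s) (h a) (h c) = before s a c.
Proof. by rewrite /before !(mem_map hinj) !(index_map hinj). Qed.

Lemma gen_pull s z x : gen pull_op s z x <-> gen E (map h s) z x.
Proof.
split; elim=> {x} [|| a x y _ h1 _ h2 | i j x hi hj _ hx].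
- exact: gen_base.
- exact: gen_zero.
- exact: gen_lin.
- by apply: gen_act => //; apply: map_f.
- exact: gen_base.
- exact: gen_zero.
- exact: gen_lin.
move/mapP: hi => [a ha ->]; move/mapP: hj => [c hc ->].
exact: (gen_act (E := pull_op)).
Qed.

Lemma hwv_pull s w z : hwv E (map h s) w z -> hwv pull_op s (w \o h) z.
Proof.
move=> [z0 hw hs]; split=> // [a ha|a c hac]; first by rewrite /pull_op hw // map_f.
by apply: hs; rewrite before_map.
Qed.

Lemma irred_pull s z : irred E (map h s) z -> irred pull_op s z.
Proof.
move=> hi S [sS hS] hg x Sx x0; apply: (hi S) Sx x0 => [|y Sy]; last by apply/gen_pull/hg.
split=> // _ _ y /mapP[a ha ->] /mapP[c hc ->]; exact: hS.
Qed.

Lemma wt_pull s sig a : wt parI (map h s) sig (h a) = wt parJ s sig a.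
Proof. by elim: s sig => //= c s IH sig; rewrite (inj_eq hinj) hpar IH. Qed.
End Reindex.

Section Frozen.
Variables (F : numClosedFieldType) (m n : nat) (b : edseq m n).

Lemma highest_weight_hwv w (V : supermodule F m n) (v : V) :
  highest_weight_vector b w v -> hwv (@sm_op F m n V) (ord_labels b) (fun i => w 0 i) v.
Proof.
move=> [v0 _ hw hp]; split=> // [i _|i j hij].
  rewrite /sm_op; have := hw (delta_mx 0 i).
  have -> : diag_mx (delta_mx 0 i) = delta_mx i i :> 'M[F]_(m + n).
    apply/matrixP => k l; rewrite !mxE /=; case: (k =P l) => [->|ne].
      by rewrite andbb mulr1n; case: eqP.
    by rewrite mulr0n; case: (k =P i) => //= ek; case: eqP => // el; case: ne; rewrite ek el.
  move=> ->; congr (_ *: _).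
  rewrite /wt_eval (bigD1 i) //= mxE !eqxx mulr1 big1 ?addr0 // => k ne.
  by rewrite mxE (negPf ne) andbF mulr0.
apply: (hp (coord_wt F i - coord_wt F j)); last exact: root_space_delta.
by exists i, j; split=> //; rewrite -before_position.
Qed.

Lemma lambda_hwv lam (V : supermodule F m n) (v : V) :
  highest_weight_vector b (lambda_wt F b lam) v ->
  hwv (@sm_op F m n V) (ord_labels b) (natw F (wt (@parity m n) (ord_labels b) lam)) v.
Proof. by move/highest_weight_hwv; apply: hwv_ext => i _; apply: wt_ord_labels. Qed.
End Frozen.

(** * The branching rule *)

Section Components.
Variables (F : numClosedFieldType) (m n : nat) (V : supermodule F m n).
Variables (s : seq 'I_(m + n)) (w : 'I_(m + n) -> F) (v : V) (p0 : bool).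
Hypotheses (us : uniq s) (hs : forall i, i \in s) (hv : hwv (@sm_op F m n V) s w v) (v0 : homog p0 v).

(** Only homogeneous summands of weight [eta] contribute to [x], and by [same_hpar] they share one
    parity. The naturals [a] and [c] record the integral change of odd weight without subtraction in
    the field. *)
Lemma wv_homog x eta : gen (@sm_op F m n V) s v x -> wv (@sm_op F m n V) s eta x -> x <> 0 ->
  exists (q : bool) (a c : nat), [/\ homog q x, odd_weight s eta + a%:R = odd_weight s w + c%:R
    & q = p0 (+) odd (a + c)].
Proof.
move=> hx hw x0; have [r e] := gen_homog_weight us hs hv v0 hx.
have hr := glrep_sm V.
have ex : x = \sum_(t <- r | same s (hwt t) eta) hval t.
  apply/esym/eqP; rewrite -subr_eq0 addrC; apply/eqP.
  refine (@weight_component _ _ _ _ _ hr s (fun x => x = 0) _ r (fun t => hval t) (fun t => hwt t) eta (- x) _ _ _ _).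
  - by split; [apply: subsp_zero | move=> i y _ ->; apply: (E0 hr)].
  - by move=> t; apply: hval_wv.
  - by move=> i hi; rewrite (EN hr) hw // scalerN.
  by rewrite -e addNr.
have [t ht] : exists t : hwvec V s w p0, same s (hwt t) eta.
  apply: contrapT => hn; apply: x0; rewrite ex big1 // => t ht.
  by case: hn; exists t.
have [a [c [h1 h2]]] := hwt_par t.
have eo : odd_weight s eta = odd_weight s (hwt t).
  by apply: eq_bigr => i _; move/allP: ht => /(_ i (hs i)) /eqP.
exists (hpar t), a, c; split=> //; last by rewrite eo.
rewrite {1}ex; apply: homog_sum => t' ht'.
rewrite (_ : hpar t = hpar t'); first exact: hval_homog.
apply: (same_hpar hs); apply/allP => i hi.
by rewrite (eqP (allP ht i hi)) (eqP (allP ht' i hi)).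
Qed.

Lemma homog_components p x : homog p x -> gen (@sm_op F m n V) s v x ->
  exists r : seq (hwvec V s w p0), x = \sum_(t <- r | hpar t == p) hval t.
Proof.
move=> hp hx; have [r e] := gen_homog_weight us hs hv v0 hx; exists r.
have h1 : homog p (\sum_(t <- r | hpar t == p) hval t).
  by apply: homog_sum => t /eqP <-; apply: hval_homog.
have h2 : homog (~~ p) (\sum_(t <- r | hpar t != p) hval t).
  by apply: homog_sum => t; have := hval_homog t; case: p (hpar t) {hp h1} => [] [].
have e2 : x = \sum_(t <- r | hpar t == p) hval t + \sum_(t <- r | hpar t != p) hval t.
  by rewrite e (bigID (fun t => hpar t == p)).
by have := homog_eq h1 h2; rewrite -e2 => /(_ hp) h0; rewrite e2 h0 addr0.
Qed.
End Components.

Lemma parity_shift (x y a c a' c' k l r q p : bool) :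
  x (+) c' (+) a (+) (k && r) = y (+) c (+) a' (+) (k && l) ->
  q (+) p (+) (x (+) y (+) (k && (l (+) r))) (+) (p (+) (a' (+) c')) = q (+) (a (+) c).
Proof.
by case: x; case: y; case: a; case: c; case: a'; case: c'; case: k; case: l; case: r; case: q; case: p.
Qed.

Section Main.
Variables (F : numClosedFieldType) (m n : nat) (hmn : (1 <= m + n)%N) (b : edseq m n).
Variables (lam : int_partition) (hlam : hook m n lam) (V : supermodule F m n).
Hypothesis hV : is_simple_hw b (lambda_wt F b lam) V.
Variable W : branching_set b lam -> supermodule F (mhat b) (nhat b).
Hypothesis hW : forall sigma : branching_set b lam,
  is_simple_hw (hat b) (lambda_wt F (hat b) (val sigma)) (W sigma).

Local Notation I := 'I_(m + n).
Local Notation J := 'I_(mhat b + nhat b).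
Local Notation par := (@parity m n).
Local Notation parJ := (@parity (mhat b) (nhat b)).
Local Notation h := (@hat_idx m n b).
Local Notation s' := (ord_labels (hat b)).
Local Notation t := (map h s').

Lemma gl_embed_act (A : 'M[F]_(mhat b + nhat b)) (x : V) :
  sm_act (gl_embed A) x = \sum_a \sum_c A a c *: sm_op (h a) (h c) x.
Proof.
rewrite /gl_embed sm_act_suml; apply: eq_bigr => a _.
by rewrite sm_act_suml; apply: eq_bigr => c _; rewrite sm_actZl.
Qed.

(** [V] is identified with the unitary model, whose restriction decomposes by [full_branching]; each
    summand is irreducible for the subalgebra and is identified with the corresponding [W sigma] by
    a second use of [hw_iso]. The component of the resulting map at [sg] is [f0 _ sg]. *)
Lemma branching_rule : exists sh : branching_set b lam -> bool,
  sm_iso (sm_restrict b V) (sm_dsum (fun sigma => pshift (sh sigma) (W sigma))).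
Proof.
have [N eN hN] := ord_labels_rcons b hmn.
have [simV [v hv0]] := hV.
have hvV := lambda_hwv hv0; have [_ [p0 vp0] _ _] := hv0.
have uo := ord_labels_uniq b; have mo := @mem_ord_labels m n b.
have hko : hk (map par (ord_labels b)) lam by apply/hook_hk.
have genV x : gen (@sm_op F m n V) (ord_labels b) v x by apply: (simple_gen uo mo hvV vp0 simV).
have irrV := simple_irred uo mo hvV vp0 simV.
(* The unitary model, built from tensor products independently of [V]; its dimension is known
   exactly, which [full_branching] needs. *)
have [X [E [dot [x0 [rep pol her hx hdim]]]]] := exists_model F uo mo hko (leqnn (sumn lam)).
have irrX := hwv_irred rep pol her uo hx.
have [phi [phig phil phiE phi0 phis]] := hw_iso (glrep_sm V) rep uo hvV hx irrV irrX.
have us : uniq (rcons t N) by rewrite -eN.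
have hkt : hk (map par (rcons t N)) lam by rewrite -eN.
have hxt : hwv E (rcons t N) (natw F (wt par (rcons t N) lam)) x0 by rewrite -eN.
have hdimt : \dim (vspan (gen E (rcons t N) x0)) = sst (sumn lam) (rev (map par (rcons t N))) lam by rewrite -eN.
have [z [zh zg zdec zun]] := full_branching rep pol her us hkt (leqnn _) hxt hdimt.
rewrite -eN in zg zdec.
set L := branch_list par t N lam (sumn lam) in zh zg zdec zun.
have ut : uniq t by move: us; rewrite rcons_uniq => /andP[].
have inL (sig : branching_set b lam) : val sig \in L.
  have /(branching_setP hmn lam _ hN) hs := set_mem (valP sig).
  rewrite mem_filter hs mem_boxed; case/andP: hs => /andP[_ hs] _.
  exact: subpart_sumn.
have Lin sig : sig \in L -> exists sg : branching_set b lam, val sg = sig.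
  rewrite mem_filter => /andP[hs _].
  have hb : branching_set b lam sig by apply/(branching_setP hmn lam _ hN).
  by exists (SigSub (mem_set hb)).
pose EJ := pull_op h E.
have repJ : glrep parJ EJ := glrep_pull (@hat_idx_inj m n b) (@parity_hat_idx m n b) rep.
have us' := ord_labels_uniq (hat b); have ms' := @mem_ord_labels _ _ (hat b).
have exW sg : exists psi : X -> W sg, exists w : W sg, exists q : bool,
  [/\ hwv (@sm_op F _ _ (W sg)) s' (natw F (wt parJ s' (val sg))) w, homog q w,
      forall x, gen (@sm_op F _ _ (W sg)) s' w x &
  [/\ forall c x y, gen EJ s' (z (val sg)) x -> gen EJ s' (z (val sg)) y -> psi (c *: x + y) = c *: psi x + psi y,
    forall i j x, gen EJ s' (z (val sg)) x -> psi (EJ i j x) = sm_op i j (psi x),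
    forall x, gen EJ s' (z (val sg)) x -> psi x = 0 -> x = 0
  & forall y, exists2 x, gen EJ s' (z (val sg)) x & psi x = y]].
  have [simW [w hw0]] := hW sg; have hw := lambda_hwv hw0; have [_ [q wq] _ _] := hw0.
  have genW := simple_gen us' ms' hw wq simW; have irrW := simple_irred us' ms' hw wq simW.
  have hz : hwv EJ s' (natw F (wt parJ s' (val sg))) (z (val sg)).
    have := hwv_pull (@hat_idx_inj m n b) (zh _ (inL sg)); apply: hwv_ext => a _.
    by rewrite /natw /= (wt_pull (@hat_idx_inj m n b) (@parity_hat_idx m n b)).
  have irrz : irred EJ s' (z (val sg)).
    by apply: irred_pull; apply: (hwv_irred rep pol her ut (zh _ (inL sg))).
  have [psi [_ psil psiE psi0 psis]] := hw_iso repJ (glrep_sm (W sg)) us' hz hw irrz irrW.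
  exists psi, w, q; split=> //; split=> // [i j x hx'|y]; first by apply: psiE.
  exact: psis.
pose psi sg : X -> W sg := projT1 (cid (exW sg)).
have hpsi sg : exists w : W sg, exists q : bool,
  [/\ hwv (@sm_op F _ _ (W sg)) s' (natw F (wt parJ s' (val sg))) w, homog q w,
      forall x, gen (@sm_op F _ _ (W sg)) s' w x &
  [/\ forall c x y, gen EJ s' (z (val sg)) x -> gen EJ s' (z (val sg)) y -> psi sg (c *: x + y) = c *: psi sg x + psi sg y,
    forall i j x, gen EJ s' (z (val sg)) x -> psi sg (EJ i j x) = sm_op i j (psi sg x),
    forall x, gen EJ s' (z (val sg)) x -> psi sg x = 0 -> x = 0
  & forall y, exists2 x, gen EJ s' (z (val sg)) x & psi sg x = y]].
  exact: (projT2 (cid (exW sg))).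
have genz (sg : branching_set b lam) x : gen E t (z (val sg)) x -> gen EJ s' (z (val sg)) x by move=> hx1; apply/gen_pull.
(* A choice of components of [y] in the decomposition. By directness it is unique on [L], which
   yields linearity and equivariance there. *)
pose dec (y : X) : int_partition -> X := xget (fun _ => 0) [set p | (forall sig, sig \in L -> gen E t (z sig) (p sig)) /\
  y = \sum_(sig <- L) p sig].
have decP y : gen E (ord_labels b) x0 y ->
    (forall sig, sig \in L -> gen E t (z sig) (dec y sig)) /\ y = \sum_(sig <- L) dec y sig.
  move=> hy; have [p hp] := zdec _ hy.
  by apply: (@xgetPex _ (fun _ => 0) [set p | (forall sig, sig \in L -> gen E t (z sig) (p sig)) /\
    y = \sum_(sig <- L) p sig]); exists p.
have decU y p : gen E (ord_labels b) x0 y -> (forall sig, sig \in L -> gen E t (z sig) (p sig)) ->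
    y = \sum_(sig <- L) p sig -> forall sig, sig \in L -> dec y sig = p sig.
  move=> hy hp e sig hs; have [hd ed] := decP y hy.
  apply/eqP; rewrite -subr_eq0; apply/eqP.
  apply: (zun (fun sig => dec y sig - p sig)) => // [sg hsg|].
    by apply: (subspB (subsp_gen _ _ _)); [apply: hd | apply: hp].
  by rewrite sumrB -ed -e subrr.
have decL c y y' : gen E (ord_labels b) x0 y -> gen E (ord_labels b) x0 y' -> forall sig, sig \in L ->
    dec (c *: y + y') sig = c *: dec y sig + dec y' sig.
  move=> hy hy'; have [hd ed] := decP y hy; have [hd' ed'] := decP y' hy'.
  apply: (decU _ (fun sig => c *: dec y sig + dec y' sig)); first exact: gen_lin.
    by move=> sg hsg; apply: gen_lin; [apply: hd | apply: hd'].
  by rewrite big_split /= -scaler_sumr -ed -ed'.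
have decE a c y : gen E (ord_labels b) x0 y -> forall sig, sig \in L ->
    dec (E (h a) (h c) y) sig = E (h a) (h c) (dec y sig).
  move=> hy; have [hd ed] := decP y hy.
  apply: (decU _ (fun sig => E (h a) (h c) (dec y sig))); first by apply: gen_act.
    by move=> sg hsg; apply: gen_act; rewrite ?map_f //; apply: hd.
  by rewrite {1}ed (Esum rep).
pose f0 (u : V) sg : W sg := psi sg (dec (phi u) (val sg)).
have gphi u := phig u (genV u).
have gdec u (sg : branching_set b lam) : gen EJ s' (z (val sg)) (dec (phi u) (val sg)).
  by apply: (genz sg); have [hd _] := decP _ (gphi u); exact: (hd _ (inL sg)).
have f0L sg c u u' : f0 (c *: u + u') sg = c *: f0 u sg + f0 u' sg.
  have [_ [_ [_ _ _ [psil _ _ _]]]] := hpsi sg.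
  by rewrite /f0 phil // decL ?inL // psil.
have f0E sg a c u : f0 (sm_op (h a) (h c) u) sg = sm_op a c (f0 u sg).
  have [_ [_ [_ _ _ [_ psiE _ _]]]] := hpsi sg.
  by rewrite /f0 phiE // decE ?inL // psiE.
have f0_sum sg T (r : seq T) (P : pred T) (u : T -> V) :
    f0 (\sum_(k <- r | P k) u k) sg = \sum_(k <- r | P k) f0 (u k) sg.
  have z1 : f0 0 sg = 0.
    by have := f0L sg (-1) 0 0; rewrite scaler0 addr0 scaleN1r addNr.
  apply: (big_morph (fun u => f0 u sg)) => // x y.
  by have := f0L sg 1 x y; rewrite !scale1r.
have osum (g : I -> F) : odd_weight (ord_labels b) g = odd_weight s' (fun a => g (h a)) + (par N)%:R * g N.
  rewrite /odd_weight eN -cats1 big_cat big_map /= [X in _ + X]big_mkcond big_seq1; congr (_ + _).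
    by apply: eq_bigl => j; rewrite parity_hat_idx.
  by case: (par N); rewrite ?mul1r ?mul0r.
have tsum (g : I -> F) : \sum_(i <- ord_labels b) g i = \sum_(i <- s') g (h i) + g N.
  by rewrite eN -cats1 big_cat big_map big_seq1.
have f0_homog sg : exists sh : bool, forall p u, homog p u -> homog (sh (+) p) (f0 u sg).
  have [w [q [hw wq genW _]]] := hpsi sg.
  pose oL := (\sum_(i <- ord_labels b | par i) wt par (ord_labels b) lam i)%N.
  pose oS := (\sum_(a <- s' | parJ a) wt parJ s' (val sg) a)%N.
  (* A weight vector of [V] has parity [p0] plus the change of its odd weight from that of [lam],
     and its image has parity [q] plus the change from that of [sg]. The two odd weights differ by
     the coordinate at [N] when [N] is odd, and this coordinate is [sumn lam - sumn (val sg)] by the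
     total weights; so the difference of parities does not depend on the vector. *)
  exists (q (+) p0 (+) odd (oL + oS + par N * (sumn lam + sumn (val sg)))) => p u hu.
  have [r ->] := homog_components uo mo hvV vp0 hu (genV u).
  rewrite f0_sum; apply: homog_sum => k /eqP <-.
  case: (pselect (f0 (hval k) sg = 0)) => [->|nz]; first exact: homog0.
  have uk0 : hval k <> 0.
    move=> e; apply: nz; rewrite e.
    by have := f0L sg (-1) 0 0; rewrite scaler0 addr0 scaleN1r addNr.
  have wy : wv (@sm_op F _ _ (W sg)) s' (fun a => hwt k (h a)) (f0 (hval k) sg).
    move=> a _; rewrite -f0E (hval_wv k) //.
    have := f0L sg (hwt k (h a)) (hval k) 0; rewrite addr0 => ->.
    have := f0L sg (-1) 0 0; rewrite scaler0 addr0 scaleN1r addNr => ->.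
    by rewrite addr0.
  have [q' [a [c [hq' e1 eq']]]] := wv_homog us' ms' hw wq (genW _) wy nz.
  have [a' [c' [e2 e3]]] := hwt_par k.
  have tot1 := total_weight (glrep_sm V) uo hvV (genV _) (hval_wv k) uk0.
  have tot2 := total_weight (glrep_sm (W sg)) us' hw (genW _) wy nz.
  have o1 := osum (hwt k).
  have t1 : \sum_(i <- s') hwt k (h i) + hwt k N = (sumn lam)%:R.
    by rewrite (sumn_wt uo hko) natr_sum -tot1 tsum.
  have hks : hk (map parJ s') (val sg).
    have := inL sg; rewrite mem_filter => /andP[/andP[_ hh] _].
    by move: hh; rewrite -map_comp (eq_map (@parity_hat_idx m n b)).
  have t2 : \sum_(i <- s') hwt k (h i) = (sumn (val sg))%:R.
    by rewrite (sumn_wt us' hks) natr_sum.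
  rewrite t2 in t1.
  have oLE : odd_weight (ord_labels b) (natw F (wt par (ord_labels b) lam)) = oL%:R by rewrite natr_sum.
  have oSE : odd_weight s' (natw F (wt parJ s' (val sg))) = oS%:R by rewrite natr_sum.
  (* The comparison of odd weights, rearranged so that all terms are added and it can be read in the
     naturals and then modulo 2. *)
  have key : (oL + c' + a + par N * sumn (val sg) = oS + c + a' + par N * sumn lam)%N.
    apply/eqP; rewrite -(eqr_nat F) !natrD !natrM -oLE -oSE -e2 -e1 o1 -t1; apply/eqP; ring.
  suff -> : q (+) p0 (+) odd (oL + oS + par N * (sumn lam + sumn (val sg))) (+) hpar k = q' by [].
  rewrite e3 eq'; have := congr1 odd key; rewrite !oddD !oddM !oddD.
  exact: parity_shift.
pose sh sg := projT1 (cid (f0_homog sg)).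
have shP sg p u : homog p u -> homog (sh sg (+) p) (f0 u sg) := projT2 (cid (f0_homog sg)) p u.
(* The branching set is finite, so every family of components has finite support and defines an
   element of the direct sum. *)
have finT : finite_set [set: branching_set b lam].
  have : finite_set ((fun sg : branching_set b lam => val sg) @^-1` [set` L]).
    by apply: finite_preimage; [move=> x y _ _; apply: val_inj | apply: finite_seq].
  by apply: sub_finite_set => sg _ /=; apply: inL.
have fin (g : forall sg, W sg) : finite_set [set sg | g sg != 0] := sub_finite_set (@subsetT _ _) finT.
pose f (u : sm_restrict b V) : sm_dsum (fun sg => pshift (sh sg) (W sg)) :=
  @DSum F _ (fun sg => pshift (sh sg) (W sg)) (f0 u) (fin (f0 u)).
have fl : linear f.
  by move=> c u u'; apply: dsumP => sg; apply: f0L.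
pose fL := GRing.isLinear.Build _ _ _ _ f fl.
pose g : {linear sm_restrict b V -> sm_dsum (fun sg => pshift (sh sg) (W sg))} := HB.pack f fL.
exists sh, g; split.
- have finj : forall u, f u = 0 -> u = 0.
    move=> u e; apply: phi0 (genV u) _; have [hd ed] := decP _ (gphi u).
    rewrite ed big_seq big1 // => sig /Lin [sg <-].
    have [_ [_ [_ _ _ [_ _ psi0 _]]]] := hpsi sg.
    by apply: psi0 (gdec u sg) _; have := congr1 (fun d : dsum _ => d sg) e.
  have fsurj d : exists u, f u = d.
    pose P sig y := exists sg : branching_set b lam, [/\ val sg = sig, gen EJ s' (z (val sg)) y & psi sg y = d sg].
    have exP sig : sig \in L -> exists y, P sig y.
      move=> /Lin [sg <-]; have [_ [_ [_ _ _ [_ _ _ psis]]]] := hpsi sg.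
      by have [y hy ey] := psis (d sg); exists y, sg.
    pose p sig := xget 0 [set y | P sig y].
    have hp sig : sig \in L -> P sig (p sig).
      by move=> /exP [y hy]; apply: (@xgetPex _ 0 [set y | P sig y]); exists y.
    have gp sig : sig \in L -> gen E t (z sig) (p sig).
      by move=> /hp [sg [<- hy _]]; exact: (proj1 (gen_pull h E s' (z (val sg)) _) hy).
    have gy : gen E (ord_labels b) x0 (\sum_(sig <- L) p sig).
      rewrite big_seq; apply: (subsp_sum (subsp_gen _ _ _)) => sig hs.
      exact: zg (gp _ hs).
    have [u _ eu] := phis _ gy; exists u; apply: dsumP => sg.
    rewrite /f /= /f0 eu (decU _ p gy gp) ?inL //.
    have [sg' [/val_inj e _ es]] := hp _ (inL sg).
    by move: es; rewrite e.
  have fi : injective f.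
    move=> u u' e; apply/eqP; rewrite -subr_eq0; apply/eqP; apply: finj.
    by have := linearB g u u'; rewrite /= e subrr.
  pose inv d := projT1 (cid (fsurj d)).
  have invP d : f (inv d) = d := projT2 (cid (fsurj d)).
  by exists inv => [u|d]; [apply: fi; rewrite invP | apply: invP].
- by move=> p u hu sg; apply: shP.
move=> A u; apply: dsumP => sg; rewrite /= /f0.
have -> : sm_act (gl_embed A) u = \sum_(a <- index_enum J) \sum_(c <- index_enum J) A a c *: sm_op (h a) (h c) u.
  exact: gl_embed_act.
rewrite -/(f0 _ sg) f0_sum [RHS](sm_actE A (f0 u sg : W sg)).
apply: eq_bigr => a _; rewrite f0_sum; apply: eq_bigr => c _.
have := f0L sg (A a c) (sm_op (h a) (h c) u) 0; rewrite addr0 f0E => ->.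
by have := f0L sg (-1) 0 0; rewrite scaler0 addr0 scaleN1r addNr => ->; rewrite addr0.
Qed.
End Main.

Theorem theorem3p1p1 (R : realType) (m n : nat) (hmn : (1 <= m + n)%N)
    (b : edseq m n) (lam : int_partition) (hlam : hook m n lam)
    (V : supermodule (complex R) m n)
    (hV : is_simple_hw b (lambda_wt (complex R) b lam) V)
    (W : branching_set b lam -> supermodule (complex R) (mhat b) (nhat b))
    (hW : forall sigma : branching_set b lam,
        is_simple_hw (hat b) (lambda_wt (complex R) (hat b) (val sigma))
          (W sigma)) :
  exists sh : branching_set b lam -> bool,
    sm_iso (sm_restrict b V) (sm_dsum (fun sigma => pshift (sh sigma) (W sigma))).
Proof. exact: (branching_rule hmn hlam hV hW). Qed.
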